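(* There is an algorithm which, given any instance of Max $(r,2)$-CSP with $n$ variables, $m$ dyadic constraints (edges of the constraint graph) and input length $L$, finds the maximum score and an assignment attaining it in time $O(n\, r^{3+m/5})$ and space $O(L)$.
   Context: An instance of Max $(r,2)$-CSP, for an integer $r\ge 2$, consists of a finite simple graph $G=(V,E)$ (the constraint graph) with $V=\{1,\dots,n\}$, $n\ge 1$, and $m=|E|$ edges (each edge written $uv$ with $u<v$), together with real-valued score functions: a constant $s_\emptyset\in\mathbb{R}$, a function $s_v:[r]\to\mathbb{R}$ for each vertex $v$ (monadic constraints), and a function $s_{uv}:[r]^2\to\mathbb{R}$ for each edge $uv$ (dyadic constraints), where $[r]=\{1,\dots,r\}$. An assignment is a map $\phi:V\to[r]$, with score $s(\phi)=s_\emptyset+\sum_{v\in V}s_v(\phi(v))+\sum_{uv\in E}s_{uv}(\phi(u),\phi(v))$. Solving an instance means outputting the maximum score and an assignment attaining it. The input length is $L=1+nr+mr^2$. The computational model is a RAM in which each addition, subtraction or comparison of real numbers takes time and space $O(1)$. The notation $f=O(g)$ means there is an absolute constant $C$ such that $f\le Cg$ for all values of all arguments. *)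

(* Defs.v *)
From HB Require Import structures.
From mathcomp Require Import all_boot all_order all_algebra.
From mathcomp Require Import reals exp.

Set Implicit Arguments.
Unset Strict Implicit.
Unset Printing Implicit Defensive.

Import Order.TTheory GRing.Theory Num.Theory.
Local Open Scope ring_scope.

(** * Max (r,2)-CSP *)

(* Variables and colours are numbered from 0.  The dyadic score [dyadic u v i j]
   is meaningful only when uv is an edge with u < v; its values at other pairs
   (u, v) are used neither by [score] nor by the input encoding. *)
Record max2csp (R : realType) (n r : nat) := Max2CSP {
  adj : rel 'I_n;
  adj_sym : symmetric adj;
  adj_irr : irreflexive adj;
  nullary : R;
  monadic : 'I_n -> 'I_r -> R;
  dyadic : 'I_n -> 'I_n -> 'I_r -> 'I_r -> R }.

Section Instance.
Variables (R : realType) (n r : nat).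
Implicit Types (I : max2csp R n r) (phi : {ffun 'I_n -> 'I_r}).
Implicit Types es : seq ('I_n * 'I_n).

Definition edges I : {set 'I_n * 'I_n} :=
  [set e | adj I e.1 e.2 & (e.1 < e.2)%N].

Definition score I phi : R :=
  nullary I + \sum_(v : 'I_n) monadic I v (phi v)
  + \sum_(e in edges I) dyadic I e.1 e.2 (phi e.1) (phi e.2).

Definition optimal I phi : Prop := forall psi, score I psi <= score I phi.

Definition input_length I : nat := 1 + n * r + #|edges I| * r ^ 2.

End Instance.

(** * Real RAM

   There are two kinds of data: natural numbers and real numbers.  Each kind
   has its own registers, named in the instructions, and its own random-access
   memory, addressed indirectly through natural-number registers.  A program
   is a finite list of instructions, so it names finitely many registers.
   Every instruction takes one unit of time.  The only operations on reals are
   copying, addition, subtraction and comparison. *)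

Inductive instr :=
| IConst of nat & nat          (* x_d := k *)
| IAdd of nat & nat & nat      (* x_d := x_a + x_b *)
| ISub of nat & nat & nat      (* x_d := x_a - x_b, truncated at 0 *)
| IMul of nat & nat & nat      (* x_d := x_a * x_b *)
| ILoad of nat & nat           (* x_d := M[x_a] *)
| IStore of nat & nat          (* M[x_a] := x_b *)
| RAdd of nat & nat & nat      (* y_d := y_a + y_b *)
| RSub of nat & nat & nat      (* y_d := y_a - y_b *)
| RLoad of nat & nat           (* y_d := N[x_a] *)
| RStore of nat & nat          (* N[x_a] := y_b *)
| Jump of nat                  (* goto l *)
| IJumpLe of nat & nat & nat   (* if x_a <= x_b then goto l *)
| RJumpLe of nat & nat & nat.  (* if y_a <= y_b then goto l *)

Definition program := seq instr.

Section RAM.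
Variable R : realType.

Record config := Config {
  pc : nat;
  ireg : nat -> nat;    (* x *)
  rreg : nat -> R;      (* y *)
  imem : nat -> nat;    (* M *)
  rmem : nat -> R }.    (* N *)

Definition exec (i : instr) (c : config) : config :=
  let: Config p x y M N := c in
  match i with
  | IConst d k => Config p.+1 [eta x with d |-> k] y M N
  | IAdd d a b => Config p.+1 [eta x with d |-> (x a + x b)%N] y M N
  | ISub d a b => Config p.+1 [eta x with d |-> (x a - x b)%N] y M N
  | IMul d a b => Config p.+1 [eta x with d |-> (x a * x b)%N] y M N
  | ILoad d a => Config p.+1 [eta x with d |-> M (x a)] y M N
  | IStore a b => Config p.+1 x y [eta M with x a |-> x b] N
  | RAdd d a b => Config p.+1 x [eta y with d |-> y a + y b] M N
  | RSub d a b => Config p.+1 x [eta y with d |-> y a - y b] M N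
  | RLoad d a => Config p.+1 x [eta y with d |-> N (x a)] M N
  | RStore a b => Config p.+1 x y M [eta N with x a |-> y b]
  | Jump l => Config l x y M N
  | IJumpLe a b l => Config (if (x a <= x b)%N then l else p.+1) x y M N
  | RJumpLe a b l => Config (if y a <= y b then l else p.+1) x y M N
  end.

(* A configuration is halted when its program counter is past the end of the
   program. *)
Definition step (P : program) (c : config) : config :=
  if onth P (pc c) is Some i then exec i c else c.

Definition halted (P : program) (c : config) : bool := (size P <= pc c)%N.

Definition run (P : program) (c : config) (t : nat) : config := iter t (step P) c.

(* [accesses_below S P c]: the memory access made by the next instruction, if
   any, is at an address less than S. *)
Definition accesses_below (S : nat) (P : program) (c : config) : bool :=
  match onth P (pc c) with
  | Some (ILoad _ a) | Some (IStore a _)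
  | Some (RLoad _ a) | Some (RStore a _) => (ireg c a < S)%N
  | _ => true
  end.

Definition words_at_most (W : nat) (c : config) : Prop :=
  forall k, (ireg c k <= W)%N /\ (imem c k <= W)%N.

(* The first t steps from c use only the first S cells of each of the two
   memories, and no natural number exceeding W ever occurs.  The bound W is
   needed because space is counted in cells: without it, one cell could hold
   an arbitrarily long string. *)
Definition runs_in_space (S W : nat) (P : program) (c : config) (t : nat) : Prop :=
  forall k, (k <= t)%N ->
    accesses_below S P (run P c k) /\ words_at_most W (run P c k).

(** ** Input and output conventions *)

Variables n r : nat.
Implicit Types (I : max2csp R n r) (es : seq ('I_n * 'I_n)).

Definition int_input es : seq nat :=
  flatten [seq [:: val e.1; val e.2] | e <- es].

Definition real_input I es : seq R :=
  nullary I
  :: [seq monadic I v i | v <- enum 'I_n, i <- enum 'I_r]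
  ++ flatten [seq [seq dyadic I e.1 e.2 i j | i <- enum 'I_r, j <- enum 'I_r]
             | e <- es].

(* The list es enumerates the edges.  Unused registers and cells hold 0. *)
Definition initial I es : config :=
  Config 0
    (nth 0%N [:: n; r; size es]) (fun _ => 0)
    (nth 0%N (int_input es)) (nth 0 (real_input I es)).

(* The maximum score is in y_0, and an assignment attaining it is in
   M[0], ..., M[n-1]. *)
Definition outputs_optimum I (c : config) : Prop :=
  exists phi : {ffun 'I_n -> 'I_r},
    [/\ optimal I phi, rreg c 0 = score I phi
      & forall v : 'I_n, imem c v = phi v].

(* The scores as listed in the input fill exactly L cells. *)
Lemma size_real_input I es :
  perm_eq es (enum (edges I)) -> size (real_input I es) = input_length I.
Proof.
move=> /perm_size; rewrite -cardE /input_length => <-.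
rewrite /real_input /= size_cat size_allpairs !size_enum_ord -addnA; congr _.+1.
congr addn; elim: es => //= e es IH.
by rewrite size_cat IH size_allpairs size_enum_ord -mulnn mulSn.
Qed.

End RAM.

(* Main.v *)
Require Import Defs.
From HB Require Import structures.
From mathcomp Require Import all_boot all_order all_algebra.
From mathcomp Require Import reals exp zify.

Set Implicit Arguments.
Unset Strict Implicit.
Unset Printing Implicit Defensive.

Import Order.TTheory GRing.Theory Num.Theory.
Local Open Scope ring_scope.

(* A vertex of degree at most 2 can be eliminated by maximizing over its colour:
   this changes the table of one vertex or of one edge, possibly a new one, and
   costs O(r^3).  While no vertex has degree 1 or 2, put a vertex of maximum
   degree into the branching set B and delete its edges.  Give a vertex of degree
   d the weight 0 if d <= 2, 5 if d = 3 and 2d if d >= 4.  The total weight is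
   at most 4m at the start, no elimination increases it, and each branching
   decreases it by at least 20; so |B| <= m/5.  For each of the r^|B| colourings
   of B, executing the eliminations costs O((n + m) r^3), and retracing them
   recovers a best extension.

   B and the list of eliminations do not depend on the scores, so they are
   computed once, and the search needs no recursion.  The algorithm is written
   in a small language of while programs over arrays, whose programs are
   compiled to the RAM; its time and its correctness are proved with Hoare
   triples. *)

(** Linear space forbids keeping a copy of the tables for each level of a recursion. One uniform
    operation on a single working table removes the need. A table that has been consumed is never
    written again, so it can still be read after the last operation, and a maximizing colour is
    recomputed in the retracing instead of being stored. A new edge takes a fresh table, but two
    live edges are deleted with it, so 2m edge tables suffice.

    The count of branchings needs both rules of choice. Each neighbour of the chosen y has degree at
    least 3, because no degree is 1 or 2, and at most that of y, because the latter is maximal; this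
    bounds from below the weight which the neighbour loses with its edge to y. That the edges at y
    lead to distinct neighbours is why the graph is kept simple. *)

Definition upd T (f : nat -> T) k x := fun i => if i == k then x else f i.

(** * A while language over arrays: syntax, semantics and compilation *)

Inductive iexp :=
| Var of nat
| Cst of nat
| Add of iexp & iexp
| Minus of iexp & iexp
| Mul of iexp & iexp
| Ld of nat & iexp.

Inductive cmd :=
| Skip
| Seq of cmd & cmd
| ISet of nat & iexp
| ISt of nat & iexp & iexp
| RLd of nat & nat & iexp
| RSt of nat & iexp & nat
| RSum of nat & nat & nat
| If of iexp & iexp & cmd & cmd
| IfR of nat & nat & cmd & cmd
| While of iexp & iexp & cmd.

Section Semantics.
Variables (R : realType) (S : nat).
Local Open Scope nat_scope.

(** [tm] is a ghost clock: one tick for each elementary command and each test, readable by no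
    expression. *)
Record st := St {
  v : nat -> nat;
  w : nat -> R;
  ia : nat -> nat -> nat;
  ra : nat -> nat -> R;
  tm : nat }.

Definition setv s d x := St (upd (v s) d x) (w s) (ia s) (ra s) (tm s).+1.
Definition setw s d x := St (v s) (upd (w s) d x) (ia s) (ra s) (tm s).+1.
Definition seti s a i x :=
  St (v s) (w s) (upd (ia s) a (upd (ia s a) i x)) (ra s) (tm s).+1.
Definition setr s a i x :=
  St (v s) (w s) (ia s) (upd (ra s) a (upd (ra s a) i x)) (tm s).+1.
Definition tick s := St (v s) (w s) (ia s) (ra s) (tm s).+1.

Fixpoint eval e s : nat :=
  match e with
  | Var k => v s k
  | Cst k => k
  | Add e1 e2 => eval e1 s + eval e2 s
  | Minus e1 e2 => eval e1 s - eval e2 s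
  | Mul e1 e2 => eval e1 s * eval e2 s
  | Ld a e => ia s a (eval e s)
  end.

Fixpoint eok e s : bool :=
  match e with
  | Var _ | Cst _ => true
  | Add e1 e2 | Minus e1 e2 | Mul e1 e2 => eok e1 s && eok e2 s
  | Ld a e => (eval e s < S) && eok e s
  end.

(** A command that indexes an array at S or beyond, or stores a natural above S, has no derivation.
    Exhibiting an execution therefore proves safety as well as termination. *)
Inductive bs : cmd -> st -> st -> Prop :=
| BSkip s : bs Skip s s
| BSeq c1 c2 s s1 s2 : bs c1 s s1 -> bs c2 s1 s2 -> bs (Seq c1 c2) s s2
| BISet d e s : eok e s -> eval e s <= S -> bs (ISet d e) s (setv s d (eval e s))
| BISt a e1 e2 s : eok e1 s -> eok e2 s -> eval e1 s < S -> eval e2 s <= S ->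
    bs (ISt a e1 e2) s (seti s a (eval e1 s) (eval e2 s))
| BRLd d a e s : eok e s -> eval e s < S ->
    bs (RLd d a e) s (setw s d (ra s a (eval e s)))
| BRSt a e b s : eok e s -> eval e s < S ->
    bs (RSt a e b) s (setr s a (eval e s) (w s b))
| BRSum d a b s : bs (RSum d a b) s (setw s d (w s a + w s b)%R)
| BIf e1 e2 c1 c2 s s' : eok e1 s -> eok e2 s ->
    bs (if eval e1 s <= eval e2 s then c1 else c2) (tick s) s' ->
    bs (If e1 e2 c1 c2) s s'
| BIfR a b c1 c2 s s' :
    bs (if (w s a <= w s b)%R then c1 else c2) (tick s) s' ->
    bs (IfR a b c1 c2) s s'
| BWhile0 e1 e2 c s : eok e1 s -> eok e2 s -> eval e2 s <= eval e1 s ->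
    bs (While e1 e2 c) s (tick s)
| BWhileS e1 e2 c s s1 s2 : eok e1 s -> eok e2 s -> eval e1 s < eval e2 s ->
    bs c s s1 -> bs (While e1 e2 c) (tick s1) s2 -> bs (While e1 e2 c) s s2.

End Semantics.

(* Language variables are the registers below 40 (register 3 holds the segment
   size), and cell i of array a is at address a * S + i. *)
Fixpoint cexp t e : program :=
  match e with
  | Var k => [:: IConst t 0; IAdd t k t]
  | Cst k => [:: IConst t k]
  | Add e1 e2 => cexp t e1 ++ cexp t.+1 e2 ++ [:: IAdd t t t.+1]
  | Minus e1 e2 => cexp t e1 ++ cexp t.+1 e2 ++ [:: ISub t t t.+1]
  | Mul e1 e2 => cexp t e1 ++ cexp t.+1 e2 ++ [:: IMul t t t.+1]
  | Ld a e => cexp t e ++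
      [:: IConst t.+1 a; IMul t.+1 t.+1 3; IAdd t t t.+1; ILoad t t]
  end.

Definition caddr a e : program :=
  cexp 40 e ++ [:: IConst 41 a; IMul 41 41 3; IAdd 40 40 41].

(** Jump targets depend on the length of code not yet emitted, so lengths are computed beforehand;
    they do not depend on the offset. *)
Fixpoint csize c : nat :=
  match c with
  | Skip => 0
  | Seq c1 c2 => csize c1 + csize c2
  | ISet d e => size (cexp 40 e) + 2
  | ISt a e1 e2 => size (caddr a e1) + (size (cexp 41 e2) + 1)
  | RLd _ a e | RSt a e _ => size (caddr a e) + 1
  | RSum _ _ _ => 1
  | If e1 e2 c1 c2 =>
      size (cexp 40 e1) + (size (cexp 41 e2) + (1 + (csize c2 + (1 + csize c1))))
  | IfR _ _ c1 c2 => 1 + (csize c2 + (1 + csize c1))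
  | While e1 e2 c => size (cexp 40 e2) + (size (cexp 41 e1) + (1 + (csize c + 1)))
  end%N.

(** Jumps are absolute, so [off] is the address of the first instruction. In a conditional, the
    branch for a true comparison comes last. *)
Fixpoint comp off c : program :=
  match c with
  | Skip => [::]
  | Seq c1 c2 => comp off c1 ++ comp (off + csize c1) c2
  | ISet d e => cexp 40 e ++ [:: IConst 41 0; IAdd d 40 41]
  | ISt a e1 e2 => caddr a e1 ++ cexp 41 e2 ++ [:: IStore 40 41]
  | RLd d a e => caddr a e ++ [:: RLoad d 40]
  | RSt a e b => caddr a e ++ [:: RStore 40 b]
  | RSum d a b => [:: RAdd d a b]
  | If e1 e2 c1 c2 =>
      let k := off + size (cexp 40 e1) + size (cexp 41 e2) + 1 in
      let l := k + csize c2 + 1 in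
      cexp 40 e1 ++ cexp 41 e2 ++ [:: IJumpLe 40 41 l]
      ++ comp k c2 ++ [:: Jump (l + csize c1)] ++ comp l c1
  | IfR a b c1 c2 =>
      let l := off + 1 + csize c2 + 1 in
      [:: RJumpLe a b l]
      ++ comp (off + 1) c2 ++ [:: Jump (l + csize c1)] ++ comp l c1
  | While e1 e2 c =>
      let k := off + size (cexp 40 e2) + size (cexp 41 e1) + 1 in
      cexp 40 e2 ++ cexp 41 e1 ++ [:: IJumpLe 40 41 (k + csize c + 1)]
      ++ comp k c ++ [:: Jump off]
  end%N.

Lemma size_comp c off : size (comp off c) = csize c.
Proof.
elim: c off => //= [c1 IH1 c2 IH2|d e|a e1 e2|d a e|a e b|e1 e2 c1 IH1 c2 IH2|
  a b c1 IH1 c2 IH2|e1 e2 c IH] off; rewrite ?size_cat /= ?size_cat /= ?IH1 ?IH2 ?IH //.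
Qed.

(** Intermediate values may exceed S, but are at most S to this power: since S >= 2, a sum of values
    bounded by S^a and S^b with a, b >= 1 is bounded by S^(a+b), just like a product. *)
Fixpoint edeg e : nat :=
  match e with
  | Var _ | Cst _ => 1
  | Add e1 e2 | Minus e1 e2 | Mul e1 e2 => edeg e1 + edeg e2
  | Ld _ e => (edeg e).+2
  end%N.

Fixpoint ewf e : bool :=
  match e with
  | Var k => k < 40
  | Cst k => k <= 24
  | Add e1 e2 | Minus e1 e2 | Mul e1 e2 => ewf e1 && ewf e2
  | Ld a e => (a < 14) && ewf e
  end%N.

(** Degree 40 keeps words within S^40. Length 80 leaves at most 161 instructions for a test, well
    within the 300 allotted to a tick. *)
Definition ewfs e := [&& ewf e, (edeg e <= 40)%N & (size (cexp 40 e) <= 80)%N].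

Definition vok d := [&& (d < 40)%N & d != 3%N].

Fixpoint cwf c : bool :=
  match c with
  | Skip | RSum _ _ _ => true
  | Seq c1 c2 => cwf c1 && cwf c2
  | ISet d e => vok d && ewfs e
  | ISt a e1 e2 => [&& (a < 14)%N, ewfs e1 & ewfs e2]
  | RLd _ a e | RSt a e _ => (a < 14)%N && ewfs e
  | If e1 e2 c1 c2 => [&& ewfs e1, ewfs e2, cwf c1 & cwf c2]
  | IfR _ _ c1 c2 => cwf c1 && cwf c2
  | While e1 e2 c => [&& ewfs e1, ewfs e2 & cwf c]
  end.

Lemma edeg_gt0 e : (0 < edeg e)%N.
Proof. by elim: e => //= *; lia. Qed.

Lemma size_cexp t e : size (cexp t e) = size (cexp 40 e).
Proof.
elim: e t => //= [e1 IH1 e2 IH2|e1 IH1 e2 IH2|e1 IH1 e2 IH2|a e IH] t;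
rewrite !size_cat /=.
- by rewrite IH1 IH2 [in RHS]IH2.
- by rewrite IH1 IH2 [in RHS]IH2.
- by rewrite IH1 IH2 [in RHS]IH2.
- by rewrite IH.
Qed.

(** * Correctness, running time and space of the compiled code *)

Section Simulation.
Variables (R : realType) (S : nat).
Hypothesis S24 : (24 <= S)%N.
Variable P : program.
Local Open Scope nat_scope.
Local Notation config := (config R).
Local Notation st := (st R).
Let W := S ^ 40.

(** Safety is required strictly before time t only: the last configuration is the first one of the
    run that follows. *)
Definition reach t (c c' : config) : Prop :=
  run P c t = c' /\ forall k, k < t ->
    accesses_below (14 * S) P (run P c k) /\ words_at_most W (run P c k).

Lemma reach_cat t1 t2 c1 c2 c3 :
  reach t1 c1 c2 -> reach t2 c2 c3 -> reach (t1 + t2) c1 c3.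
Proof.
have runD c a b : run P c (a + b) = run P (run P c a) b.
  by rewrite /run addnC iterD.
move=> [r1 s1] [r2 s2]; split; first by rewrite runD r1.
move=> k kt; case: (ltnP k t1) => [/s1 //|k1].
have := s2 (k - t1); rewrite -r1 -runD subnKC //; apply; lia.
Qed.

Lemma reach1 i c c' : onth P (pc c) = Some i ->
  match i with
  | ILoad _ a | IStore a _ | RLoad _ a | RStore a _ => ireg c a < 14 * S
  | _ => true
  end -> words_at_most W c -> exec i c = c' -> reach 1 c c'.
Proof.
move=> Pc acc wc <-; split; first by rewrite /run /= /step Pc.
by case=> // _; rewrite /run /= /accesses_below Pc; case: i acc Pc.
Qed.

Definition same_store (c c' : config) :=
  [/\ rreg c' = rreg c, imem c' = imem c & rmem c' = rmem c].

(** Only cells i < S are related, so that the segments from a * S are disjoint. The bounds on s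
    itself are carried along for [eval_bound], hence for the size of words. *)
Record sim (s : st) (c : config) : Prop := Sim {
  sim_v : forall k, k < 40 -> ireg c k = v s k;
  sim_3 : v s 3 = S;
  sim_w : forall k, rreg c k = w s k;
  sim_ia : forall a i, i < S -> imem c (a * S + i) = ia s a i;
  sim_ra : forall a i, i < S -> rmem c (a * S + i) = ra s a i;
  sim_words : words_at_most W c;
  sim_vle : forall k, k < 40 -> v s k <= S;
  sim_iale : forall a i, i < S -> ia s a i <= S }.

Lemma sim_temps s c c' : sim s c -> same_store c c' -> words_at_most W c' ->
  (forall k, k < 40 -> ireg c' k = ireg c k) -> sim s c'.
Proof.
move=> [h1 h2 h3 h4 h5 h6 h7 h8] [e1 e2 e3] wc' e; split => //.
- by move=> k k40; rewrite e // h1.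
- by move=> k; rewrite e1.
- by move=> a i iS; rewrite e2 h4.
- by move=> a i iS; rewrite e3 h5.
Qed.

Lemma eval_bound e (s : st) c : sim s c -> eok S e s -> ewf e -> eval e s <= S ^ edeg e.
Proof.
move=> sc; have S0 : 0 < S by lia.
have pw a : 0 < a -> 2 <= S ^ a.
  by move=> a0; rewrite (leq_trans _ (leq_pexp2l S0 a0)) // expn1; lia.
have addb a b x y : 0 < a -> 0 < b -> x <= S ^ a -> y <= S ^ b -> x + y <= S ^ (a + b).
  move=> a0 b0 xa yb; rewrite expnD; move: (pw a a0) (pw b b0) => pa pb.
  by apply: leq_trans (leq_add xa yb) _; nia.
elim: e => /= [k _ k40|k _ k24|e1 IH1 e2 IH2|e1 IH1 e2 IH2|e1 IH1 e2 IH2|a e IH].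
- by rewrite expn1; apply: sim_vle sc _ k40.
- by rewrite expn1; lia.
- move=> /andP[o1 o2] /andP[w1 w2].
  by apply: addb (IH1 o1 w1) (IH2 o2 w2); apply: edeg_gt0.
- move=> /andP[o1 o2] /andP[w1 w2]; apply: leq_trans (leq_subr _ _) _.
  apply: leq_trans (leq_addr (eval e2 s) _) _.
  by apply: addb (IH1 o1 w1) (IH2 o2 w2); apply: edeg_gt0.
- move=> /andP[o1 o2] /andP[w1 w2].
  by rewrite expnD leq_mul // (IH1, IH2).
- move=> /andP[o1 o2] /andP[w1 w2]; apply: leq_trans (sim_iale sc _ o1) _.
  by rewrite -[X in X <= _]expn1 leq_pexp2l.
Qed.

Lemma words_set (c : config) p d k : words_at_most W c -> k <= W ->
  words_at_most W (Config p [eta ireg c with d |-> k] (rreg c) (imem c) (rmem c)).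
Proof. by move=> wc kW j; case: (wc j) => /= h1 h2; split=> //=; case: (j == d). Qed.

Lemma onth_mid (p1 p2 : program) i : onth (p1 ++ i :: p2) (size p1) = Some i.
Proof. by elim: p1. Qed.

Lemma le_W k x : k <= 40 -> x <= S ^ k -> x <= W.
Proof. by move=> k40 xS; apply: leq_trans xS _; rewrite leq_pexp2l //; lia. Qed.

(** Registers below t are preserved, so a left operand held in t survives the evaluation of the
    right one in t + 1. *)
Definition cexp_spec e := forall t pre post (c : config) (s : st),
  P = pre ++ cexp t e ++ post -> pc c = size pre -> 40 <= t -> sim s c ->
  ewf e -> edeg e <= 40 -> eok S e s ->
  exists c', [/\ reach (size (cexp t e)) c c', pc c' = size pre + size (cexp t e),
    ireg c' t = eval e s, forall k, k < t -> ireg c' k = ireg c k &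
    same_store c c' /\ words_at_most W c'].

Lemma step_set i d x (pre post : program) (c : config) :
  P = pre ++ i :: post -> pc c = size pre -> words_at_most W c -> x <= W ->
  exec i c = Config (pc c).+1 [eta ireg c with d |-> x] (rreg c) (imem c) (rmem c) ->
  match i with
  | ILoad _ a | IStore a _ | RLoad _ a | RStore a _ => ireg c a < 14 * S
  | _ => true
  end ->
  exists c', [/\ reach 1 c c', pc c' = size pre + 1, ireg c' d = x,
    forall k, k != d -> ireg c' k = ireg c k &
    same_store c c' /\ words_at_most W c'].
Proof.
move=> eP pcc wc xW ei acc; exists (exec i c); split.
- by apply: (@reach1 i) => //; rewrite pcc eP onth_mid.
- by rewrite ei /= pcc addn1.
- by rewrite ei /= eqxx.
- by move=> k /negPf kd; rewrite ei /= kd.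
- rewrite ei; split=> //; exact: words_set.
Qed.

Lemma same_store_trans c1 c2 c3 : same_store c1 c2 -> same_store c2 c3 -> same_store c1 c3.
Proof. by move=> [a b d] [a1 b1 d1]; rewrite /same_store a1 b1 d1. Qed.

Lemma step_bin (op : nat -> nat -> nat) i e1 e2 t pre post (c : config) (s : st) :
  (forall c : config, exec i c = Config (pc c).+1
     [eta ireg c with t |-> op (ireg c t) (ireg c t.+1)] (rreg c) (imem c) (rmem c)) ->
  match i with
  | ILoad _ a | IStore a _ | RLoad _ a | RStore a _ => false
  | _ => true
  end ->
  P = pre ++ (cexp t e1 ++ cexp t.+1 e2 ++ [:: i]) ++ post ->
  pc c = size pre -> 40 <= t -> sim s c ->
  cexp_spec e1 -> cexp_spec e2 ->
  ewf e1 && ewf e2 -> edeg e1 + edeg e2 <= 40 -> eok S e1 s && eok S e2 s ->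
  op (eval e1 s) (eval e2 s) <= W ->
  exists c', [/\ reach (size (cexp t e1 ++ cexp t.+1 e2 ++ [:: i])) c c',
    pc c' = size pre + size (cexp t e1 ++ cexp t.+1 e2 ++ [:: i]),
    ireg c' t = op (eval e1 s) (eval e2 s), forall k, k < t -> ireg c' k = ireg c k &
    same_store c c' /\ words_at_most W c'].
Proof.
move=> ei acc eP pcc t40 sc H1 H2 /andP[w1 w2] de /andP[o1 o2] opW.
have [||c1 [r1 p1 v1 f1 [s1 wd1]]] := H1 t pre (cexp t.+1 e2 ++ [:: i] ++ post) c s _ pcc t40 sc w1 _ o1.
- by rewrite eP -!catA.
- by lia.
have sc1 : sim s c1 by apply: sim_temps sc s1 wd1 _ => k k40; apply: f1; lia.
have [||||c2 [r2 p2 v2 f2 [s2 wd2]]] :=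
  H2 t.+1 (pre ++ cexp t e1) (i :: post) c1 s _ _ _ sc1 w2 _ o2.
- by rewrite eP -!catA.
- by rewrite p1 size_cat.
- by lia.
- by lia.
have [|||||c3 [r3 p3 v3 f3 [s3 wd3]]] := @step_set i t (op (eval e1 s) (eval e2 s)) (pre ++ cexp t e1 ++ cexp t.+1 e2) post c2 _ _ wd2.
- by rewrite eP -!catA.
- by rewrite p2 !size_cat addnA.
- by [].
- by rewrite ei v2 f2 // v1.
- by case: i acc {ei eP}.
exists c3; split.
- by rewrite !size_cat; apply: reach_cat r1 (reach_cat r2 r3).
- by rewrite p3 !size_cat /=; lia.
- by [].
- by move=> k kt; rewrite f3 ?f2 ?f1 //; lia.
- by split=> //; apply: same_store_trans s1 (same_store_trans s2 s3).
Qed.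

Lemma step_addr e a t pre post (c : config) (s : st) :
  P = pre ++ (cexp t e ++ [:: IConst t.+1 a; IMul t.+1 t.+1 3; IAdd t t t.+1]) ++ post ->
  pc c = size pre -> 40 <= t -> sim s c -> cexp_spec e ->
  ewf e -> edeg e <= 40 -> eok S e s -> eval e s < S -> a < 14 ->
  exists c', [/\ reach (size (cexp t e) + 3) c c',
    pc c' = size pre + size (cexp t e) + 3,
    ireg c' t = a * S + eval e s, forall k, k < t -> ireg c' k = ireg c k &
    same_store c c' /\ words_at_most W c'].
Proof.
move=> eP pcc t40 sc H we de oe eS a14.
have [|c1 [r1 p1 v1 f1 [s1 wd1]]] :=
  H t pre ([:: IConst t.+1 a; IMul t.+1 t.+1 3; IAdd t t t.+1] ++ post) c s _ pcc t40 sc we de oe.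
  by rewrite eP -!catA.
(* Since a < 14 <= S, every address formed here is below S * S. *)
have SS : S * S <= W by apply: (@le_W 2) => //; rewrite -mulnn.
have [|||||c2 [r2 p2 v2 f2 [s2 wd2]]] := @step_set (IConst t.+1 a) t.+1 a (pre ++ cexp t e) ([:: IMul t.+1 t.+1 3; IAdd t t t.+1] ++ post) c1 _ _ wd1.
- by rewrite eP -!catA.
- by rewrite p1 size_cat.
- by nia.
- by case: (c1).
- by [].
have [|||||c3 [r3 p3 v3 f3 [s3 wd3]]] := @step_set (IMul t.+1 t.+1 3) t.+1 (a * S) (pre ++ cexp t e ++ [:: IConst t.+1 a]) (IAdd t t t.+1 :: post) c2 _ _ wd2.
- by rewrite eP -!catA.
- by rewrite p2 !size_cat /=; lia.
- by nia.
- have -> : a * S = ireg c2 t.+1 * ireg c2 3.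
    by rewrite v2 f2 ?f1 ?(sim_v sc) ?(sim_3 sc) //; lia.
  by case: (c2).
- by [].
have [|||||c4 [r4 p4 v4 f4 [s4 wd4]]] := @step_set (IAdd t t t.+1) t (a * S + eval e s) (pre ++ cexp t e ++ [:: IConst t.+1 a; IMul t.+1 t.+1 3]) post c3 _ _ wd3.
- by rewrite eP -!catA.
- by rewrite p3 !size_cat /=; lia.
- by nia.
- have -> : a * S + eval e s = ireg c3 t + ireg c3 t.+1.
    by rewrite v3 f3 ?f2 ?v1 //; lia.
  by case: (c3).
- by [].
exists c4; split.
- by apply: reach_cat r1 (reach_cat r2 (reach_cat r3 r4)).
- by rewrite p4 !size_cat /=; lia.
- by [].
- by move=> k kt; rewrite f4 ?f3 ?f2 ?f1 //; lia.
- by split=> //; apply: same_store_trans s1 (same_store_trans s2 (same_store_trans s3 s4)).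
Qed.

Lemma cexp_ok e : cexp_spec e.
Proof.
elim: e => [k|k|e1 IH1 e2 IH2|e1 IH1 e2 IH2|e1 IH1 e2 IH2|a e IH];
  move=> t pre post c s eP pcc t40 sc we de oe.
- have [|||c2 [r2 p2 v2 f2 [s2 wd2]]] := @step_set (IConst t 0) t 0 pre (IAdd t k t :: post) c eP pcc (sim_words sc); rewrite //.
  - by case: (c).
  have kt : k != t by move: we => /=; lia.
  have [|||||c3 [r3 p3 v3 f3 [s3 wd3]]] := @step_set (IAdd t k t) t (v s k) (pre ++ [:: IConst t 0]) post c2 _ _ wd2.
  - by rewrite eP -!catA.
  - by rewrite p2 !size_cat.
  - by apply: (@le_W 1) => //; rewrite expn1; apply: sim_vle sc _ we.
  - have -> : v s k = ireg c2 k + ireg c2 t by rewrite v2 f2 ?(sim_v sc) ?addn0.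
    by case: (c2).
  - by [].
  exists c3; split.
  - by apply: reach_cat r2 r3.
  - by rewrite p3 !size_cat /=; lia.
  - by [].
  - by move=> j jt; rewrite f3 ?f2 //; lia.
  - by split=> //; apply: same_store_trans s2 s3.
- have [|||c2 [r2 p2 v2 f2 [s2 wd2]]] := @step_set (IConst t k) t k pre post c eP pcc (sim_words sc); rewrite //.
  - by apply: (@le_W 1) => //; rewrite expn1; move: we => /=; lia.
  - by case: (c).
  exists c2; split=> // j jt; rewrite f2 //; lia.
- have b := le_W de (eval_bound (e := Add e1 e2) sc oe we).
  by apply: step_bin eP pcc t40 sc IH1 IH2 we de oe b => //; case.
- have b := le_W de (eval_bound (e := Minus e1 e2) sc oe we).
  by apply: step_bin eP pcc t40 sc IH1 IH2 we de oe b => //; case.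
- have b := le_W de (eval_bound (e := Mul e1 e2) sc oe we).
  by apply: step_bin eP pcc t40 sc IH1 IH2 we de oe b => //; case.
- move: we oe de => /= /andP[a14 we] /andP[eS oe] de.
  have [||c1 [r1 p1 v1 f1 [s1 wd1]]] :=
    @step_addr e a t pre (ILoad t t :: post) c s _ pcc t40 sc IH we _ oe eS a14.
  - by rewrite eP /= -!catA.
  - by lia.
  have sc1 : sim s c1 by apply: sim_temps sc s1 wd1 _ => k k40; apply: f1; lia.
  have [|||||c2 [r2 p2 v2 f2 [s2 wd2]]] := @step_set (ILoad t t) t (ia s a (eval e s)) (pre ++ cexp t e ++ [:: IConst t.+1 a; IMul t.+1 t.+1 3; IAdd t t t.+1]) post c1 _ _ wd1.
  - by rewrite eP /= -!catA.
  - by rewrite p1 !size_cat /=; lia.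
  - by apply: (@le_W 1) => //; rewrite expn1; apply: sim_iale sc _ _ eS.
  - by rewrite -(sim_ia sc1 a eS) -v1; case: (c1).
  - by rewrite v1; nia.
  exists c2; split.
  - rewrite size_cat (_ : _ + _ = size (cexp t e) + 3 + 1); last by rewrite /=; lia.
    exact: reach_cat r1 r2.
  - by rewrite p2 !size_cat /=; lia.
  - by [].
  - by move=> k kt; rewrite f2 ?f1 //; lia.
  - by split=> //; apply: same_store_trans s1 s2.
Qed.

Lemma sim_tick s c : sim s c -> sim (tick s) c.
Proof. by case. Qed.

Lemma step_jump i l (pre post : program) (s : st) (c : config) :
  P = pre ++ i :: post -> pc c = size pre -> sim s c ->
  exec i c = Config l (ireg c) (rreg c) (imem c) (rmem c) ->
  match i with
  | ILoad _ a | IStore a _ | RLoad _ a | RStore a _ => false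
  | _ => true
  end ->
  exists c', [/\ reach 1 c c', sim s c' & pc c' = l].
Proof.
move=> eP pcc sc ei acc; exists (exec i c); split; last by rewrite ei.
  apply: (@reach1 i) => //; last exact: sim_words sc; first by rewrite pcc eP onth_mid.
  by case: i acc {eP ei}.
by rewrite ei; apply: (sim_temps sc) => // k; apply: (sim_words sc).
Qed.

Lemma step_test e1 e2 l pre post (s : st) (c : config) :
  P = pre ++ (cexp 40 e1 ++ cexp 41 e2 ++ [:: IJumpLe 40 41 l]) ++ post ->
  pc c = size pre -> sim s c -> ewfs e1 -> ewfs e2 -> eok S e1 s -> eok S e2 s ->
  exists t c', [/\ reach t c c', t <= 161, sim s c' &
    pc c' = if eval e1 s <= eval e2 s then l
            else size pre + size (cexp 40 e1) + size (cexp 41 e2) + 1].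
Proof.
move=> eP pcc sc /and3P[w1 d1 z1] /and3P[w2 d2 z2] o1 o2.
have [||c1 [r1 p1 v1 f1 [s1 wd1]]] :=
  @cexp_ok e1 40 pre (cexp 41 e2 ++ [:: IJumpLe 40 41 l] ++ post) c s _ pcc _ sc w1 d1 o1.
- by rewrite eP -!catA.
- by [].
have sc1 : sim s c1 by apply: sim_temps sc s1 wd1 _ => k k40; apply: f1; lia.
have [|||c2 [r2 p2 v2 f2 [s2 wd2]]] :=
  @cexp_ok e2 41 (pre ++ cexp 40 e1) (IJumpLe 40 41 l :: post) c1 s _ _ _ sc1 w2 d2 o2.
- by rewrite eP -!catA.
- by rewrite p1 size_cat.
- by [].
have sc2 : sim s c2 by apply: sim_temps sc1 s2 wd2 _ => k k40; apply: f2; lia.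
have [|||||c3 [r3 sc3 p3]] := @step_jump (IJumpLe 40 41 l)
  (if eval e1 s <= eval e2 s then l else (pc c2).+1) (pre ++ cexp 40 e1 ++ cexp 41 e2) post s c2.
- by rewrite eP -!catA.
- by rewrite p2 !size_cat addnA.
- by [].
- by rewrite -v1 -v2 -(f2 40) //; case: (c2).
- by [].
exists (size (cexp 40 e1) + (size (cexp 41 e2) + 1)), c3; split=> //.
- by apply: reach_cat r1 (reach_cat r2 r3).
- by move: z1 z2; rewrite -(size_cexp 41 e2); lia.
- by rewrite p3 p2 size_cat addn1.
Qed.

Lemma addr_eq a b i j : i < S -> j < S -> (a * S + i == b * S + j) = (a == b) && (i == j).
Proof.
move=> iS jS; apply/eqP/andP => [e|[/eqP-> /eqP->] //].
have S0 : 0 < S by lia.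
have ab : a = b.
  by have := congr1 (fun x => x %/ S) e; rewrite !divnMDl // !divn_small // !addn0.
by split; apply/eqP => //; move: e; rewrite ab; lia.
Qed.

Lemma upd2E T (f : nat -> nat -> T) a i x b j :
  upd f a (upd (f a) i x) b j = if (b == a) && (j == i) then x else f b j.
Proof. by rewrite /upd; case: eqP => //= ->; case: eqP. Qed.

Lemma addr_lt a i : a < 14 -> i < S -> a * S + i < 14 * S. Proof. by nia. Qed.

(** Induction on the derivation, which unfolds the loops. Time is amortized: each tick of [tm] pays
    for 300 instructions, so the bounds for successive parts simply add up. *)
Lemma comp_ok c s s' : bs S c s s' -> cwf c -> forall pre post cf,
  P = pre ++ comp (size pre) c ++ post -> pc cf = size pre -> sim s cf ->
  exists t cf', [/\ reach t cf cf', sim s' cf', pc cf' = size pre + csize c &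
    t + 300 * tm s <= 300 * tm s'].
Proof.
have W0 : S <= W by apply: (@le_W 1) => //; rewrite expn1.
elim=> {c s s'}.
- by move=> s _ pre post cf eP pcf sc; exists 0, cf; split=> //=; lia.
- move=> c1 c2 s s1 s2 _ IH1 _ IH2 /= /andP[w1 w2] pre post cf eP pcf sc.
  have [|t1 [cf1 [r1 sc1 p1 t1b]]] := IH1 w1 pre (comp (size pre + csize c1) c2 ++ post) cf _ pcf sc.
    by rewrite eP -!catA.
  have [||t2 [cf2 [r2 sc2 p2 t2b]]] := IH2 w2 (pre ++ comp (size pre) c1) post cf1 _ _ sc1.
  + by rewrite eP size_cat size_comp -!catA.
  + by rewrite p1 size_cat size_comp.
  exists (t1 + t2), cf2; split=> //; first exact: reach_cat r1 r2.
  + by rewrite p2 size_cat size_comp /=; lia.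
  + by lia.
- move=> d e s oe eS /= /andP[/andP[d40 d3] /and3P[we de ze]] pre post cf eP pcf sc.
  have [||c1 [r1 p1 v1 f1 [s1 wd1]]] :=
    @cexp_ok e 40 pre ([:: IConst 41 0; IAdd d 40 41] ++ post) cf s _ pcf _ sc we de oe.
  + by rewrite eP -!catA.
  + by [].
  have [|||||c2 [r2 p2 v2 f2 [s2 wd2]]] := @step_set (IConst 41 0) 41 0
    (pre ++ cexp 40 e) (IAdd d 40 41 :: post) c1 _ _ wd1.
  + by rewrite eP -!catA.
  + by rewrite p1 size_cat.
  + by [].
  + by case: (c1).
  + by [].
  have [|||||c3 [r3 p3 v3 f3 [s3 wd3]]] := @step_set (IAdd d 40 41) d (eval e s)
    (pre ++ cexp 40 e ++ [:: IConst 41 0]) post c2 _ _ wd2.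
  + by rewrite eP -!catA.
  + by rewrite p2 !size_cat /=; lia.
  + by lia.
  + have -> : eval e s = ireg c2 40 + ireg c2 41 by rewrite v2 f2 // v1 addn0.
    by case: (c2).
  + by [].
  exists (size (cexp 40 e) + (1 + 1)), c3; split.
  + by apply: reach_cat r1 (reach_cat r2 r3).
  + have [q1 q2 q3] := same_store_trans s1 (same_store_trans s2 s3).
    case: sc => h1 h2 h3 h4 h5 h6 h7 h8; split=> //=.
    * move=> k k40; rewrite /upd; case: eqP => [->//|/eqP kd].
      by rewrite f3 // f2 ?f1 ?h1 //; lia.
    * by rewrite /upd eq_sym (negPf d3).
    * by move=> k; rewrite q1.
    * by move=> a i iS; rewrite q2 h4.
    * by move=> a i iS; rewrite q3 h5.
    * by move=> k k40; rewrite /upd; case: eqP => // _; apply: h7.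
  + by rewrite p3 !size_cat /=; lia.
  + by rewrite /=; lia.
- move=> a e1 e2 s o1 o2 eS1 eS2 /= /and3P[a14 /and3P[w1 d1 z1] /and3P[w2 d2 z2]] pre post cf eP pcf sc.
  have [||c1 [r1 p1 v1 f1 [s1 wd1]]] :=
    @step_addr e1 a 40 pre (cexp 41 e2 ++ [:: IStore 40 41] ++ post) cf s _ pcf _ sc (@cexp_ok e1) w1 d1 o1 eS1 a14.
  + by rewrite eP /caddr -!catA.
  + by [].
  have sc1 : sim s c1 by apply: sim_temps sc s1 wd1 _ => k k40; apply: f1; lia.
  have [|||c2 [r2 p2 v2 f2 [s2 wd2]]] :=
    @cexp_ok e2 41 (pre ++ caddr a e1) (IStore 40 41 :: post) c1 s _ _ _ sc1 w2 d2 o2.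
  + by rewrite eP -!catA.
  + by rewrite p1 !size_cat /=; lia.
  + by [].
  have sc2 : sim s c2 by apply: sim_temps sc1 s2 wd2 _ => k k40; apply: f2; lia.
  have v2' : ireg c2 40 = a * S + eval e1 s by rewrite f2.
  have r3 : reach 1 c2 (exec (IStore 40 41) c2).
    apply: (@reach1 (IStore 40 41)) => //; last by rewrite v2'; exact: addr_lt.
    have -> : pc c2 = size (pre ++ caddr a e1 ++ cexp 41 e2) by rewrite p2 !size_cat; lia.
    by rewrite eP (_ : _ ++ _ = (pre ++ caddr a e1 ++ cexp 41 e2) ++ IStore 40 41 :: post) ?onth_mid // -!catA.
  have ec3 : exec (IStore 40 41) c2 = Config (pc c2).+1 (ireg c2) (rreg c2) [eta imem c2 with a * S + eval e1 s |-> eval e2 s] (rmem c2).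
    by rewrite -v2 -v2'; case: (c2).
  move: r3; rewrite {}ec3; set c3 := Config _ _ _ _ _ => r3.
  exists (size (cexp 40 e1) + 3 + (size (cexp 41 e2) + 1)), c3; split.
  + by apply: reach_cat r1 (reach_cat r2 r3).
  + case: sc2 => h1 h2 h3 h4 h5 h6 h7 h8; split=> //=.
    * by move=> b i iS; rewrite addr_eq // upd2E; case: ifP => // _; apply: h4.
    * move=> k; case: (h6 k) => h61 h62; split=> //=.
      by case: ifP => // _; lia.
    * by move=> b i iS; rewrite upd2E; case: ifP => // _; apply: h8.
  + by rewrite /c3 /= p2 !size_cat /=; lia.
  + by move: z1 z2; rewrite -(size_cexp 41 e2) /=; lia.
- move=> d a e s oe eS /= /andP[a14 /and3P[we de ze]] pre post cf eP pcf sc.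
  have [||c1 [r1 p1 v1 f1 [s1 wd1]]] :=
    @step_addr e a 40 pre (RLoad d 40 :: post) cf s _ pcf _ sc (@cexp_ok e) we de oe eS a14.
  + by rewrite eP /caddr -!catA.
  + by [].
  have sc1 : sim s c1 by apply: sim_temps sc s1 wd1 _ => k k40; apply: f1; lia.
  have r2 : reach 1 c1 (exec (RLoad d 40) c1).
    apply: (@reach1 (RLoad d 40)) => //; last by rewrite v1; exact: addr_lt.
    have -> : pc c1 = size (pre ++ caddr a e) by rewrite p1 !size_cat /=; lia.
    by rewrite eP (_ : _ ++ _ = (pre ++ caddr a e) ++ RLoad d 40 :: post) ?onth_mid // -!catA.
  have ec2 : exec (RLoad d 40) c1 = Config (pc c1).+1 (ireg c1) [eta rreg c1 with d |-> ra s a (eval e s)] (imem c1) (rmem c1).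
    by rewrite -(sim_ra sc1 a eS) -v1; case: (c1).
  move: r2; rewrite {}ec2; set c2 := Config _ _ _ _ _ => r2.
  exists (size (cexp 40 e) + 3 + 1), c2; split.
  + by apply: reach_cat r1 r2.
  + case: sc1 => h1 h2 h3 h4 h5 h6 h7 h8; split=> //=.
    by move=> k; rewrite /upd; case: ifP => // _; apply: h3.
  + by rewrite /c2 /= p1 !size_cat /=; lia.
  + by rewrite /=; lia.
- move=> a e b s oe eS /= /andP[a14 /and3P[we de ze]] pre post cf eP pcf sc.
  have [||c1 [r1 p1 v1 f1 [s1 wd1]]] :=
    @step_addr e a 40 pre (RStore 40 b :: post) cf s _ pcf _ sc (@cexp_ok e) we de oe eS a14.
  + by rewrite eP /caddr -!catA.
  + by [].
  have sc1 : sim s c1 by apply: sim_temps sc s1 wd1 _ => k k40; apply: f1; lia.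
  have r2 : reach 1 c1 (exec (RStore 40 b) c1).
    apply: (@reach1 (RStore 40 b)) => //; last by rewrite v1; exact: addr_lt.
    have -> : pc c1 = size (pre ++ caddr a e) by rewrite p1 !size_cat /=; lia.
    by rewrite eP (_ : _ ++ _ = (pre ++ caddr a e) ++ RStore 40 b :: post) ?onth_mid // -!catA.
  have ec2 : exec (RStore 40 b) c1 = Config (pc c1).+1 (ireg c1) (rreg c1) (imem c1) [eta rmem c1 with a * S + eval e s |-> w s b].
    by rewrite -(sim_w sc1 b) -v1; case: (c1).
  move: r2; rewrite {}ec2; set c2 := Config _ _ _ _ _ => r2.
  exists (size (cexp 40 e) + 3 + 1), c2; split.
  + by apply: reach_cat r1 r2.
  + case: sc1 => h1 h2 h3 h4 h5 h6 h7 h8; split=> //=.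
    by move=> a' i iS; rewrite addr_eq // upd2E; case: ifP => // _; apply: h5.
  + by rewrite /c2 /= p1 !size_cat /=; lia.
  + by rewrite /=; lia.
- move=> d a b s /= _ pre post cf eP pcf sc.
  have r2 : reach 1 cf (exec (RAdd d a b) cf).
    apply: (@reach1 (RAdd d a b)) => //; last exact: sim_words sc.
    by rewrite pcf eP onth_mid.
  have ec2 : exec (RAdd d a b) cf = Config (pc cf).+1 (ireg cf) [eta rreg cf with d |-> (w s a + w s b)%R] (imem cf) (rmem cf).
    by rewrite -!(sim_w sc); case: (cf).
  move: r2; rewrite {}ec2; set c2 := Config _ _ _ _ _ => r2.
  exists 1, c2; split=> //.
  + case: sc => h1 h2 h3 h4 h5 h6 h7 h8; split=> //=.
    by move=> k; rewrite /upd; case: ifP => // _; apply: h3.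
  + by rewrite /c2 /= pcf addn1.
  + by rewrite /=; lia.
- move=> e1 e2 c1 c2 s s' o1 o2 _ IH /= /and4P[w1 w2 wc1 wc2] pre post cf eP pcf sc.
  set k := size pre + size (cexp 40 e1) + size (cexp 41 e2) + 1 in eP.
  set l := k + csize c2 + 1 in eP.
  have [|t1 [cf1 [r1 t1b sc1 p1]]] := @step_test e1 e2 l pre
    (comp k c2 ++ [:: Jump (l + csize c1)] ++ comp l c1 ++ post) s cf _ pcf sc w1 w2 o1 o2.
    by rewrite eP -!catA /= -?catA.
  have sc1' := sim_tick sc1.
  move: IH p1; case: ifP => _ IH p1.
  + have [||t2 [cf2 [r2 sc2 p2 t2b]]] := IH wc1 (pre ++ cexp 40 e1 ++ cexp 41 e2 ++ [:: IJumpLe 40 41 l] ++ comp k c2 ++ [:: Jump (l + csize c1)]) post cf1 _ _ sc1'.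
    * rewrite eP !size_cat size_comp /= -!catA /= -?catA /=.
      by do 3!congr cat; congr cons; congr cat; congr cons; congr (comp _ _ ++ _); rewrite /l /k; lia.
    * by rewrite p1 !size_cat size_comp /= /l /k; lia.
    exists (t1 + t2), cf2; split=> //; first exact: reach_cat r1 r2.
    * by rewrite p2 !size_cat size_comp /=; lia.
    * by move: t2b => /=; lia.
  + have [||t2 [cf2 [r2 sc2 p2 t2b]]] := IH wc2 (pre ++ cexp 40 e1 ++ cexp 41 e2 ++ [:: IJumpLe 40 41 l]) (Jump (l + csize c1) :: comp l c1 ++ post) cf1 _ _ sc1'.
    * rewrite eP !size_cat /= -!catA /= -?catA /=.
      by do 3!congr cat; congr cons; congr (comp _ _ ++ _); rewrite /k; lia.
    * by rewrite p1 !size_cat /= /k; lia.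
    have [|||||cf3 [r3 sc3 p3]] := @step_jump (Jump (l + csize c1)) (l + csize c1) (pre ++ cexp 40 e1 ++ cexp 41 e2 ++ [:: IJumpLe 40 41 l] ++ comp k c2) (comp l c1 ++ post) s' cf2.
    * by rewrite eP -!catA /= -?catA.
    * by rewrite p2 !size_cat size_comp /=; lia.
    * by [].
    * by case: (cf2).
    * by [].
    exists (t1 + (t2 + 1)), cf3; split=> //; first exact: reach_cat r1 (reach_cat r2 r3).
    * by rewrite p3 /l /k; lia.
    * by move: t2b => /=; lia.
- move=> a b c1 c2 s s' _ IH /= /andP[wc1 wc2] pre post cf eP pcf sc.
  set l := size pre + 1 + csize c2 + 1 in eP.
  have [|||||cf1 [r1 sc1 p1]] := @step_jump (RJumpLe a b l)
    (if (w s a <= w s b)%R then l else (pc cf).+1) pre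
    (comp (size pre + 1) c2 ++ [:: Jump (l + csize c1)] ++ comp l c1 ++ post) s cf.
  + by rewrite eP /= -?catA.
  + by [].
  + by [].
  + by rewrite -!(sim_w sc); case: (cf).
  + by [].
  have sc1' := sim_tick sc1.
  move: IH p1; case: ifP => _ IH p1.
  + have [||t2 [cf2 [r2 sc2 p2 t2b]]] := IH wc1 (pre ++ [:: RJumpLe a b l] ++ comp (size pre + 1) c2 ++ [:: Jump (l + csize c1)]) post cf1 _ _ sc1'.
    * rewrite eP /= ?size_cat /= ?size_cat ?size_comp /= -?catA /= -?catA /=.
      by congr cat; congr cons; congr cat; congr cons; congr (comp _ _ ++ _); rewrite /l; lia.
    * by rewrite p1 ?size_cat /= ?size_cat ?size_comp /= /l; lia.
    exists (1 + t2), cf2; split=> //; first exact: reach_cat r1 r2.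
    * by rewrite p2 ?size_cat /= ?size_cat ?size_comp /=; lia.
    * by move: t2b => /=; lia.
  + have [||t2 [cf2 [r2 sc2 p2 t2b]]] := IH wc2 (pre ++ [:: RJumpLe a b l]) (Jump (l + csize c1) :: comp l c1 ++ post) cf1 _ _ sc1'.
    * by rewrite eP ?size_cat /= -?catA /= -?catA /=.
    * by rewrite p1 ?size_cat /= pcf; lia.
    have [|||||cf3 [r3 sc3 p3]] := @step_jump (Jump (l + csize c1)) (l + csize c1) (pre ++ [:: RJumpLe a b l] ++ comp (size pre + 1) c2) (comp l c1 ++ post) s' cf2.
    * by rewrite eP /= -?catA /= -?catA.
    * by rewrite p2 ?size_cat /= ?size_comp /=; lia.
    * by [].
    * by case: (cf2).
    * by [].
    exists (1 + (t2 + 1)), cf3; split=> //; first exact: reach_cat r1 (reach_cat r2 r3).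
    * by rewrite p3 /l; lia.
    * by move: t2b => /=; lia.
- move=> e1 e2 c s o1 o2 le21 /= /and3P[w1 w2 wc] pre post cf eP pcf sc.
  set k := size pre + size (cexp 40 e2) + size (cexp 41 e1) + 1 in eP.
  have [|t1 [cf1 [r1 t1b sc1 p1]]] := @step_test e2 e1 (k + csize c + 1) pre
    (comp k c ++ [:: Jump (size pre)] ++ post) s cf _ pcf sc w2 w1 o2 o1.
    by rewrite eP -?catA /= -?catA.
  exists t1, cf1; split=> //; first exact: sim_tick.
  + by rewrite p1 le21 /k; lia.
  + by rewrite /=; lia.
- move=> e1 e2 c s s1 s2 o1 o2 lt12 _ IH1 _ IH2 /= wf pre post cf eP pcf sc.
  have /and3P[w1 w2 wc] := wf.
  set k := size pre + size (cexp 40 e2) + size (cexp 41 e1) + 1 in eP.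
  have [|t1 [cf1 [r1 t1b sc1 p1]]] := @step_test e2 e1 (k + csize c + 1) pre
    (comp k c ++ [:: Jump (size pre)] ++ post) s cf _ pcf sc w2 w1 o2 o1.
    by rewrite eP -?catA /= -?catA.
  move: p1; rewrite leqNgt lt12 /= => p1.
  have [||t2 [cf2 [r2 sc2 p2 t2b]]] := IH1 wc (pre ++ cexp 40 e2 ++ cexp 41 e1 ++ [:: IJumpLe 40 41 (k + csize c + 1)]) (Jump (size pre) :: post) cf1 _ _ sc1.
  + rewrite eP ?size_cat /= -?catA /= -?catA /=.
    by do 3!congr cat; congr cons; congr (comp _ _ ++ _); rewrite /k; lia.
  + by rewrite p1 ?size_cat /= /k; lia.
  have [|||||cf3 [r3 sc3 p3]] := @step_jump (Jump (size pre)) (size pre) (pre ++ cexp 40 e2 ++ cexp 41 e1 ++ [:: IJumpLe 40 41 (k + csize c + 1)] ++ comp k c) post s1 cf2.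
  + by rewrite eP -?catA /= -?catA.
  + by rewrite p2 ?size_cat ?size_comp /=; lia.
  + by [].
  + by case: (cf2).
  + by [].
  have [|t4 [cf4 [r4 sc4 p4 t4b]]] := IH2 wf pre post cf3 _ p3 (sim_tick sc3).
    by rewrite eP.
  exists (t1 + (t2 + (1 + t4))), cf4; split=> //.
  + exact: reach_cat r1 (reach_cat r2 (reach_cat r3 r4)).
  + by move: t4b => /=; lia.
Qed.

End Simulation.

(** * Hoare triples with running time, and frames read off the text of a command *)

Definition For i lo hi c :=
  Seq (ISet i lo) (While (Var i) hi (Seq c (ISet i (Add (Var i) (Cst 1))))).

Fixpoint mv c : seq nat :=
  match c with
  | ISet d _ => [:: d]
  | Seq c1 c2 | If _ _ c1 c2 | IfR _ _ c1 c2 => mv c1 ++ mv c2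
  | While _ _ c => mv c
  | _ => [::]
  end.

Fixpoint mw c : seq nat :=
  match c with
  | RLd d _ _ | RSum d _ _ => [:: d]
  | Seq c1 c2 | If _ _ c1 c2 | IfR _ _ c1 c2 => mw c1 ++ mw c2
  | While _ _ c => mw c
  | _ => [::]
  end.

Fixpoint mi c : seq nat :=
  match c with
  | ISt a _ _ => [:: a]
  | Seq c1 c2 | If _ _ c1 c2 | IfR _ _ c1 c2 => mi c1 ++ mi c2
  | While _ _ c => mi c
  | _ => [::]
  end.

Fixpoint mr c : seq nat :=
  match c with
  | RSt a _ _ => [:: a]
  | Seq c1 c2 | If _ _ c1 c2 | IfR _ _ c1 c2 => mr c1 ++ mr c2
  | While _ _ c => mr c
  | _ => [::]
  end.

Section Hoare.
Variables (R : realType) (S : nat).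
Local Open Scope nat_scope.
Local Notation st := (st R).

Definition bnd (s : st) :=
  (forall k, v s k <= S) /\ (forall a i, i < S -> ia s a i <= S).

(* What a command leaves alone, read off its text. *)
Record fr c (s s' : st) : Prop := Fr {
  fr_v : forall k, k \notin mv c -> v s' k = v s k;
  fr_w : forall k, k \notin mw c -> w s' k = w s k;
  fr_i : forall a, a \notin mi c -> ia s' a = ia s a;
  fr_r : forall a, a \notin mr c -> ra s' a = ra s a;
  fr_b : bnd s -> bnd s' }.

Lemma fr_refl c s : fr c s s. Proof. by []. Qed.

Lemma fr_trans c s1 s2 s3 : fr c s1 s2 -> fr c s2 s3 -> fr c s1 s3.
Proof.
move=> [a b e d f] [a' b' e' d' f']; split=> [k h|k h|k h|k h|/f/f' //].
- by rewrite a' ?a.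
- by rewrite b' ?b.
- by rewrite e' ?e.
- by rewrite d' ?d.
Qed.

Lemma fr_sub c c' s1 s2 : {subset mv c <= mv c'} -> {subset mw c <= mw c'} ->
  {subset mi c <= mi c'} -> {subset mr c <= mr c'} -> fr c s1 s2 -> fr c' s1 s2.
Proof.
move=> h1 h2 h3 h4 [a b e d f]; split=> // k /negP h.
- by rewrite a //; apply/negP => /h1.
- by rewrite b //; apply/negP => /h2.
- by rewrite e //; apply/negP => /h3.
- by rewrite d //; apply/negP => /h4.
Qed.

Lemma bs_fr c s s' : bs S c s s' -> fr c s s'.
Proof.
have U T (f : nat -> T) d k x : k \notin [:: d] -> upd f d x k = f k.
  by rewrite inE /upd => /negPf ->.
have tk c0 (s0 s1 : st) : fr c0 (tick s0) s1 -> fr c0 s0 s1 by case.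
have ls (T : eqType) (x y : seq T) : {subset x <= x ++ y}.
  by move=> k; rewrite mem_cat => ->.
have rs (T : eqType) (x y : seq T) : {subset y <= x ++ y}.
  by move=> k; rewrite mem_cat orbC => ->.
elim=> {c s s'} //.
- move=> c1 c2 s s1 s2 _ h1 _ h2; apply: (@fr_trans _ _ s1).
    by apply: fr_sub h1; apply: ls.
  by apply: fr_sub h2; apply: rs.
- move=> d e s _ eS; split=> [k|//|//|//|[b1 b2]]; first exact: U.
  by split=> // k; rewrite /= /upd; case: ifP.
- move=> a e1 e2 s _ _ _ eS; split=> [//|//|k|//|[b1 b2]]; first exact: U.
  by split=> // b i iS; rewrite /= upd2E; case: ifP => // _; apply: b2.
- by move=> d a e s _ _; split=> //= k; apply: U.
- by move=> a e b s _ _; split=> //= k; apply: U.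
- by move=> d a b s; split=> //= k; apply: U.
- move=> e1 e2 c1 c2 s s' _ _ _ /tk.
  by case: ifP => _; apply: fr_sub; (apply: ls || apply: rs).
- move=> a b c1 c2 s s' _ /tk.
  by case: ifP => _; apply: fr_sub; (apply: ls || apply: rs).
- by move=> e1 e2 c s s1 s2 _ _ _ _ [a b d e f] _ /tk; apply: fr_trans; split.
Qed.

(** Total correctness; as the clock belongs to the state, Q can bound the running time. *)
Definition wp c (Q : st -> Prop) s := exists2 s', bs S c s s' & Q s'.

(** Consequence and frame rule in one: what the text of c leaves alone comes for free, so triples
    mention only what changes. *)
Lemma wp_use c s (P Q : st -> Prop) :
  wp c P s -> (forall s', fr c s s' -> P s' -> Q s') -> wp c Q s.
Proof. by move=> [s' b p] h; exists s' => //; apply: h (bs_fr b) p. Qed.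

Lemma wp_skip Q s : Q s -> wp Skip Q s.
Proof. by move=> q; exists s => //; constructor. Qed.

Lemma wp_seq c1 c2 Q s : wp c1 (wp c2 Q) s -> wp (Seq c1 c2) Q s.
Proof. by move=> [s1 b1 [s2 b2 q]]; exists s2 => //; apply: BSeq b1 b2. Qed.

Lemma wp_set d e Q s : eok S e s -> eval e s <= S -> Q (setv s d (eval e s)) ->
  wp (ISet d e) Q s.
Proof. by move=> o b q; exists (setv s d (eval e s)) => //; constructor. Qed.

Lemma wp_st a e1 e2 Q s : eok S e1 s -> eok S e2 s -> eval e1 s < S -> eval e2 s <= S ->
  Q (seti s a (eval e1 s) (eval e2 s)) -> wp (ISt a e1 e2) Q s.
Proof. by move=> o1 o2 b1 b2 q; eexists; [constructor|]. Qed.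

Lemma wp_rld d a e Q s : eok S e s -> eval e s < S ->
  Q (setw s d (ra s a (eval e s))) -> wp (RLd d a e) Q s.
Proof. by move=> o b q; eexists; [constructor|]. Qed.

Lemma wp_rst a e b Q s : eok S e s -> eval e s < S ->
  Q (setr s a (eval e s) (w s b)) -> wp (RSt a e b) Q s.
Proof. by move=> o h q; eexists; [constructor|]. Qed.

Lemma wp_rsum d a b Q s : Q (setw s d (w s a + w s b)%R) -> wp (RSum d a b) Q s.
Proof. by move=> q; eexists; [constructor|]. Qed.

Lemma wp_if e1 e2 c1 c2 Q s : eok S e1 s -> eok S e2 s ->
  (eval e1 s <= eval e2 s -> wp c1 Q (tick s)) ->
  (eval e2 s < eval e1 s -> wp c2 Q (tick s)) -> wp (If e1 e2 c1 c2) Q s.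
Proof.
move=> o1 o2 h1 h2; case: (leqP (eval e1 s) (eval e2 s)) => [l|l].
  by have [s' b q] := h1 l; exists s' => //; constructor; rewrite ?l.
by have [s' b q] := h2 l; exists s' => //; constructor; rewrite // leqNgt l.
Qed.

Lemma wp_ifr a b c1 c2 Q s :
  ((w s a <= w s b)%R -> wp c1 Q (tick s)) ->
  ((w s b < w s a)%R -> wp c2 Q (tick s)) -> wp (IfR a b c1 c2) Q s.
Proof.
move=> h1 h2; case: (boolP (w s a <= w s b)%R) => [l|l].
  by have [s' c q] := h1 l; exists s' => //; constructor; rewrite l.
have [|s' c q] := h2; first by rewrite ltNge.
by exists s' => //; constructor; rewrite (negPf l).
Qed.

(** The index of the invariant is a variant that drops in each round. So there are at most N rounds,
    each costing T and one tick, and a last test. *)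
Lemma wp_while e1 e2 c s N T (Inv : nat -> st -> Prop) (Q : st -> Prop) :
  Inv N s ->
  (forall s1 k, fr (While e1 e2 c) s s1 -> Inv k s1 ->
     [/\ eok S e1 s1, eok S e2 s1 &
      (eval e1 s1 < eval e2 s1 ->
         wp c (fun s2 => tm s2 <= tm s1 + T /\ exists2 k', k' < k & Inv k' (tick s2)) s1)]) ->
  (forall s1 k, fr (While e1 e2 c) s (tick s1) -> Inv k s1 -> eval e2 s1 <= eval e1 s1 ->
     tm (tick s1) <= tm s + N * T.+1 + 1 -> Q (tick s1)) ->
  wp (While e1 e2 c) Q s.
Proof.
move=> inv0 body exit.
suff H k s1 : Inv k s1 -> fr (While e1 e2 c) s s1 ->
    tm s1 + k * T.+1 <= tm s + N * T.+1 -> wp (While e1 e2 c) Q s1.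
  exact: H inv0 (fr_refl _ _) (leqnn _).
elim/ltn_ind: k s1 => k IH s1 invk fs1 tk.
have [o1 o2 h] := body _ _ fs1 invk.
case: (ltnP (eval e1 s1) (eval e2 s1)) => [lt|ge]; last first.
  exists (tick s1); first exact: BWhile0.
  apply: exit invk ge _; first by case: fs1.
  by rewrite /=; lia.
have [s2 b2 [t2 [k' k'k inv']]] := h lt.
have [||s3 b3 q3] := IH k' k'k (tick s2) inv'.
- by apply: fr_trans fs1 _; case: (bs_fr b2).
- by rewrite /=; nia.
by exists s3 => //; apply: BWhileS b2 b3.
Qed.

(** The bound [hi] is evaluated again before each round, so its value N has to be invariant. Beyond
    T, a round pays for the increment and for the test. *)
Lemma wp_for i lo hi c s l N T (Inv : nat -> st -> Prop) (Q : st -> Prop) :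
  eok S lo s -> eval lo s = l -> l <= N -> N <= S -> i \notin mv c ->
  (forall s1 k, l <= k <= N -> fr (For i lo hi c) s s1 -> v s1 i = k -> Inv k s1 ->
     eok S hi s1 /\ eval hi s1 = N) ->
  Inv l (setv s i l) ->
  (forall s1 k, l <= k < N -> fr (For i lo hi c) s s1 -> v s1 i = k -> Inv k s1 ->
     wp c (fun s2 => tm s2 <= tm s1 + T /\ Inv k.+1 (tick (setv s2 i k.+1))) s1) ->
  (forall s1, fr (For i lo hi c) s (tick s1) -> v s1 i = N -> Inv N s1 ->
     tm (tick s1) <= tm s + (N - l) * (T + 2) + 2 -> Q (tick s1)) ->
  wp (For i lo hi c) Q s.
Proof.
move=> olo elo lN NS ic ohi inv0 body exit.
have fs0 : fr (For i lo hi c) s (setv s i l).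
  split=> [k|//|//|//|[b1 b2]].
    by rewrite !inE /= => /norP[/negPf e _]; rewrite /upd e.
  by split=> // k; rewrite /= /upd; case: ifP => // _; lia.
apply: wp_seq; apply: wp_set => //; rewrite elo; first by lia.
pose Inv' j s1 := [/\ fr (For i lo hi c) s s1, v s1 i = N - j, j <= N - l & Inv (N - j) s1].
apply: (@wp_while _ _ _ _ (N - l) T.+1 Inv').
- by split=> //; rewrite ?subKn //= /upd eqxx.
- move=> s1 j fs1 [fs vi jl invj].
  have [|oh eh] := ohi s1 (N - j) _ fs vi invj; first by lia.
  split=> //=; rewrite vi eh => ltN.
  have [|s2 b2 [t2 inv2]] := body s1 (N - j) _ fs vi invj; first by lia.
  apply: wp_seq; exists s2 => //; apply: wp_set => //=.
    by rewrite (fr_v (bs_fr b2)) // vi; lia.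
  split; first by lia.
  have ei : v s2 i + 1 = (N - j).+1 by rewrite (fr_v (bs_fr b2)) // vi addn1.
  exists j.-1; first by lia.
  rewrite ei /Inv'; have -> : N - j.-1 = (N - j).+1 by lia.
  split=> //; last by lia.
  + apply: fr_trans fs _; case: (bs_fr b2) => h1 h2 h3 h4 h5; split=> [k|k|k|k|/h5 [b1 b3]] /=.
    * rewrite inE mem_cat inE !negb_or => /and3P[/negPf k1 k2 _].
      by rewrite /upd k1 h1.
    * by rewrite cats0; apply: h2.
    * by rewrite cats0; apply: h3.
    * by rewrite cats0; apply: h4.
    * by split=> // k; rewrite /= /upd; case: ifP => // _; lia.
  + by rewrite /= /upd eqxx; lia.
- move=> s1 j fs1 [fs vi jl invj] /=.
  have [|oh eh] := ohi s1 (N - j) _ fs vi invj; first by lia.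
  rewrite vi eh => ge tmb.
  have j0 : N - j = N by lia.
  rewrite j0 in vi invj; apply: exit => //; first by case: fs.
  by move: tmb => /=; rewrite addn2; lia.
Qed.

(** An invariant that does not read the clock absorbs the tick of the last test. *)
Lemma wp_for_tick i lo hi c s l N T (Inv : nat -> st -> Prop) (Q : st -> Prop) :
  (forall k s1, Inv k s1 -> Inv k (tick s1)) ->
  eok S lo s -> eval lo s = l -> l <= N -> N <= S -> i \notin mv c ->
  (forall s1 k, l <= k <= N -> fr (For i lo hi c) s s1 -> v s1 i = k -> Inv k s1 ->
     eok S hi s1 /\ eval hi s1 = N) ->
  Inv l (setv s i l) ->
  (forall s1 k, l <= k < N -> fr (For i lo hi c) s s1 -> v s1 i = k -> Inv k s1 ->
     wp c (fun s2 => tm s2 <= tm s1 + T /\ Inv k.+1 (tick (setv s2 i k.+1))) s1) ->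
  (forall s1, fr (For i lo hi c) s s1 -> v s1 i = N -> Inv N s1 ->
     tm s1 <= tm s + (N - l) * (T + 2) + 2 -> Q s1) ->
  wp (For i lo hi c) Q s.
Proof.
move=> it h1 h2 h3 h4 h5 h6 h7 h8 h9; apply: wp_for h1 h2 h3 h4 h5 h6 h7 h8 _.
by move=> s1 f vi inv t1; apply: h9 => //; apply: it.
Qed.

End Hoare.

(* The operation on the working table T which adds, for each colour a of ox and b
   of oz, the maximum over the colours c of oy of
   T[ou + c] + T[oe + c * oec + a * (r + 1 - oec)]
   + T[of_ + c * ofc + b * (r + 1 - ofc)]
   to T[og + a * oga + b * (r + 1 - oga)].  The strides are 1 and r, or r and 1,
   in either order, so that an edge table can be used from both ends.  An absent
   neighbour is the dummy vertex n, which has the single colour 0. *)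
Record op := Op {
  oy : nat; ox : nat; oz : nat; ou : nat; oe : nat;
  oec : nat; of_ : nat; ofc : nat; og : nat; oga : nat }.

(** * Layout of the tables, and operations as steps between sets of factors *)

Section Tables.
Variables (n r m : nat).
Hypothesis r_gt0 : (0 < r)%N.
Local Open Scope nat_scope.

Definition ubase v := 1 + v * r.
Definition base e := 1 + n * r + e * (r * r).
(** The end of the room for 2m edge tables. The r cells from here on always hold 0 and are read in
    place of absent tables. *)
Definition zbase := base (2 * m).
Definition cb v := if v < n then r else 1.

Definition adu o c := ou o + c.
Definition ade o c a := oe o + c * oec o + a * (r + 1 - oec o).
Definition adf o c b := of_ o + c * ofc o + b * (r + 1 - ofc o).
Definition adg o a b := og o + a * oga o + b * (r + 1 - oga o).

(* [None] is the constant term, [Some (inl v)] the monadic table of v, and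
   [Some (inr (e, u, v))] the table of the edge e = uv. *)
Definition factor := option (nat + nat * nat * nat).
Definition FK : factor := None.
Definition FU v : factor := Some (inl v).
Definition FE e u v : factor := Some (inr (e, u, v)).

Definition adr (q : factor) (phi : nat -> nat) :=
  match q with
  | None => 0
  | Some (inl v) => ubase v + phi v
  | Some (inr (e, u, v)) => base e + phi u * r + phi v
  end.

Definition blo (q : factor) :=
  match q with
  | None => 0
  | Some (inl v) => ubase v
  | Some (inr (e, _, _)) => base e
  end.

Definition bhi (q : factor) :=
  match q with
  | None => 1
  | Some (inl v) => ubase v + r
  | Some (inr (e, _, _)) => base e + r * r
  end.

Definition inblk q i := blo q <= i < bhi q.

Definition dep (q : factor) y :=
  match q with
  | None => false
  | Some (inl v) => v == y
  | Some (inr (_, u, v)) => (u == y) || (v == y)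
  end.

Definition fok E (q : factor) :=
  match q with
  | None => true
  | Some (inl v) => v < n
  | Some (inr (e, u, v)) => [&& e < E, u < n & v < n]
  end.

(** The last clause gives each edge table a single pair of ends, so that distinct factors occupy
    disjoint blocks. *)
Definition wfQ (Q : seq factor) E :=
  [/\ uniq Q, forall q, q \in Q -> fok E q &
   forall e u v u' v', FE e u v \in Q -> FE e u' v' \in Q -> u = u' /\ v = v'].

Definition col (phi : nat -> nat) := (forall v, v < n -> phi v < r) /\ phi n = 0.

Lemma col_cb phi v : col phi -> v <= n -> phi v < cb v.
Proof.
move=> [h h0] vn; rewrite /cb; case: (ltnP v n) => [/h//|nv].
have -> : v = n by lia.
by rewrite h0.
Qed.

Lemma base_lt e i : i < r * r -> base e + i < base e.+1.
Proof. by rewrite /base => ?; lia. Qed.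

Lemma base_mono e e' : e <= e' -> base e <= base e'.
Proof. by rewrite /base => ?; nia. Qed.

Lemma ubase_lt v i : v < n -> i < r -> ubase v + i < base 0.
Proof. by rewrite /base /ubase => *; nia. Qed.

Lemma blk_disj Q E q q' i : wfQ Q E -> q \in Q -> q' \in Q ->
  inblk q i -> inblk q' i -> q = q'.
Proof.
have U v j : fok E (FU v) -> inblk (FU v) j -> 0 < j < base 0.
  rewrite /inblk /blo /bhi /= => vn /andP[h1 h2].
  have := @ubase_lt v (j - ubase v) vn; rewrite /ubase in h1 h2 *; lia.
have B e u v j : inblk (FE e u v) j -> base 0 <= j.
  rewrite /inblk /blo /bhi /= => /andP[h1 h2].
  by apply: leq_trans h1; apply: base_mono.
have B0 : 0 < base 0 by rewrite /base; lia.
move=> [uQ fQ eQ] qQ q'Q; have f1 := fQ _ qQ; have f2 := fQ _ q'Q; move: f1 f2 qQ q'Q.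
case: q => [[v|[[e u] v]]|]; case: q' => [[v'|[[e' u'] v']]|] // f1 f2 qQ q'Q.
- rewrite /inblk /= /ubase => h1 h2; congr (FU _).
  by case: (ltngtP v v') => // vv; nia.
- by move=> /(U _ _ f1) h1 /B h2; lia.
- by move=> /(U _ _ f1) h1; rewrite /inblk /= => h2; lia.
- by move=> /B h1 /(U _ _ f2) h2; lia.
- rewrite /inblk /= /base => h1 h2.
  have ee : e = e' by case: (ltngtP e e') => // ?; nia.
  by move: ee qQ q'Q => -> qQ /(eQ _ _ _ _ _ qQ)[-> ->].
- by move=> /B h1; rewrite /inblk /= => h2; lia.
- by move=> h2 /(U _ _ f2) h1; move: h2; rewrite /inblk /= => h2; lia.
- by move=> h2 /B h1; move: h2; rewrite /inblk /= => h2; lia.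
Qed.

Lemma blk_below E q i : fok E q -> inblk q i -> i < base E.
Proof.
case: q => [[v|[[e u] v]]|]; rewrite /inblk /=.
- by move=> vn /andP[h1 h2]; rewrite /ubase /base in h1 h2 *; nia.
- by move=> /andP[eE _] /andP[h1 h2]; rewrite /base in h1 h2 *; nia.
- by rewrite /base; lia.
Qed.

Lemma adr_blk E q phi : fok E q -> col phi -> inblk q (adr q phi).
Proof.
move=> fq [h _]; case: q fq => [[v|[[e u] v]]|] //=; rewrite /inblk /=.
- by move=> /h; lia.
- by move=> /and3P[_ /h h1 /h h2]; nia.
Qed.

(** The list l holds at most one factor: an absent table is read from the zero cells, a present one
    from its own block, at the address which the factor prescribes. *)
Definition slot (l : seq factor) y x (ad : nat -> nat -> nat) :=
  (l = [::] /\ forall c a, c < r -> a < cb x -> zbase <= ad c a < zbase + r) \/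
  (exists q, [/\ l = [:: q], forall c a, c < r -> a < cb x -> inblk q (ad c a) &
     forall phi, col phi -> ad (phi y) (phi x) = adr q phi]).

(* A static description of an op turning the factors Q into the factors Q':
   the tables of lu, le and lf are consumed, that of g receives their
   maximum over the colours of y. *)
Inductive elim_step (Sp : pred nat) o Q E Q' E' : Prop :=
  Step lu le lf Rest g of
    perm_eq Q (lu ++ le ++ lf ++ Rest) &
    slot lu (oy o) (ox o) (fun c _ => adu o c) &
    slot le (oy o) (ox o) (ade o) &
    slot lf (oy o) (oz o) (adf o) &
    (forall a b, a < cb (ox o) -> b < cb (oz o) -> inblk g (adg o a b)) &
    (forall a b a' b', a < cb (ox o) -> b < cb (oz o) -> a' < cb (ox o) -> b' < cb (oz o) ->
       adg o a b = adg o a' b' -> a = a' /\ b = b') &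
    (forall phi, col phi -> adg o (phi (ox o)) (phi (oz o)) = adr g phi) &
    (perm_eq Q' Rest /\ g \in Rest /\ E' = E \/
     [/\ perm_eq Q' (g :: Rest), E' = E.+1, blo g = base E, bhi g = base E' & E' <= 2 * m]) &
    [/\ oy o < n, ox o <= n, oz o <= n, oy o != ox o & oy o != oz o] &
    (Sp (oy o) \/ forall q, q \in Rest -> ~~ dep q (oy o)) &
    wfQ Q E & wfQ Q' E' & E <= 2 * m.

(** What an execution in place needs: addresses within the working table, distinct target cells for
    distinct pairs (a, b), and no target cell among the cells read. The pairs can then be treated in
    any order. *)
Definition opsafe o :=
  [/\ [/\ oy o < n, ox o <= n, oz o <= n, oy o != ox o & oy o != oz o],
   forall c a, c < r -> a < cb (ox o) ->
     [/\ adu o c < zbase + r, ade o c a < zbase + r &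
      forall a' b', a' < cb (ox o) -> b' < cb (oz o) ->
        adg o a' b' != adu o c /\ adg o a' b' != ade o c a],
   forall c b, c < r -> b < cb (oz o) -> adf o c b < zbase + r /\
      forall a' b', a' < cb (ox o) -> b' < cb (oz o) -> adg o a' b' != adf o c b &
   forall a b, a < cb (ox o) -> b < cb (oz o) -> adg o a b < zbase + r /\
     forall a' b', a' < cb (ox o) -> b' < cb (oz o) ->
       adg o a b = adg o a' b' -> a = a' /\ b = b'].

(** The cell read lies in the block of a consumed factor or among the zero cells. A block of Q'
    belongs to a factor that is not consumed, or else starts at [base E], beyond all blocks of Q,
    and ends before the zero cells. *)
Lemma slot_disj l y x ad c a Q E (Q' : seq factor) E' i : slot l y x ad -> c < r -> a < cb x ->
  wfQ Q E -> {subset l <= Q} -> E <= 2 * m ->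
  (forall q, q \in Q' -> q \in Q /\ q \notin l \/ blo q = base E /\ bhi q = base E' /\ E' <= 2 * m) ->
  (exists2 q, q \in Q' & inblk q i) -> i != ad c a /\ ad c a < zbase + r.
Proof.
move=> sl cr ax wf lQ E2 hQ' [q qQ' qi]; have [_ fQ _] := wf.
have iz : i < zbase.
  case: (hQ' _ qQ') => [[qQ _]|[h1 [h2 h3]]].
    by apply: leq_trans (blk_below (fQ _ qQ) qi) (base_mono E2).
  by move: qi; rewrite /inblk h1 h2 => /andP[_] /leq_trans; apply; apply: base_mono.
case: sl => [[_ /(_ c a cr ax)]|[q' [el /(_ c a cr ax) h _]]]; first by lia.
have q'Q : q' \in Q by apply: lQ; rewrite el inE.
have := blk_below (fQ _ q'Q) h; have := base_mono E2; rewrite -/zbase => h1 h2.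
split; last by lia.
apply/eqP => ei; rewrite -ei in h.
case: (hQ' _ qQ') => [[qQ qn]|[h3 _]].
  by move: qn; rewrite el inE (blk_disj wf qQ q'Q qi h) eqxx.
have := blk_below (fQ _ q'Q) h; move: qi; rewrite /inblk h3; lia.
Qed.

Lemma perm_slots (lu le lf Rest Q : seq factor) : perm_eq Q (lu ++ le ++ lf ++ Rest) -> uniq Q ->
  [/\ {subset lu <= Q}, {subset le <= Q}, {subset lf <= Q}, {subset Rest <= Q} &
   forall q, q \in Rest -> [/\ q \notin lu, q \notin le & q \notin lf]].
Proof.
move=> pQ; rewrite (perm_uniq pQ) => uQ.
have mQ q : q \in Q = (q \in lu) || (q \in le) || (q \in lf) || (q \in Rest).
  by rewrite (perm_mem pQ) !mem_cat !orbA.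
split=> [q h|q h|q h|q h|q h]; rewrite ?mQ ?h ?orbT //.
move: uQ; rewrite !cat_uniq !has_cat => /and3P[_ /norP[_ /norP[_ h1]] /and3P[_ /norP[_ h2] /and3P[_ h3 _]]].
by split; [move: h1|move: h2|move: h3] => /hasPn/(_ _ h).
Qed.

Lemma step_new Sp o Q E Q' E' : elim_step Sp o Q E Q' E' -> forall lu le lf Rest g,
  perm_eq Q (lu ++ le ++ lf ++ Rest) -> uniq Q ->
  (perm_eq Q' Rest /\ g \in Rest /\ E' = E \/
     [/\ perm_eq Q' (g :: Rest), E' = E.+1, blo g = base E, bhi g = base E' & E' <= 2 * m]) ->
  g \in Q' /\
  (forall q, q \in Q' -> [/\ q \in Q, q \notin lu, q \notin le & q \notin lf] \/
       [/\ blo q = base E, bhi q = base E', E' <= 2 * m & E <= E']).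
Proof.
move=> _ lu le lf Rest g pQ uQ; have [s1 s2 s3 s4 s5] := perm_slots pQ uQ.
case=> [[p' [gR eE]]|[p' eE h1 h2 h3]].
  split; first by rewrite (perm_mem p').
  by move=> q; rewrite (perm_mem p') => qR; left; have [? ? ?] := s5 _ qR; split=> //; apply: s4.
split; first by rewrite (perm_mem p') inE eqxx.
move=> q; rewrite (perm_mem p') inE => /orP[/eqP->|qR]; first by right; rewrite eE in h1 h2 h3 *.
by left; have [? ? ?] := s5 _ qR; split=> //; apply: s4.
Qed.

Lemma step_safe Sp o Q E Q' E' : elim_step Sp o Q E Q' E' -> opsafe o.
Proof.
move=> st; have := st; case=> lu le lf Rest g pQ su se sf gb gi ga cs yx dy wf wf' E2.
have uQ : uniq Q by case: wf.
have [gQ' hQ'] := step_new st pQ uQ cs.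
have [s1 s2 s3 s4 s5] := perm_slots pQ uQ.
have [y_n x_n z_n nx nz] := yx.
have cb0 x : 0 < cb x by rewrite /cb; case: ifP.
split=> //.
- move=> c a cr ax.
  have H1 := slot_disj (i := _) su cr ax wf s1 E2.
  have H2 := slot_disj (i := _) se cr ax wf s2 E2.
  have D a' b' : a' < cb (ox o) -> b' < cb (oz o) ->
     (adg o a' b' != adu o c /\ adu o c < zbase + r) /\ (adg o a' b' != ade o c a /\ ade o c a < zbase + r).
    move=> ha' hb'; split.
      apply: (H1 Q' E'); last by exists g => //; apply: gb.
      by move=> q /hQ'[[h1 h2 _ _]|[h1 h2 h3 _]]; [left|right].
    apply: (H2 Q' E'); last by exists g => //; apply: gb.
    by move=> q /hQ'[[h1 _ h2 _]|[h1 h2 h3 _]]; [left|right].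
  have [[_ d1] [_ d2]] := D 0 0 (cb0 _) (cb0 _).
  by split=> // a' b' ha' hb'; have [[-> _] [-> _]] := D a' b' ha' hb'.
- move=> c b cr bz.
  have D a' b' : a' < cb (ox o) -> b' < cb (oz o) ->
     (adg o a' b' != adf o c b /\ adf o c b < zbase + r).
    move=> ha' hb'; apply: (slot_disj (Q' := Q') (E' := E') sf cr bz wf s3 E2); last by exists g => //; apply: gb.
    by move=> q /hQ'[[h1 _ _ h2]|[h1 h2 h3 _]]; [left|right].
  have [_ d1] := D 0 0 (cb0 _) (cb0 _).
  by split=> // a' b' ha' hb'; have [-> _] := D a' b' ha' hb'.
- move=> a b ha hb; split; last by move=> a' b' ha' hb'; apply: gi.
  have [_ fQ' _] := wf'; have := blk_below (fQ' _ gQ') (gb a b ha hb).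
  have : base E' <= zbase by apply: base_mono; case: cs => [[_ [_ ->]]|[]].
  by lia.
Qed.

End Tables.

(** * Maxima of sums of factors along a chain of operations *)

Section Eliminate.
Variables (R : realType) (n r m : nat).
Hypothesis r_gt0 : (0 < r)%N.

Definition F (Q : seq factor) (T : nat -> R) phi : R := \sum_(q <- Q) T (adr n r q phi).

Definition oval (T : nat -> R) o c a b : R :=
  T (adu o c) + T (ade r o c a) + T (adf r o c b).

Variables lo hi : nat -> nat.

Definition dom (Sp : pred nat) :=
  [/\ forall v, (v < n -> lo v < hi v <= r)%N, lo n = 0%N, hi n = 1%N &
   forall v, (v < n -> Sp v -> hi v = (lo v).+1)%N].

Definition indom phi := forall v, (v <= n -> lo v <= phi v < hi v)%N.

(** A relation rather than a function: the retracing recomputes a maximizer, and any maximizer will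
    do. *)
Definition isbest T o a b c :=
  (lo (oy o) <= c < hi (oy o))%N /\
  forall c', (lo (oy o) <= c' < hi (oy o))%N -> oval T o c' a b <= oval T o c a b.

Definition op_post o (T T' : nat -> R) :=
  (forall a b, (lo (ox o) <= a < hi (ox o))%N -> (lo (oz o) <= b < hi (oz o))%N ->
     exists2 c, isbest T o a b c & T' (adg r o a b) = T (adg r o a b) + oval T o c a b) /\
  (forall i, (forall a b, (lo (ox o) <= a < hi (ox o))%N -> (lo (oz o) <= b < hi (oz o))%N ->
     i <> adg r o a b) -> T' i = T i).

(** This includes the edge tables not yet opened, so that an operation can add to a fresh block
    exactly as it adds to an existing one. *)
Definition zeros E (T : nat -> R) := forall i, (base n r E <= i < zbase n r m + r)%N -> T i = 0.

Lemma dom_cb Sp v a : dom Sp -> (v <= n -> lo v <= a < hi v -> a < cb n r v)%N.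
Proof.
move=> [h1 h2 h3 _] vn /andP[_ ah]; rewrite /cb; case: (ltnP v n) => [/h1/andP[_]|nv].
  exact: leq_trans.
have e : v = n by lia.
by move: ah; rewrite e h3.
Qed.

Lemma indom_col Sp phi : dom Sp -> indom phi -> col n r phi.
Proof.
move=> d h; split=> [v vn|].
  by have := dom_cb d (ltnW vn) (h v (ltnW vn)); rewrite /cb vn.
by have := h n (leqnn _); case: d => _ -> -> _; lia.
Qed.

Lemma indom_upd phi y c : indom phi -> (lo y <= c < hi y)%N -> indom (upd phi y c).
Proof. by move=> h hc v /h; rewrite /upd; case: eqP => [->|]. Qed.

Lemma adr_upd q phi y c : ~~ dep q y -> adr n r q (upd phi y c) = adr n r q phi.
Proof.
case: q => [[v|[[e u] v]]|] //=; rewrite /upd; first by move=> /negPf ->.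
by move=> /norP[/negPf -> /negPf ->].
Qed.

Lemma adr_ext q phi phi' : phi =1 phi' -> adr n r q phi = adr n r q phi'.
Proof. by move=> h; case: q => [[v|[[e u] v]]|] //=; rewrite !h. Qed.

Lemma F_ext Q T phi phi' : phi =1 phi' -> F Q T phi = F Q T phi'.
Proof. by move=> h; apply: eq_bigr => q _; rewrite (adr_ext _ h). Qed.

Lemma slot_sum l y x ad E T phi : slot n r m l y x ad -> zeros E T -> (E <= 2 * m)%N ->
  (y < n)%N -> (x <= n)%N -> col n r phi -> F l T phi = T (ad (phi y) (phi x)).
Proof.
move=> sl z E2 yn xn cp; have [cp1 cp2] := cp.
case: sl => [[-> h]|[q [-> _ h]]].
  rewrite /F big_nil z //; have := h _ _ (cp1 _ yn) (col_cb r_gt0 cp xn).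
  by have := base_mono n r_gt0 E2; rewrite -/(zbase n r m); lia.
by rewrite /F big_seq1 h.
Qed.

Section Step.
Variables (Sp : pred nat) (o : op) (Q Q' : seq factor) (E E' : nat) (T T' : nat -> R).
Hypothesis stp : elim_step n r m Sp o Q E Q' E'.
Hypothesis dm : dom Sp.
Hypothesis zT : zeros E T.
Hypothesis post : op_post o T T'.

Lemma post_outside i :
  (forall q, q \in Q' -> ~~ inblk n r q i) -> T' i = T i.
Proof.
have := stp; case=> lu le lf Rest g pQ su se sf gb gi ga cs [_ xn zn _ _] dy wf wf' E2 hi'.
have [gQ' _] := step_new stp pQ (let: And3 u _ _ := wf in u) cs.
case: post => _; apply => a b ha hb ei.
have := hi' _ gQ'; rewrite ei gb //; first exact: dom_cb dm xn ha.
exact: dom_cb dm zn hb.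
Qed.

Lemma step_E : (E <= E')%N /\ (E' <= 2 * m)%N.
Proof. by case: stp => lu le lf Rest g _ _ _ _ _ _ _ [[_ [_ ->]]|[_ -> _ _ ?]] _ _ _ _ ?. Qed.

Lemma step_zeros : zeros E' T'.
Proof.
move=> i /andP[i1 i2]; have [EE E2] := step_E.
rewrite post_outside.
  by apply: zT; rewrite i2 (leq_trans (base_mono _ _ EE)).
move=> q qQ; apply/negP => qi.
have [_ fQ _] : wfQ n Q' E' by case: stp.
by have := blk_below r_gt0 (fQ _ qQ) qi; lia.
Qed.

Lemma step_value phi c : indom phi -> isbest T o (phi (ox o)) (phi (oz o)) c ->
  F Q T phi <= F Q' T' phi /\ F Q T (upd phi (oy o) c) = F Q' T' phi.
Proof.
move=> ip bc; have cp := indom_col dm ip.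
have := stp; case=> lu le lf Rest g pQ su se sf gb gi ga cs [yn xn zn nx nz] dy wf wf' E2.
have uQ : uniq Q by case: wf.
have [gQ' hQ'] := step_new stp pQ uQ cs.
have [_ _ _ sR _] := perm_slots pQ uQ.
have FQ psi : col n r psi -> F Q T psi = oval T o (psi (oy o)) (psi (ox o)) (psi (oz o)) + F Rest T psi.
  move=> cpsi; rewrite /F (perm_big _ pQ) /= !big_cat /= !addrA; congr (_ + _ + _ + _).
  - exact: slot_sum su zT E2 yn xn cpsi.
  - exact: slot_sum se zT E2 yn xn cpsi.
  - exact: slot_sum sf zT E2 yn zn cpsi.
have [c' bc' eT'] : exists2 c', isbest T o (phi (ox o)) (phi (oz o)) c' &
    T' (adr n r g phi) = T (adr n r g phi) + oval T o c' (phi (ox o)) (phi (oz o)).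
  by have [_ h] := post; rewrite -ga //; case: post => h1 _; apply: h1; apply: ip.
have [rc mc] := bc; have [rc' mc'] := bc'.
have ecc : oval T o c' (phi (ox o)) (phi (oz o)) = oval T o c (phi (ox o)) (phi (oz o)).
  by apply/eqP; rewrite eq_le mc // mc'.
rewrite ecc in eT'.
have [_ fQ' _] := wf'.
have oth q : q \in Q' -> q != g -> T' (adr n r q phi) = T (adr n r q phi).
  move=> qQ qg; case: post => _; apply => a b ha hb ei.
  move/eqP: qg; apply; apply: (blk_disj r_gt0 wf' qQ gQ' (adr_blk r_gt0 (fQ' _ qQ) cp)).
  by rewrite ei gb //; [apply: dom_cb dm xn ha|apply: dom_cb dm zn hb].
have uQ' : uniq Q' by case: wf'.
have FQ' : F Q' T' phi = oval T o c (phi (ox o)) (phi (oz o)) + F Rest T phi.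
  have -> : F Q' T' phi = oval T o c (phi (ox o)) (phi (oz o)) + F Q' T phi.
    rewrite /F (bigD1_seq g) //= [in RHS](bigD1_seq g) //= eT'.
    have -> : \sum_(q <- Q' | q != g) T' (adr n r q phi) = \sum_(q <- Q' | q != g) T (adr n r q phi).
      by rewrite big_seq_cond [RHS]big_seq_cond; apply: eq_bigr => q /andP[qQ qg]; apply: oth.
    by rewrite [RHS]addrA; congr (_ + _); rewrite addrC.
  (* A fresh block held zeros before the step, so there g contributes nothing under T. *)
  congr (_ + _); case: cs => [[p' _]|[p' _ b1 b2 b3]]; rewrite /F (perm_big _ p') //=.
  rewrite big_cons zT ?add0r //.
  have := adr_blk r_gt0 (fQ' _ gQ') cp; rewrite /inblk b1 b2.
  by have := base_mono n r_gt0 b3; rewrite -/(zbase n r m); lia.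
rewrite FQ'; split; first by rewrite FQ // lerD2r mc //; apply: ip; apply: ltnW.
rewrite FQ; last by apply: indom_col dm _; apply: indom_upd.
have -> : upd phi (oy o) c (oy o) = c by rewrite /upd eqxx.
have -> : upd phi (oy o) c (ox o) = phi (ox o) by rewrite /upd eq_sym (negPf nx).
have -> : upd phi (oy o) c (oz o) = phi (oz o) by rewrite /upd eq_sym (negPf nz).
congr (_ + _); case: dy => [sy|dy].
  have ec : c = phi (oy o).
    case: dm => _ _ _ /(_ _ yn sy) h.
    by have := ip _ (ltnW yn); lia.
  by apply: F_ext => k; rewrite /upd; case: eqP => [->|].
by rewrite /F big_seq [RHS]big_seq; apply: eq_bigr => q qR; rewrite adr_upd ?dy.
Qed.

End Step.

Section Chain.
Variables (Q0 : seq factor) (Sp : pred nat).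

Inductive chain : seq op -> seq factor -> nat -> Prop :=
| Chain0 : chain [::] Q0 m
| ChainS ops o Q E Q' E' :
    chain ops Q E -> elim_step n r m Sp o Q E Q' E' -> chain (rcons ops o) Q' E'.

Variables (o0 : op) (Ts : nat -> nat -> R).

Lemma chain_safe ops Q E : chain ops Q E ->
  forall k, (k < size ops)%N -> opsafe n r m (nth o0 ops k).
Proof.
elim=> // {ops Q E} ops o Q E Q' E' _ IH stp k; rewrite size_rcons nth_rcons.
case: (ltnP k (size ops)) => [/IH//|k1 k2]; rewrite (_ : k == size ops); last by lia.
exact: step_safe stp.
Qed.

Lemma chain_opt ops Q E : chain ops Q E -> dom Sp -> zeros m (Ts 0) ->
  (forall k, (k < size ops)%N -> op_post (nth o0 ops k) (Ts k) (Ts k.+1)) ->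
  zeros E (Ts (size ops)) /\
  forall phi, indom phi -> F Q0 (Ts 0) phi <= F Q (Ts (size ops)) phi.
Proof.
move=> ch dm z0; elim: ch => // {ops Q E} ops o Q E Q' E' _ IH stp post.
have [k kl|zE opt] := IH.
  by have := post k; rewrite size_rcons nth_rcons kl; apply; apply: ltnW.
have := post (size ops); rewrite size_rcons nth_rcons ltnn eqxx => /(_ (leqnn _)) po.
split; first exact: step_zeros stp dm zE po.
move=> phi ip; apply: le_trans (opt _ ip) _.
have [yx _ _ _] := step_safe r_gt0 stp; have [_ xn zn _ _] := yx.
have [c bc _] := po.1 _ _ (ip _ xn) (ip _ zn).
exact: (step_value stp dm zE po ip bc).1.
Qed.

(** All maximizers are taken in one late table [Te], not in the successive tables. It agrees with
    each of them on the cells read by the corresponding operation: these lie in blocks already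
    consumed, which are written no more, or among the zero cells. The condition on [Te] refers to
    the end of the chain under consideration, so that it is inherited by prefixes. The colourings
    run backwards, from [phis (size ops)] to [phis 0]. *)
Lemma chain_rec ops Q E : chain ops Q E -> dom Sp -> zeros m (Ts 0) ->
  (forall k, (k < size ops)%N -> op_post (nth o0 ops k) (Ts k) (Ts k.+1)) ->
  forall Te phis,
  (forall i, (forall q, q \in Q -> ~~ inblk n r q i) -> ~~ (base n r E <= i < zbase n r m)%N ->
     Te i = Ts (size ops) i) ->
  (forall k, (k <= size ops)%N -> indom (phis k)) ->
  (forall k, (k < size ops)%N -> let o := nth o0 ops k in
     exists2 c, isbest Te o (phis k.+1 (ox o)) (phis k.+1 (oz o)) c &
       phis k =1 upd (phis k.+1) (oy o) c) ->
  F Q0 (Ts 0) (phis 0%N) = F Q (Ts (size ops)) (phis (size ops)).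
Proof.
move=> ch dm z0; elim: ch => // {ops Q E} ops o Q E Q' E' ch IH stp post Te phis eTe ip ph.
have post' k : (k < size ops)%N -> op_post (nth o0 ops k) (Ts k) (Ts k.+1).
  by move=> kl; have := post k; rewrite size_rcons nth_rcons kl; apply; apply: ltnW.
have := post (size ops); rewrite size_rcons nth_rcons ltnn eqxx => /(_ (leqnn _)) po.
rewrite size_rcons in eTe ip.
have [zE _] := chain_opt ch dm z0 post'.
have := stp; case=> lu le lf Rest g pQ su se sf gb gi ga cs [yn xn zn nx nz] dy wf wf' E2.
have uQ : uniq Q by case: wf.
have [gQ' hQ'] := step_new stp pQ uQ cs.
have [s1 s2 s3 s4 s5] := perm_slots pQ uQ.
have [EE E2'] := step_E stp.
rewrite (IH post' Te phis).
- have [c bc ec] := ph (size ops) (eq_leq (esym (size_rcons _ _))).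
  rewrite nth_rcons ltnn eqxx /= in bc ec *.
  have ip1 := ip _ (leqnn _).
  (* The cells read by the last operation avoid all blocks of Q' and all blocks still to be opened;
     hence neither this operation nor a later one changes them. *)
  have ag l y x ad c' a : slot n r m l y x ad -> {subset l <= Q} ->
    (forall q, q \in Q' -> q \in Q /\ q \notin l \/ blo n r q = base n r E /\ bhi n r q = base n r E' /\ E' <= 2 * m)%N ->
    (c' < r)%N -> (a < cb n r x)%N -> Te (ad c' a) = Ts (size ops) (ad c' a).
    move=> sl lQ hl c'r ax.
    have nb q : q \in Q' -> ~~ inblk n r q (ad c' a).
      move=> qQ'; apply/negP => qi.
      have := slot_disj r_gt0 sl c'r ax wf lQ E2 hl (ex_intro2 _ _ q qQ' qi).
      by rewrite eqxx; case.
    rewrite eTe //; first exact: post_outside stp dm po _ nb.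
    case: sl => [[_ /(_ _ _ c'r ax)]|[q [el /(_ _ _ c'r ax) h _]]]; first by lia.
    have [_ fQ _] := wf; have qQ : q \in Q by apply: lQ; rewrite el inE.
    by have := blk_below r_gt0 (fQ _ qQ) h; have := base_mono n r_gt0 EE; lia.
  have agv c' : (lo (oy o) <= c' < hi (oy o))%N ->
     oval Te o c' (phis (size ops).+1 (ox o)) (phis (size ops).+1 (oz o)) =
     oval (Ts (size ops)) o c' (phis (size ops).+1 (ox o)) (phis (size ops).+1 (oz o)).
    move=> hc'.
    have c'r : (c' < r)%N by have := dom_cb dm (ltnW yn) hc'; rewrite /cb yn.
    have ax := dom_cb dm xn (ip1 _ xn); have az := dom_cb dm zn (ip1 _ zn).
    rewrite /oval; congr (_ + _ + _).
    + apply: (ag lu (oy o) (ox o) (fun c _ => adu o c) c' _ su s1 _ c'r ax).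
      by move=> q /hQ'[[? ? _ _]|[? ? ? _]]; [left|right].
    + apply: (ag le _ _ _ _ _ se s2 _ c'r ax).
      by move=> q /hQ'[[? _ ? _]|[? ? ? _]]; [left|right].
    + apply: (ag lf _ _ _ _ _ sf s3 _ c'r az).
      by move=> q /hQ'[[? _ _ ?]|[? ? ? _]]; [left|right].
  have bc' : isbest (Ts (size ops)) o (phis (size ops).+1 (ox o)) (phis (size ops).+1 (oz o)) c.
    by case: bc => rc mc; split=> // c' hc'; rewrite -!agv //; apply: mc.
  by rewrite (F_ext _ _ ec) ?size_rcons (step_value stp dm zE po ip1 bc').2.
- move=> i nQ ni; rewrite eTe; first apply: (post_outside stp dm po).
  + move=> q /hQ'[[qQ _ _ _]|[b1 b2 _ _]]; first exact: nQ.
    by rewrite /inblk b1 b2; have := base_mono n r_gt0 E2'; rewrite -/(zbase n r m); lia.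
  + move=> q /hQ'[[qQ _ _ _]|[b1 b2 _ _]]; first exact: nQ.
    by rewrite /inblk b1 b2; have := base_mono n r_gt0 E2'; rewrite -/(zbase n r m); lia.
  + by have := base_mono n r_gt0 EE; lia.
- by move=> k kl; apply: ip; apply: leqW.
- by move=> k kl; have := ph k; rewrite size_rcons nth_rcons kl; apply; apply: ltnW.
Qed.

End Chain.

Lemma step_sub Sp Sp' o Q E Q' E' : {subset Sp <= Sp'} ->
  elim_step n r m Sp o Q E Q' E' -> elim_step n r m Sp' o Q E Q' E'.
Proof.
move=> sS [lu le lf Rest g ? ? ? ? ? ? ? ? ? dy *]; apply: (@Step _ _ _ _ _ _ _ _ _ lu le lf Rest g) => //.
by case: dy => [/sS|]; [left|right].
Qed.

(** The branching set grows while the list of operations is being built. *)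
Lemma chain_sub Q0 Sp Sp' ops Q E : {subset Sp <= Sp'} ->
  chain Q0 Sp ops Q E -> chain Q0 Sp' ops Q E.
Proof.
move=> sS; elim=> [|{ops Q E} ops o Q E Q' E' _ IH stp]; first exact: Chain0.
exact: ChainS IH (step_sub sS stp).
Qed.

End Eliminate.

(* The arrays of naturals: 0 holds the graph while the eliminations are chosen,
   and the best colouring afterwards; 1 and 2 hold the bounds lo <= c < hi of
   the colours c of a vertex (only one for a vertex of B); 3 marks
   the eliminated vertices; 4 to 13 hold the fields of the operations.  Array 0
   of reals holds the input tables, array 1 the working tables.  Real registers:
   0 is the best score, 1 the current maximum, 2 and 3 are scratch, 9 is 0. *)
Notation n_ := 0%N (only parsing).
Notation r_ := 1%N (only parsing).
Notation m_ := 2%N (only parsing).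
Notation L_ := 4%N (only parsing).
Notation E_ := 5%N (only parsing).
Notation k_ := 6%N (only parsing).
Notation zr_ := 7%N (only parsing).
Notation best_ := 8%N (only parsing).
Notation y_ := 9%N (only parsing).
Notation u_ := 10%N (only parsing).
Notation d_ := 11%N (only parsing).
Notation e_ := 12%N (only parsing).
Notation x_ := 13%N (only parsing).
Notation z_ := 14%N (only parsing).
Notation eb_ := 15%N (only parsing).
Notation ec_ := 16%N (only parsing).
Notation fb_ := 17%N (only parsing).
Notation fc_ := 18%N (only parsing).
Notation ub_ := 19%N (only parsing).
Notation gb_ := 20%N (only parsing).
Notation ga_ := 21%N (only parsing).
Notation a_ := 22%N (only parsing).
Notation b_ := 23%N (only parsing).
Notation c_ := 24%N (only parsing).
Notation bc_ := 25%N (only parsing).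
Notation i_ := 26%N (only parsing).
Notation fl_ := 27%N (only parsing).
Notation go_ := 28%N (only parsing).
Notation j_ := 29%N (only parsing).
Notation B_ := 30%N (only parsing).
Notation rr_ := 31%N (only parsing).
Notation q_ := 32%N (only parsing).
Notation kk_ := 33%N (only parsing).

(** By truncated subtraction this is 1 if a = b and 0 otherwise. *)
Definition eqe a b := Minus (Cst 1) (Add (Minus a b) (Minus b a)).
Definition eu e := Ld 0 (Mul (Cst 2) e).
Definition ev e := Ld 0 (Add (Mul (Cst 2) e) (Cst 1)).
Definition basee e := Add (Var B_) (Mul e (Var rr_)).
Definition ubasee u := Add (Cst 1) (Mul u (Var r_)).
Definition lo_ u := Ld 1 u.
Definition hi_ u := Ld 2 u.

Fixpoint Seqs cs := match cs with
  | [::] => Skip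
  | [:: c] => c
  | c :: cs => Seq c (Seqs cs)
  end.

(** Evaluation of one assignment of the branching vertices *)

Definition Cload := Seqs [::
  RLd 2 1 (Add (Var ub_) (Var c_));
  RLd 3 1 (Add (Add (Var eb_) (Mul (Var c_) (Var ec_)))
               (Mul (Var a_) (Minus (Add (Var r_) (Cst 1)) (Var ec_))));
  RSum 2 2 3;
  RLd 3 1 (Add (Add (Var fb_) (Mul (Var c_) (Var fc_)))
               (Mul (Var b_) (Minus (Add (Var r_) (Cst 1)) (Var fc_))));
  RSum 2 2 3].

(** The sum with real register 9, which is 0, serves as a copy. *)
Definition Ckeep := Seq (ISet bc_ (Var c_)) (RSum 1 2 9).

(** The comparison with [lo_] singles out the first colour, at which there is no maximum to compare
    with. *)
Definition Cargmax := For c_ (lo_ (Var y_)) (hi_ (Var y_)) (Seq Cload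
  (If (Var c_) (lo_ (Var y_)) Ckeep (IfR 2 1 Skip Ckeep))).

Definition gaddr := Add (Add (Var gb_) (Mul (Var a_) (Var ga_)))
                        (Mul (Var b_) (Minus (Add (Var r_) (Cst 1)) (Var ga_))).

Definition Cexec :=
  For a_ (lo_ (Var x_)) (hi_ (Var x_)) (For b_ (lo_ (Var z_)) (hi_ (Var z_))
    (Seqs [:: Cargmax; RLd 3 1 gaddr; RSum 3 3 1; RSt 1 gaddr 3])).

Fixpoint Cloads k l := match l with
  | [::] => Skip
  | (d, a) :: l => Seq (ISet d (Ld a k)) (Cloads k l)
  end.

Definition Cop k := Cloads k [:: (y_, 4); (x_, 5); (z_, 6); (ub_, 7); (eb_, 8);
  (ec_, 9); (fb_, 10); (fc_, 11); (gb_, 12); (ga_, 13)]%N.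

Definition Ceval := For i_ (Cst 0) (Var k_) (Seq (Cop (Var i_)) Cexec).

(** Besides the L cells of the input, 2L cells are cleared: the room for new edge tables and the
    zero cells end before 3L, as [zr_S] shows. *)
Definition Ccopy := For i_ (Cst 0) (Var L_) (Seqs [::
  RLd 3 0 (Var i_); RSt 1 (Var i_) 3; RSt 1 (Add (Var L_) (Var i_)) 9;
  RSt 1 (Add (Add (Var L_) (Var L_)) (Var i_)) 9]).

Definition Crecover := Seq
  (For u_ (Cst 0) (Add (Var n_) (Cst 1)) (ISt 0 (Var u_) (lo_ (Var u_))))
  (For i_ (Cst 0) (Var k_) (Seqs [::
    Cop (Minus (Minus (Var k_) (Cst 1)) (Var i_));
    ISet a_ (Ld 0 (Var x_)); ISet b_ (Ld 0 (Var z_));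
    Cargmax; ISt 0 (Var y_) (Var bc_)])).

Definition Cupdate := Seqs [:: ISet fl_ (Cst 1); RSum 0 3 9; Crecover].

(** A counter in base r whose digits are the colours of the vertices of B. These are recognized by
    [hi] <= [lo] + 1, since r > 1. [go_] becomes 1 when the carry has been absorbed; if it is still
    0 at the end, all colourings have been visited. *)
Definition Codo := Seq (ISet go_ (Cst 0))
  (For u_ (Cst 0) (Var n_) (If (Cst 1) (Var go_) Skip
    (If (hi_ (Var u_)) (Add (lo_ (Var u_)) (Cst 1))
      (If (Var r_) (hi_ (Var u_))
        (Seq (ISt 1 (Var u_) (Cst 0)) (ISt 2 (Var u_) (Cst 1)))
        (Seqs [:: ISt 1 (Var u_) (Add (lo_ (Var u_)) (Cst 1));
                  ISt 2 (Var u_) (Add (hi_ (Var u_)) (Cst 1)); ISet go_ (Cst 1)]))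
      Skip))).

(** [fl_] is 0 until a first score is known, as no real lies below all scores. *)
Definition Csearch := Seqs [:: ISet go_ (Cst 1); ISet fl_ (Cst 0);
  While (Cst 0) (Var go_) (Seqs [:: Ccopy; Ceval; RLd 3 1 (Cst 0);
    If (Var fl_) (Cst 0) Cupdate (IfR 3 0 Skip Cupdate); Codo])].

(** Choice of the branching vertices and of the elimination order *)

Fixpoint Cstores l := match l with
  | [::] => Skip
  | (d, a) :: l => Seq (ISt a (Var k_) (Var d)) (Cstores l)
  end.

Definition Cemit := Seq (Cstores [:: (y_, 4); (x_, 5); (z_, 6); (ub_, 7); (eb_, 8);
  (ec_, 9); (fb_, 10); (fc_, 11); (gb_, 12); (ga_, 13)]%N)
  (ISet k_ (Add (Var k_) (Cst 1))).

Definition Cdeg := Seq (ISet d_ (Cst 0)) (For e_ (Cst 0) (Var E_)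
  (ISet d_ (Add (Var d_) (Add (eqe (eu (Var e_)) (Var u_)) (eqe (ev (Var e_)) (Var u_)))))).

(** One maximization serves both rules: a degree of 1 or 2 gets the key L, which exceeds every
    degree, so eliminations take precedence over branchings. A maximum of 0 means that no edge is
    left. *)
Definition Cchoose := Seq (ISet best_ (Cst 0)) (For u_ (Cst 0) (Var n_) (Seqs [::
  Cdeg; ISet kk_ (Var d_);
  If (Cst 1) (Var d_) (If (Var d_) (Cst 2) (ISet kk_ (Var L_)) Skip) Skip;
  If (Var kk_) (Var best_) Skip (Seq (ISet best_ (Var kk_)) (ISet y_ (Var u_)))])).

Definition Cfind := Seq (ISet j_ (Var E_)) (For e_ (Cst 0) (Var E_)
  (If (Cst 1) (Add (eqe (eu (Var e_)) (Var y_)) (eqe (ev (Var e_)) (Var y_)))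
    (ISet j_ (Var e_)) Skip)).

(** Degrees 1 and 2 are treated alike: when no edge is left at y, the dummy vertex and the zero
    cells take the place of the neighbour and of its table. *)
Definition Ctake := Seq Cfind (If (Var E_) (Var j_)
  (Seqs [:: ISet x_ (Var n_); ISet eb_ (Var zr_); ISet ec_ (Cst 1)])
  (Seqs [:: ISet eb_ (basee (Var j_));
    If (Cst 1) (eqe (eu (Var j_)) (Var y_))
      (Seq (ISet x_ (ev (Var j_))) (ISet ec_ (Var r_)))
      (Seq (ISet x_ (eu (Var j_))) (ISet ec_ (Cst 1)));
    ISt 0 (Mul (Cst 2) (Var j_)) (Var n_);
    ISt 0 (Add (Mul (Cst 2) (Var j_)) (Cst 1)) (Var n_)])).

(** [gb_] = 0 means that xz is not an edge, for every edge table starts at 1 or later. Reusing an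
    existing edge keeps the graph simple. *)
Definition Ctarget := Seqs [:: ISet gb_ (Cst 0);
  For e_ (Cst 0) (Var E_) (Seq
    (If (Cst 1) (Mul (eqe (eu (Var e_)) (Var x_)) (eqe (ev (Var e_)) (Var z_)))
      (Seq (ISet gb_ (basee (Var e_))) (ISet ga_ (Var r_))) Skip)
    (If (Cst 1) (Mul (eqe (eu (Var e_)) (Var z_)) (eqe (ev (Var e_)) (Var x_)))
      (Seq (ISet gb_ (basee (Var e_))) (ISet ga_ (Cst 1))) Skip));
  If (Var gb_) (Cst 0) (Seqs [:: ISt 0 (Mul (Cst 2) (Var E_)) (Var x_);
      ISt 0 (Add (Mul (Cst 2) (Var E_)) (Cst 1)) (Var z_);
      ISet gb_ (basee (Var E_)); ISet ga_ (Var r_); ISet E_ (Add (Var E_) (Cst 1))])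
    Skip].

(** If the second neighbour x is the dummy vertex, y has degree 1, and the target is the monadic
    table of z; with [ga_] = r, the stride of the colour of z is r + 1 - r = 1. *)
Definition Celim := Seqs [:: ISt 3 (Var y_) (Cst 1); ISet ub_ (ubasee (Var y_));
  Ctake; ISet z_ (Var x_); ISet fb_ (Var eb_); ISet fc_ (Var ec_); Ctake;
  If (Var n_) (Var x_) (Seq (ISet gb_ (ubasee (Var z_))) (ISet ga_ (Var r_))) Ctarget;
  Cemit].

(** Each edge yx yields an operation which adds to the monadic table of x the row selected by the
    colour of y. The search moves that single colour later on, without changing the operations. *)
Definition Cbranch := Seqs [:: ISt 2 (Var y_) (Cst 1); ISet ub_ (Var zr_);
  ISet z_ (Var n_); ISet fb_ (Var zr_); ISet fc_ (Cst 1); ISet ga_ (Cst 1);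
  For q_ (Cst 0) (Var best_)
    (Seqs [:: Ctake; ISet gb_ (ubasee (Var x_)); Cemit])].

Definition Cround := Seq Cchoose (If (Var best_) (Cst 0) (ISet go_ (Cst 0))
  (If (Var L_) (Var best_) Celim Cbranch)).

(** The vertices not eliminated, those of B among them, are isolated by now. The maximum of each
    monadic table goes to the constant in cell 0. *)
Definition Cfinal := Seqs [:: ISet x_ (Var n_); ISet z_ (Var n_);
  ISet eb_ (Var zr_); ISet fb_ (Var zr_); ISet ec_ (Cst 1); ISet fc_ (Cst 1);
  ISet gb_ (Cst 0); ISet ga_ (Cst 1);
  For u_ (Cst 0) (Var n_) (If (Ld 3 (Var u_)) (Cst 0)
    (Seqs [:: ISet y_ (Var u_); ISet ub_ (ubasee (Var u_)); Cemit]) Skip)].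

(** Without edges, r * r may exceed the bound S on stored naturals. The last factor of [rr_] makes
    it 0 in that case, in which it is multiplied only by 0. *)
Definition Cinit := Seqs [::
  ISet rr_ (Mul (Mul (Var r_) (Var r_)) (Minus (Cst 1) (Minus (Cst 1) (Var m_)))); ISet B_ (Add (Cst 1) (Mul (Var n_) (Var r_)));
  ISet L_ (basee (Var m_)); ISet zr_ (basee (Mul (Cst 2) (Var m_)));
  ISet E_ (Var m_); ISet k_ (Cst 0);
  For u_ (Cst 0) (Var n_) (ISt 2 (Var u_) (Var r_)); ISt 2 (Var n_) (Cst 1)].

Definition Cplan := Seqs [:: Cinit; ISet go_ (Cst 1);
  While (Cst 0) (Var go_) Cround; Cfinal].

Definition Cmain := Seq Cplan Csearch.

Lemma Cmain_wf : cwf Cmain. Proof. by vm_compute. Qed.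

Lemma eqeE x y : (1 - ((x - y) + (y - x)) = (x == y))%N.
Proof. by case: eqP => [->|/eqP]; lia. Qed.

Lemma updE T (f : nat -> T) k x i : upd f k x i = if i == k then x else f i.
Proof. by []. Qed.

(** * Executing one operation in place *)

Section Registers.
Variables (R : realType) (S n r m : nat).
Local Open Scope nat_scope.
Local Notation st := (st R).

Record regs (s : st) : Prop := Regs {
  rg_n : v s 0 = n; rg_r : v s 1 = r; rg_m : v s 2 = m;
  rg_L : v s 4 = base n r m; rg_z : v s 7 = zbase n r m;
  rg_B : v s 30 = 1 + n * r; rg_rr : 0 < m -> v s 31 = r * r; rg_0 : w s 9 = 0%R }.

Lemma regs_fr c (s s' : st) : fr S c s s' -> regs s ->
  all (fun k => k \notin mv c) [:: 0; 1; 2; 4; 7; 30; 31] && (9 \notin mw c) -> regs s'.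
Proof.
move=> f [h0 h1 h2 h3 h4 h5 h6 h7] /andP[/and5P[? ? ? ? /and4P[? ? ? _]] ?].
by split=> [||||||m0|]; rewrite ?(fr_v f) ?(fr_w f) //; apply: h6.
Qed.

Record opregs o (s : st) : Prop := Opregs {
  or_y : v s 9 = oy o; or_x : v s 13 = ox o; or_z : v s 14 = oz o;
  or_eb : v s 15 = oe o; or_ec : v s 16 = oec o; or_fb : v s 17 = of_ o;
  or_fc : v s 18 = ofc o; or_ub : v s 19 = ou o; or_gb : v s 20 = og o;
  or_ga : v s 21 = oga o }.

Lemma opregs_fr c o (s s' : st) : fr S c s s' -> opregs o s ->
  all (fun k => k \notin mv c) [:: 9; 13; 14; 15; 16; 17; 18; 19; 20; 21] -> opregs o s'.
Proof.
move=> f [h0 h1 h2 h3 h4 h5 h6 h7 h8 h9] /and5P[? ? ? ? /and5P[? ? ? ? /and3P[? ? _]]].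
by split; rewrite (fr_v f).
Qed.

End Registers.

Section Leaf.
Variables (R : realType) (S n r m : nat).
Hypothesis n_gt0 : (0 < n)%N.
Hypothesis r_gt1 : (1 < r)%N.
Hypothesis S_def : S = (8 * base n r m)%N.
Local Open Scope nat_scope.
Local Notation st := (st R).
Local Notation regs := (@regs R n r m).
Local Notation opregs := (@opregs R).
Local Notation wp := (@wp R S).
Local Notation fr := (fr S).
Local Notation bnd := (bnd S).

Let r_gt0 : 0 < r. Proof. exact: ltnW. Qed.

Lemma zr_S : zbase n r m + r <= 3 * base n r m.
Proof. by rewrite /zbase /base; nia. Qed.

Lemma rS : r < S. Proof. by have := zr_S; rewrite S_def; lia. Qed.

Lemma nS : n.+1 < S. Proof. by rewrite S_def /base; nia. Qed.

Lemma wp_argmax (s : st) o a b lo hi T : regs s -> bnd s -> opregs o s ->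
  v s 22 = a -> v s 23 = b -> ia s 1 = lo -> ia s 2 = hi -> ra s 1 = T ->
  oy o < S -> lo (oy o) < hi (oy o) <= r ->
  (forall c, c < r -> [/\ adu o c < S, ade r o c a < S & adf r o c b < S]) ->
  wp Cargmax (fun s' => [/\ tm s' <= tm s + (11 * r + 2),
     isbest r lo hi T o a b (v s' 25) & w s' 1 = oval r T o (v s' 25) a b]) s.
Proof.
move=> rg bs os va vb vlo vhi vT yS /andP[lh hr] ads.
(* Vacuous before the first colour, when the registers hold no maximum yet. *)
pose Inv k (s1 : st) := lo (oy o) < k ->
  [/\ lo (oy o) <= v s1 25 < k, w s1 1 = oval r T o (v s1 25) a b &
   forall c', lo (oy o) <= c' < k -> (oval r T o c' a b <= w s1 1)%R].
have hS := rS.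
apply: (@wp_for _ _ _ _ _ _ _ (lo (oy o)) (hi (oy o)) 9 Inv).
- by rewrite /= (or_y os) yS.
- by rewrite /= (or_y os) vlo.
- by lia.
- by lia.
- by [].
- move=> s1 k _ f _ _; rewrite /= (or_y (opregs_fr f os isT)) yS.
  by rewrite (fr_i f) // vhi.
- by rewrite /Inv ltnn.
- move=> s1 k kl f vk inv.
  have os1 := opregs_fr f os isT.
  have rg1 := regs_fr f rg isT.
  have kr : k < r by lia.
  have [a1 a2 a3] := ads k kr; rewrite /adu /ade /adf in a1 a2 a3.
  have va1 : v s1 22 = a by rewrite (fr_v f).
  have vb1 : v s1 23 = b by rewrite (fr_v f).
  have vT1 : ra s1 1 = T by rewrite (fr_r f).
  apply: wp_seq; apply: wp_seq; apply: wp_rld => //.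
    by rewrite /= vk (or_ub os1).
  apply: wp_seq; apply: wp_rld => //.
    by rewrite /= vk (or_eb os1) (or_ec os1) va1 (rg_r rg1).
  apply: wp_seq; apply: wp_rsum; apply: wp_seq; apply: wp_rld => //.
    by rewrite /= vk (or_fb os1) (or_fc os1) vb1 (rg_r rg1).
  apply: wp_rsum.
  rewrite /= vk (or_ub os1) (or_eb os1) (or_ec os1) (or_fb os1) (or_fc os1) va1 vb1 (rg_r rg1) vT1.
  set s2 := setw _ 2 _.
  have w2 : w s2 2 = oval r T o k a b by [].
  have keep s3 : v s3 = v s2 -> w s3 = w s2 -> ra s3 = ra s2 -> tm s3 <= tm s2 + 2 ->
     (forall c', lo (oy o) <= c' < k -> (oval r T o c' a b <= oval r T o k a b)%R) ->
     wp Ckeep (fun s4 => tm s4 <= tm s1 + 9 /\ Inv k.+1 (tick (setv s4 24 k.+1))) s3.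
    move=> e1 e2 e3 t3 mx; apply: wp_seq; apply: wp_set => //.
      by rewrite /= e1 /= vk; lia.
    apply: wp_rsum; split; first by move: t3; rewrite /s2 /=; lia.
    move=> _; rewrite /= e1 e2 /= !updE /= vk; split.
    - by lia.
    - rewrite (fr_w f) // (rg_0 rg) GRing.addr0; exact: w2.
    - move=> c' hc'; rewrite (fr_w f) // (rg_0 rg) GRing.addr0.
      have [->//|c'k] := eqVneq c' k; apply: mx; lia.
  have lo1 : ia s1 1 (v s1 9) = lo (oy o) by rewrite (fr_i f) // vlo (or_y os1).
  apply: wp_if => //=.
  - by rewrite (or_y os1) yS.
  - rewrite lo1 vk => kle; apply: keep => //=; first by lia.
    by move=> c'; lia.
  - rewrite lo1 vk => kgt.
    have [i1 i2 i3] := inv kgt.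
    apply: wp_ifr => /= cmp.
    + apply: wp_skip; split; first by rewrite /=; lia.
      move=> _ /=; rewrite !updE /=; split=> //; first by lia.
      move=> c' hc'; have [->|c'k] := eqVneq c' k; first exact: cmp.
      by apply: i3; lia.
    + apply: keep => //=; first by lia.
      move=> c' hc'; apply: (@Order.le_trans _ _ (w s1 1)); first by apply: i3.
      exact: Order.POrderTheory.ltW.
- move=> s1 f vk inv t1; have [i1 i2 i3] := inv lh.
  split=> //.
  + have := @leq_mul (hi (oy o) - lo (oy o)) 11 r 11; move: t1 => /=; lia.
  + by split=> // c' hc'; rewrite -i2; apply: i3.
Qed.

Section Partial.
Variables (lo hi : nat -> nat) (Sp : pred nat) (o : op).
Hypothesis dm : dom n r lo hi Sp.
Hypothesis sf : opsafe n r m o.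

Let inx a := lo (ox o) <= a < hi (ox o).
Let inz b := lo (oz o) <= b < hi (oz o).

(** [D] is the set of pairs (a, b) that the double loop has already treated. *)
Definition partial_post (D : nat -> nat -> Prop) (T T1 : nat -> R) :=
  (forall a b, inx a -> inz b -> D a b -> exists2 c, isbest r lo hi T o a b c &
     T1 (adg r o a b) = (T (adg r o a b) + oval r T o c a b)%R) /\
  (forall i, (forall a b, inx a -> inz b -> D a b -> i <> adg r o a b) -> T1 i = T i).

Lemma inx_cb a : inx a -> a < cb n r (ox o).
Proof. by case: sf => [[_ xn _ _ _] _ _ _]; exact: (dom_cb r_gt0 dm xn). Qed.

Lemma inz_cb b : inz b -> b < cb n r (oz o).
Proof. by case: sf => [[_ _ zn _ _] _ _ _]; exact: (dom_cb r_gt0 dm zn). Qed.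

Lemma iny_r c : lo (oy o) <= c < hi (oy o) -> c < r.
Proof.
case: sf => [[yn _ _ _ _] _ _ _] h; have := dom_cb r_gt0 dm (ltnW yn) h.
by rewrite /cb yn.
Qed.

(** Working in place is sound because the targets written so far are not among the cells read for
    any later pair. *)
Lemma partial_oval D T T1 a b c : partial_post D T T1 -> inx a -> inz b ->
  lo (oy o) <= c < hi (oy o) -> oval r T1 o c a b = oval r T o c a b.
Proof.
move=> [_ h] /inx_cb ha /inz_cb hb /iny_r hc.
case: sf => _ s1 s2 _; have [_ _ s1'] := s1 _ _ hc ha; have [_ s2'] := s2 _ _ hc hb.
rewrite /oval; congr (_ + _ + _)%R; apply: h => a' b' /inx_cb ha' /inz_cb hb' _ /esym/eqP; apply/negP.
- by case: (s1' a' b' ha' hb').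
- by case: (s1' a' b' ha' hb').
- exact: s2'.
Qed.

Lemma partial_add (D D' : nat -> nat -> Prop) T T1 a b c : partial_post D T T1 ->
  inx a -> inz b -> ~ D a b -> (forall a' b', D' a' b' <-> D a' b' \/ a' = a /\ b' = b) ->
  isbest r lo hi T1 o a b c ->
  partial_post D' T (upd T1 (adg r o a b) (T1 (adg r o a b) + oval r T1 o c a b))%R.
Proof.
move=> pp ha hb nD D'E [rc mc]; have [p1 p2] := pp.
have inj a1 b1 : inx a1 -> inz b1 -> D a1 b1 -> adg r o a1 b1 <> adg r o a b.
  move=> h1 h2 d e; case: sf => _ _ _ /(_ _ _ (inx_cb h1) (inz_cb h2))[_ h].
  by have [ea eb] := h _ _ (inx_cb ha) (inz_cb hb) e; apply: nD; rewrite -ea -eb.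
split.
- move=> a' b' ha' hb' /D'E[d|[-> ->]].
    have [c' bc' ec'] := p1 a' b' ha' hb' d; exists c' => //.
    by rewrite updE; case: eqP => // /(inj _ _ ha' hb' d).
  exists c.
    split=> // c' rc'; rewrite -!(partial_oval pp ha hb) //; exact: mc.
  rewrite updE eqxx (partial_oval pp ha hb) // p2 // => a1 b1 ha1 hb1 d /esym.
  exact: inj.
- move=> i hi'; rewrite updE; case: eqP => [e|_].
    by case: (hi' a b ha hb) => //; apply/D'E; right.
  by apply: p2 => a' b' ha' hb' d; apply: hi' => //; apply/D'E; left.
Qed.

End Partial.

Lemma dom_S lo hi Sp y c : dom n r lo hi Sp -> y <= n -> lo y <= c < hi y -> hi y <= r /\ c < S.
Proof.
move=> dm yn h; have := dom_cb r_gt0 dm yn h; have := rS; have := nS; case: dm => d1 d2 d3 _.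
rewrite /cb; case: (ltnP y n) => [/d1|ny]; first by lia.
have e : y = n by lia.
rewrite e d2 d3 in h *; lia.
Qed.

Lemma wp_exec (s : st) o lo hi T Sp : regs s -> bnd s -> opregs o s ->
  ia s 1 = lo -> ia s 2 = hi -> ra s 1 = T -> dom n r lo hi Sp -> opsafe n r m o ->
  wp Cexec (fun s' => tm s' <= tm s + 24 * (r * r * r) /\ op_post r lo hi o T (ra s' 1)) s.
Proof.
move=> rg bs os vlo vhi vT dm sf.
have [[yn xn zn _ _] sf1 sf2 sf3] := sf.
have hS := rS; have hnS := nS; have hz := zr_S; have bS : base n r m <= S by lia.
have dlh y : y <= n -> lo y < hi y <= r.
  move=> yn'; case: (dm) => d1 d2 d3 _; case: (ltnP y n) => [/d1//|ny].
  have -> : y = n by lia.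
  by rewrite d2 d3.
(* The pairs before (k, k') in lexicographic order. *)
pose D k k' a b := a < k \/ a = k /\ b < k'.
pose Inv k (s1 : st) := partial_post lo hi o (D k (lo (oz o))) T (ra s1 1).
have := dlh _ xn; have := dlh _ zn; have := dlh _ (ltnW yn) => /andP[ly hy] /andP[lz hz'] /andP[lx hx].
apply: (@wp_for _ _ _ _ _ _ _ (lo (ox o)) (hi (ox o)) (r * (11 * r + 7) + 2) Inv).
- by rewrite /= (or_x os); lia.
- by rewrite /= (or_x os) vlo.
- by lia.
- by lia.
- by [].
- move=> s1 k _ f _ _; rewrite /= (or_x (opregs_fr f os isT)) (fr_i f) // vhi.
  by split=> //; rewrite andbT; lia.
- rewrite /Inv /= vT; split.
    by move=> a b ha hb; rewrite /D; lia.
  by [].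
- move=> s1 a ha f va inv.
  have os1 := opregs_fr f os isT.
  have rg1 := regs_fr f rg isT.
  have bs1 := fr_b f bs.
  pose Inv2 k (s2 : st) := partial_post lo hi o (D a k) T (ra s2 1).
  apply: (@wp_for _ _ _ _ _ _ _ (lo (oz o)) (hi (oz o)) (11 * r + 5) Inv2).
  + by rewrite /= (or_z os1); lia.
  + by rewrite /= (or_z os1) (fr_i f) // vlo.
  + by lia.
  + by lia.
  + by [].
  + move=> s2 k _ f2 _ _; rewrite /= (or_z (opregs_fr f2 os1 isT)) (fr_i f2) // (fr_i f) // vhi.
    by split=> //; rewrite andbT; lia.
  + exact: inv.
  + move=> s2 b hb f2 vb inv2.
    have os2 := opregs_fr f2 os1 isT.
    have rg2 := regs_fr f2 rg1 isT.
    have bs2 := fr_b f2 bs1.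
    have va2 : v s2 22 = a by rewrite (fr_v f2).
    have vl2 : ia s2 1 = lo by rewrite (fr_i f2) // (fr_i f).
    have vh2 : ia s2 2 = hi by rewrite (fr_i f2) // (fr_i f).
    have acb := dom_cb r_gt0 dm xn ha; have bcb := dom_cb r_gt0 dm zn hb.
    apply: wp_seq; apply: (wp_use (@wp_argmax s2 o a b lo hi (ra s2 1) rg2 bs2 os2 va2 vb vl2 vh2 erefl _ _ _)).
    * by lia.
    * by rewrite ly hy.
    * move=> c cr; have [h1 h2 _] := sf1 _ _ cr acb; have [h3 _] := sf2 _ _ cr bcb.
      by split; lia.
    move=> s3 f3 [t3 bc wb].
    have os3 := opregs_fr f3 os2 isT.
    have rg3 := regs_fr f3 rg2 isT.
    have eg : eval gaddr s3 = adg r o a b.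
      by rewrite /= (or_gb os3) (or_ga os3) (rg_r rg3) (fr_v f3 (k := 22)) // va2 (fr_v f3 (k := 23)) // vb.
    have egS : adg r o a b < S by have := (sf3 _ _ acb bcb).1; lia.
    apply: wp_seq; apply: wp_rld => //; first by rewrite eg.
    apply: wp_seq; apply: wp_rsum; apply: wp_rst => //; first by rewrite -[eval _ _]/(eval gaddr s3) eg.
    rewrite -[eval _ (setw (setw _ _ _) _ _)]/(eval gaddr s3) eg.
    split; first by rewrite /=; lia.
    rewrite /Inv2 /= !updE /= wb (fr_r f3) //.
    apply: (partial_add dm sf inv2) bc => //.
    * by rewrite /D; lia.
    * by move=> a' b'; rewrite /D; lia.
  + move=> s2 f2 vb inv2 t2; split.
      have := @leq_mul (hi (oz o) - lo (oz o)) (11 * r + 7) r (11 * r + 7).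
      by move: t2 => /=; lia.
    rewrite /Inv /=; case: inv2 => i1 i2; split.
      by move=> a' b' ha' hb' d; apply: i1 => //; move: d; rewrite /D; lia.
    by move=> i hi'; apply: i2 => a' b' ha' hb' d; apply: hi' => //; move: d; rewrite /D; lia.
- move=> s1 f va inv t1; split.
    have := @leq_mul (hi (ox o) - lo (ox o)) (r * (11 * r + 7) + 4) r (r * (11 * r + 7) + 4).
    (* The constant is 11 + 7 + 4 + 2. *)
    have : r * (r * (11 * r + 7) + 4) + 2 <= 24 * (r * r * r) by nia.
    by move: t1 => /=; lia.
  case: inv => i1 i2; split.
    by move=> a' b' ha' hb'; apply: i1 => //; rewrite /D; move: ha'; lia.
  by move=> i hi'; apply: i2 => a' b' ha' hb' d; apply: hi'.
Qed.
End Leaf.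

(** * Executing a list of operations and retracing it *)

Section Search.
Variables (R : realType) (S n r m : nat).
Hypothesis n_gt0 : (0 < n)%N.
Hypothesis r_gt1 : (1 < r)%N.
Hypothesis S_def : S = (8 * base n r m)%N.
Local Open Scope nat_scope.
Local Notation st := (st R).
Local Notation regs := (@regs R n r m).
Local Notation opregs := (@opregs R).
Local Notation wp := (@wp R S).
Local Notation fr := (fr S).
Local Notation bnd := (bnd S).

Let r_gt0 : 0 < r. Proof. exact: ltnW. Qed.

Definition opat (s : st) k := Op (ia s 4 k) (ia s 5 k) (ia s 6 k) (ia s 7 k)
  (ia s 8 k) (ia s 9 k) (ia s 10 k) (ia s 11 k) (ia s 12 k) (ia s 13 k).

Lemma opat_fr c s s' : fr c s s' ->
  all (fun k => k \notin mi c) [:: 4; 5; 6; 7; 8; 9; 10; 11; 12; 13] -> opat s' =1 opat s.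
Proof.
move=> f /and5P[? ? ? ? /and5P[? ? ? ? /and3P[? ? _]]] k.
by rewrite /opat !(fr_i f).
Qed.

Lemma wp_loads l e s k : uniq [seq p.1 | p : nat * nat <- l] -> bnd s -> k < S ->
  (forall s' : st, ia s' = ia s -> (forall j, j \notin [seq p.1 | p <- l] -> v s' j = v s j) ->
     eok S e s' /\ eval e s' = k) ->
  wp (Cloads e l) (fun s' => tm s' <= tm s + size l /\
     forall d a, (d, a) \in l -> v s' d = ia s a k) s.
Proof.
elim: l s => [|[d a] l IH] s /=; first by move=> *; apply: wp_skip; split=> //; lia.
move=> /andP[dl ul] bs kS he; have [oe ee] := he s erefl (fun _ _ => erefl).
apply: wp_seq; apply: wp_set; rewrite /= ?ee ?kS //; first by apply: bs.2.
set s1 := setv _ _ _.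
have b1 : bnd s1.
  by case: bs => h1 h2; split=> // j; rewrite /= updE; case: ifP => // _; apply: h2.
apply: (wp_use (IH s1 ul b1 kS _)).
  move=> s' ei hv; apply: he => // j; rewrite inE negb_or => /andP[jd jl].
  by rewrite hv //= updE (negPf jd).
move=> s2 f2 [t2 h2]; split; first by move: t2; rewrite /=; lia.
move=> d' a'; rewrite inE => /orP[/eqP[-> ->]|]; last exact: h2.
rewrite (fr_v f2) /= ?updE ?eqxx //.
by move: dl; elim: (l) => //= -[d1 a1] l' IHl; rewrite !inE /= !negb_or => /andP[-> /IHl].
Qed.

Lemma wp_op e s k : bnd s -> k < S ->
  (forall s' : st, ia s' = ia s -> v s' 6 = v s 6 -> v s' 26 = v s 26 ->
     eok S e s' /\ eval e s' = k) ->
  wp (Cop e) (fun s' => tm s' <= tm s + 10 /\ opregs (opat s k) s') s.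
Proof.
move=> bs kS he; apply: (wp_use (wp_loads _ bs kS _)) => //.
  by move=> s' e1 hv; apply: he => //; apply: hv.
by move=> s' _ [t h]; split=> //; split; apply: h.
Qed.

Lemma wp_eval (s : st) lo hi Sp K : regs s -> bnd s -> ia s 1 = lo -> ia s 2 = hi ->
  dom n r lo hi Sp -> v s 6 = K -> K < S -> (forall k, k < K -> opsafe n r m (opat s k)) ->
  wp Ceval (fun s' => tm s' <= tm s + (K * (36 * (r * r * r)) + 2) /\
     exists Ts, [/\ Ts 0 = ra s 1, Ts K = ra s' 1 &
       forall k, k < K -> op_post r lo hi (opat s k) (Ts k) (Ts k.+1)]) s.
Proof.
move=> rg bs vlo vhi dm vK KS sf.
pose Inv j (s1 : st) := exists Ts, [/\ Ts 0 = ra s 1, Ts j = ra s1 1 &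
       forall k, k < j -> op_post r lo hi (opat s k) (Ts k) (Ts k.+1)].
apply: (@wp_for _ _ _ _ _ _ _ 0 K (10 + 24 * (r * r * r)) Inv).
- by [].
- by [].
- by lia.
- by lia.
- by [].
- by move=> s1 k _ f _ _; rewrite /= (fr_v f) // vK.
- by exists (fun _ => ra s 1).
- move=> s1 k /andP[_ kK] f vk [Ts [T0 Tk Tp]].
  have rg1 := regs_fr f rg isT.
  have bs1 := fr_b f bs.
  apply: wp_seq; apply: (wp_use (wp_op (k := k) (e := Var 26) bs1 _ _)); first by lia.
    by move=> s2 _ _ /= ->.
  move=> s2 f2 [t2 os2]; rewrite (opat_fr f isT) in os2.
  have rg2 := regs_fr f2 rg1 isT.
  apply: (wp_use (wp_exec n_gt0 r_gt1 S_def rg2 (fr_b f2 bs1) os2 (lo := lo) (hi := hi) (T := Ts k) _ _ _ dm (sf _ kK))).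
  + by rewrite (fr_i f2) // (fr_i f).
  + by rewrite (fr_i f2) // (fr_i f).
  + by rewrite (fr_r f2).
  move=> s3 f3 [t3 po]; split; first by lia.
  exists (fun j => if j <= k then Ts j else ra s3 1); split=> //=; first by rewrite ltnn.
  move=> j jk; rewrite -ltnS jk; case: (ltnP j k) => [jk'|kj]; first exact: Tp.
  by have -> : j = k by lia.
- move=> s1 f _ inv t1; split=> //.
  have : K * (10 + 24 * (r * r * r) + 2) <= K * (36 * (r * r * r)) by rewrite leq_mul //; nia.
  by move: t1 => /=; lia.
Qed.

Lemma wp_copy (s : st) : regs s ->
  wp Ccopy (fun s' => [/\ tm s' <= tm s + (6 * base n r m + 2),
    forall i, i < base n r m -> ra s' 1 i = ra s 0 i &
    forall i, base n r m <= i < 3 * base n r m -> ra s' 1 i = 0%R]) s.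
Proof.
move=> rg; set L := base n r m; have SL : S = 8 * L := S_def.
pose Inv j (s1 : st) := [/\ forall i, i < j -> ra s1 1 i = ra s 0 i,
   forall i, i < j -> ra s1 1 (L + i) = 0%R & forall i, i < j -> ra s1 1 (L + L + i) = 0%R].
apply: (@wp_for _ _ _ _ _ _ _ 0 L 4 Inv).
- by [].
- by [].
- by lia.
- by lia.
- by [].
- by move=> s1 k _ f _ _; rewrite /= (rg_L (regs_fr f rg isT)).
- by [].
- move=> s1 k /andP[_ kL] f vk [i1 i2 i3].
  have rg1 := regs_fr f rg isT.
  have vL := rg_L rg1; rewrite -/L in vL.
  apply: wp_seq; apply: wp_rld => //; first by rewrite /= vk; lia.
  apply: wp_seq; apply: wp_rst => //; first by rewrite /= vk; lia.
  apply: wp_seq; apply: wp_rst => //; first by rewrite /= vk vL; lia.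
  apply: wp_rst => //; first by rewrite /= vk vL; lia.
  split; first by rewrite /=; lia.
  rewrite /Inv /= vk vL /upd /= (rg_0 rg1) (fr_r f) //.
  by split=> i ik;
    (do 3 (case: eqP => [?|?]; try by [lia|subst])); try (by [apply: i1; lia|apply: i2; lia|apply: i3; lia|]); try lia.
- move=> s1 f vk [i1 i2 i3] t1; split=> //=; first by move: t1 => /=; lia.
  move=> i hi; case: (ltnP i (L + L)) => hi2.
    by have -> : i = L + (i - L) by [lia]; apply: i2; lia.
  by have -> : i = L + L + (i - L - L) by [lia]; apply: i3; lia.
Qed.

Lemma wp_recover (s : st) lo hi Sp K T : regs s -> bnd s -> ia s 1 = lo -> ia s 2 = hi ->
  ra s 1 = T -> dom n r lo hi Sp -> v s 6 = K -> K < S ->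
  (forall k, k < K -> opsafe n r m (opat s k)) ->
  wp Crecover (fun s' => tm s' <= tm s + (3 * n + K * (28 * r) + 7) /\
    exists phis, [/\ phis 0 = ia s' 0, forall k, k <= K -> indom n lo hi (phis k) &
     forall k, k < K -> let o := opat s k in
       exists2 c, isbest r lo hi T o (phis k.+1 (ox o)) (phis k.+1 (oz o)) c &
         phis k =1 upd (phis k.+1) (oy o) c]) s.
Proof.
move=> rg bs vlo vhi vT dm vK KS sf.
have hS := rS n_gt0 r_gt1 S_def; have hnS := nS n_gt0 r_gt1 S_def; have hz := zr_S n_gt0 r_gt1 S_def.
pose Inv0 k (s1 : st) := forall u, u < k -> ia s1 0 u = lo u.
apply: wp_seq; apply: (@wp_for _ _ _ _ _ _ _ 0 n.+1 1 Inv0).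
- by [].
- by [].
- by lia.
- by lia.
- by [].
- by move=> s1 k _ f _ _; rewrite /= (rg_n (regs_fr f rg isT)) addn1.
- by [].
- move=> s1 k /andP[_ kn] f vk i0.
  have lk : lo k <= S.
    rewrite -vlo; apply: bs.2; lia.
  have l1 : ia s1 1 = lo by rewrite (fr_i f).
  apply: wp_st; rewrite /= ?vk ?l1 //; try lia.
  split; first by lia.
  move=> u uk; rewrite /= /upd /= ?vk ?l1; case: eqP => [->//|/eqP uk'].
  by apply: i0; lia.
move=> s1' f1' _ i1; set s1 := tick s1'; move=> t1; have f1 : fr _ s s1 := f1'.
have rg1 := regs_fr f1 rg isT; have bs1 := fr_b f1 bs.
have ip0 : indom n lo hi (ia s1 0).
  move=> u un; rewrite (i1 u) ?ltnS // leqnn /=; case: dm => d1 d2 d3 _.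
  case: (ltnP u n) => [/d1/andP[]//|nu].
  have -> : u = n by lia.
  by rewrite d2 d3.
(* The index of psi counts the operations undone; it is reversed at the end to match [chain_rec]. *)
pose Inv j (s2 : st) := exists psi, [/\ psi j = ia s2 0,
  forall k, k <= j -> indom n lo hi (psi k) &
  forall k, k < j -> let o := opat s (K - 1 - k) in
       exists2 c, isbest r lo hi T o (psi k (ox o)) (psi k (oz o)) c &
         psi k.+1 =1 upd (psi k) (oy o) c].
apply: (@wp_for _ _ _ _ _ _ _ 0 K (11 * r + 15) Inv).
- by [].
- by [].
- by lia.
- by lia.
- by [].
- by move=> s2 k _ f _ _; rewrite /= (fr_v f) // (fr_v f1) // vK.
- by exists (fun _ => ia s1 0); split=> // k; rewrite leqn0 => /eqP->.
- move=> s2 k /andP[_ kK] f vk [psi [pk pin pst]].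
  have rg2 := regs_fr f rg1 isT; have bs2 := fr_b f bs1.
  have K2 : v s2 6 = K by rewrite (fr_v f) // (fr_v f1).
  apply: wp_seq; apply: (wp_use (wp_op (k := K - 1 - k) bs2 _ _)); first by lia.
    move=> s3 _ e6 e26 /=; rewrite e6 e26 vk K2; split=> //.
  move=> s3 f3 [t3 os3]; rewrite (opat_fr f isT) (opat_fr f1 isT) in os3.
  have [o oE] : exists o, o = opat s (K - 1 - k) by eexists.
  rewrite -oE in os3.
  have [|[yn xn zn _ _] sf1 sf2 _] := sf (K - 1 - k); first by lia.
  rewrite -oE in yn xn zn sf1 sf2.
  have rg3 := regs_fr f3 rg2 isT; have bs3 := fr_b f3 bs2.
  have c3 : ia s3 0 = psi k by rewrite (fr_i f3).
  have ipk := pin k (leqnn _).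
  have ax := dom_S n_gt0 r_gt1 S_def dm xn (ipk _ xn).
  have bz := dom_S n_gt0 r_gt1 S_def dm zn (ipk _ zn).
  have acb := dom_cb r_gt0 dm xn (ipk _ xn).
  have bcb := dom_cb r_gt0 dm zn (ipk _ zn).
  apply: wp_seq; apply: wp_set; rewrite /= ?(or_x os3) ?c3 ?andbT; [by lia|by lia|].
  apply: wp_seq; apply: wp_set; rewrite /= /upd /= ?(or_z os3) ?c3 ?andbT; [by lia|by lia|].
  set s4 := setv _ 23 _.
  have f4 : fr (Seq (ISet 22 (Cst 0)) (ISet 23 (Cst 0))) s3 s4.
    split=> [j|//|//|//|[h1 h2]]; first by rewrite !inE /s4 /= /upd => /norP[/negPf -> /negPf ->].
    by split=> // j; rewrite /s4 /= /upd; case: ifP => _; [lia|]; case: ifP => _; [lia|exact: h1].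
  have rg4 := regs_fr f4 rg3 isT; have bs4 := fr_b f4 bs3; have os4 := opregs_fr f4 os3 isT.
  apply: wp_seq; apply: (wp_use (wp_argmax n_gt0 r_gt1 S_def (a := psi k (ox o)) (b := psi k (oz o)) (lo := lo) (hi := hi) (T := T) rg4 bs4 os4 _ _ _ _ _ _ _ _)).
  + by [].
  + by [].
  + by rewrite /= (fr_i f3) // (fr_i f) // (fr_i f1).
  + by rewrite /= (fr_i f3) // (fr_i f) // (fr_i f1).
  + by rewrite /= (fr_r f3) // (fr_r f) // (fr_r f1).
  + by lia.
  + by case: dm => d1 _ _ _; apply: d1.
  + move=> c cr; have [h1 h2 _] := sf1 _ _ cr acb; have [h3 _] := sf2 _ _ cr bcb.
    by split; lia.
  move=> s5 f5 [t5 bc _].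
  have os5 := opregs_fr f5 os4 isT.
  have cS := dom_S n_gt0 r_gt1 S_def dm (ltnW yn) bc.1.
  apply: wp_st; rewrite /= ?(or_y os5) //; try lia.
  split; first by move: t5; rewrite /s4 /=; lia.
  exists (fun j => if j <= k then psi j else upd (psi k) (oy o) (v s5 25)).
  rewrite ltnn; split.
  + by rewrite /= (fr_i f5) // -c3.
  + move=> j jk; case: (leqP j k) => [|jk']; first exact: pin.
    exact: indom_upd ipk bc.1.
  + move=> j jk; case: (ltnP j k) => [jk'|kj].
      by rewrite (ltnW jk'); apply: pst.
    have -> : j = k by lia.
    by rewrite -oE leqnn; exists (v s5 25).
- move=> s2 f _ [psi [pk pin pst]] t2; split.
    have : K * (11 * r + 15 + 2) <= K * (28 * r) by rewrite leq_mul //; lia.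
    by move: t1 t2; rewrite /s1 /=; lia.
  exists (fun j => psi (K - j)); split=> /=.
  + by rewrite subn0 pk.
  + by move=> k kK; apply: pin; lia.
  + move=> k kK; have [|c bc ec] := pst (K - k.+1); first by lia.
    have e : K - 1 - (K - k.+1) = k by lia.
    rewrite e in bc ec; exists c => // j; rewrite -ec; congr psi; lia.
Qed.
End Search.

(** * Numbering the colourings of the branching set *)

Section Odometer.
Variables (r : nat) (Sp : pred nat).
Hypothesis r_gt0 : (0 < r)%N.
Local Open Scope nat_scope.

Definition weight k := r ^ count Sp (iota 0 k).

(** The colours on [Sp] read as digits in base r, the least significant first. *)
Fixpoint code k (f : nat -> nat) :=
  if k is k'.+1 then code k' f + (if Sp k' then f k' * weight k' else 0) else 0.

Lemma weightS k : weight k.+1 = if Sp k then r * weight k else weight k.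
Proof.
rewrite /weight -addn1 iotaD count_cat /= add0n addn0.
by case: (Sp k); rewrite ?addn0 // addn1 expnS.
Qed.

Lemma weight_gt0 k : 0 < weight k. Proof. by rewrite expn_gt0 r_gt0. Qed.

Lemma code_lt k f : (forall u, u < k -> Sp u -> f u < r) -> code k f < weight k.
Proof.
elim: k => //= k IH h; rewrite weightS.
have := IH (fun u uk => h u (ltnW uk)); have := h k (leqnn _).
by case: (Sp k) => [/(_ isT)|]; [nia|lia].
Qed.

Lemma eq_code k f g : (forall u, u < k -> Sp u -> f u = g u) -> code k f = code k g.
Proof.
elim: k => //= k IH h; rewrite (IH (fun u uk => h u (ltnW uk))).
by have := h k (leqnn _); case: (Sp k) => [->|].
Qed.

Lemma code_inj k f g : (forall u, u < k -> Sp u -> f u < r) ->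
  (forall u, u < k -> Sp u -> g u < r) -> code k f = code k g ->
  forall u, u < k -> Sp u -> f u = g u.
Proof.
elim: k => //= k IH hf hg e.
have lf := code_lt (fun u uk => hf u (ltnW uk)).
have lg := code_lt (fun u uk => hg u (ltnW uk)).
have [e1 e2] : code k f = code k g /\ (Sp k -> f k = g k).
  move: e; case: (Sp k) => e; last by split=> //; lia.
  have ek : f k = g k.
    by case: (ltngtP (f k) (g k)) => // ?; nia.
  by split=> //; move: e; rewrite ek; lia.
move=> u; rewrite ltnS leq_eqVlt => /orP[/eqP->|uk] //.
by apply: IH e1 u uk => u' u'k; [apply: hf|apply: hg]; apply: ltnW.
Qed.

End Odometer.

(** * The search through all colourings of the branching set *)

Section Search.
Variables (R : realType) (S n r m : nat).
Hypothesis n_gt0 : (0 < n)%N.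
Hypothesis r_gt1 : (1 < r)%N.
Hypothesis S_def : S = (8 * base n r m)%N.
Variable Sp : pred nat.
Local Open Scope nat_scope.
Local Notation st := (st R).
Local Notation regs := (@regs R n r m).
Local Notation opregs := (@opregs R).
Local Notation wp := (@wp R S).
Local Notation fr := (fr S).
Local Notation bnd := (bnd S).
Local Notation code := (code r Sp).
Local Notation weight := (weight r Sp).

Let r_gt0 : 0 < r. Proof. exact: ltnW. Qed.

Definition dstate (lo hi : nat -> nat) :=
  [/\ forall u, u < n -> if Sp u then hi u = (lo u).+1 /\ lo u < r else lo u = 0 /\ hi u = r,
   lo n = 0 & hi n = 1].

Lemma dstate_dom lo hi : dstate lo hi -> dom n r lo hi Sp.
Proof.
move=> [h h0 h1]; split=> // u un; have := h u un; case: (Sp u) => [] [] //.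
- by move=> -> ?; lia.
- by move=> -> ->; lia.
Qed.

Lemma dstate_lt lo hi u : dstate lo hi -> u < n -> Sp u -> lo u < r.
Proof. by move=> [h _ _] un su; have := h u un; rewrite su => -[]. Qed.

Lemma wp_odo (s : st) lo hi : regs s -> bnd s -> ia s 1 = lo -> ia s 2 = hi ->
  dstate lo hi ->
  wp Codo (fun s' => tm s' <= tm s + (8 * n + 3) /\ dstate (ia s' 1) (ia s' 2) /\
     (v s' 28 = 1 /\ code n (ia s' 1) = (code n lo).+1 \/
      v s' 28 = 0 /\ weight n = (code n lo).+1)) s.
Proof.
move=> rg bs vlo vhi ds.
have hS := rS n_gt0 r_gt1 S_def; have hnS := nS n_gt0 r_gt1 S_def.
(* As long as the carry is pending, all digits below k were r - 1, so that their code was [weight k]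
   - 1, and have been reset to 0. If it is still pending at k = n, the last colouring had been
   reached. *)
pose Inv k (s1 : st) := dstate (ia s1 1) (ia s1 2) /\
  (v s1 28 = 1 /\ code k (ia s1 1) = (code k lo).+1 \/
   [/\ v s1 28 = 0, weight k = (code k lo).+1, code k (ia s1 1) = 0 &
     forall u, k <= u -> ia s1 1 u = lo u]) /\ (forall u, k <= u -> ia s1 1 u = lo u).
apply: wp_seq; apply: wp_set => //; set s0 := setv _ _ _.
apply: (@wp_for _ _ _ _ _ _ _ 0 n 6 Inv).
- by [].
- by [].
- by lia.
- by lia.
- by [].
- by move=> s1 k _ f _ _; rewrite /= (fr_v f) // /s0 /= /upd /= (rg_n rg).
- by rewrite /Inv /= vlo vhi; split=> //; split=> //; right; split.
- move=> s1 k /andP[_ kn] f vk [ds1 [c1 same]].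
  have rg1 : regs s1.
    have : regs s0 by case: rg => *; split.
    by move=> rg0; apply: (regs_fr f rg0).
  have bs1 : bnd s1.
    by apply: (fr_b f); case: bs => h1 h2; split=> // j; rewrite /= updE; case: ifP.
  have sk : ia s1 1 k = lo k by apply: same.
  have loS : lo k < S.
    have /andP[l1 l2] : lo k < hi k <= r by case: (dstate_dom ds) => h _ _ _; apply: h.
    by lia.
  apply: wp_if => //= g1.
    apply: wp_skip; split; first by rewrite /=; lia.
    rewrite /Inv /= /upd /=; split=> //; split; last by move=> u uk; rewrite same // ltnW.
    left; case: c1 => [[-> ->]|[g0 _ _ _]]; last by move: g1; rewrite g0.
    by split=> //; rewrite /= sk; case: (Sp k); lia.
  have {c1} [g0 wk ck _] : [/\ v s1 28 = 0, weight k = (code k lo).+1, code k (ia s1 1) = 0 &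
     forall u, k <= u -> ia s1 1 u = lo u].
    by case: c1 => // -[g2 _]; move: g1; rewrite g2.
  have dk := (let: And3 h _ _ := ds1 in h) k kn.
  apply: wp_if => //=; rewrite ?vk ?andbT; try by lia.
  + move: dk; case: ifP => [spk [hk lk] _|_ [lk hk]]; last by move: lk hk => -> ->; lia.
    apply: wp_if => //=; rewrite ?vk ?andbT ?(rg_r rg1); try by lia.
    * move=> rk; have lkr : lo k = r.-1 by lia.
      apply: wp_seq; apply: wp_st; rewrite /= ?vk //; try by lia.
      apply: wp_st; rewrite /= ?vk //; try by lia.
      rewrite /Inv /= /upd /= ?vk; split; first by rewrite /=; lia.
      split; last split.
      - rewrite /=; case: ds1 => d1 d2 d3; split.
        + move=> u un; have := d1 u un; case: (u =P k) => [->|//].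
          by rewrite spk; lia.
        + by case: eqP => // ?; lia.
        + by case: eqP => // ?; lia.
      - right; rewrite /= g0; split=> //.
        + by rewrite weightS spk; nia.
        + rewrite spk eqxx mul0n addn0 -[RHS]ck; apply: eq_code => u uk _.
          by case: eqP => // ?; lia.
        + by move=> u uk; case: eqP => [?|_]; [lia|apply: same; lia].
      - by move=> u uk /=; case: eqP => [?|_]; [lia|apply: same; lia].
    * move=> rk.
      apply: wp_seq; apply: wp_st; rewrite /= ?vk ?andbT //; try by lia.
      apply: wp_seq; apply: wp_st; rewrite /= /upd /= ?vk ?andbT //; try by lia.
      apply: wp_set; rewrite //=; first by lia.
      rewrite /Inv /= /upd /= ?vk; split; first by rewrite /=; lia.
      split; last split.
      - rewrite /=; case: ds1 => d1 d2 d3; split.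
        + move=> u un; have := d1 u un; case: (u =P k) => [->|//].
          by rewrite spk; lia.
        + by case: eqP => // ?; lia.
        + by case: eqP => // ?; lia.
      - left; split=> //.
        rewrite /= spk eqxx (@eq_code _ _ _ _ (ia s1 1)); last first.
          by move=> u uk _; case: eqP => // ?; lia.
        by rewrite ck sk; nia.
      - by move=> u uk /=; case: eqP => [?|_]; [lia|apply: same; lia].
  + move: dk; case: ifP => [spk [hk lk]|spk _]; first by rewrite hk; lia.
    move=> _; apply: wp_skip; split; first by rewrite /=; lia.
    rewrite /Inv /= /upd /=; split=> //; split; last by move=> u uk; rewrite same // ltnW.
    right; rewrite /= spk !addn0 weightS spk; split=> // u uk.
    by apply: same; apply: ltnW.
- move=> s1 f vk [ds1 [c1 _]] t1; split; first by move: t1; rewrite /s0 /=; lia.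
  split=> //.
  by case: c1 => [[? ?]|[? ? _ _]]; [left|right].
Qed.

Definition table0 (s : st) i : R := if i < base n r m then ra s 0 i else 0%R.

Lemma eq_F Q E T T' phi : wfQ n Q E -> E <= 2 * m -> col n r phi ->
  (forall i, i < 3 * base n r m -> T i = T' i) -> F (R := R) n r Q T phi = F n r Q T' phi.
Proof.
move=> [_ fQ _] E2 cp h; rewrite /F big_seq [RHS]big_seq; apply: eq_bigr => q qQ.
apply: h; have := blk_below r_gt0 (fQ q qQ) (adr_blk r_gt0 (fQ q qQ) cp).
have := base_mono n r_gt0 E2; have := zr_S n_gt0 r_gt1 S_def; rewrite /zbase; lia.
Qed.

Definition leaf_cost K :=
  6 * base n r m + K * (36 * (r * r * r)) + K * (28 * r) + 11 * n + 20.

(** The leaves come in the order of [code]: after t of them, the best score is the maximum over all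
    colourings with code below t, and [weight n] exceeds every code. The chain ends with the
    constant alone, so the maximum of a leaf stands in cell 0. *)
Lemma wp_search (s : st) K Q0 E : regs s -> bnd s -> dstate (ia s 1) (ia s 2) ->
  code n (ia s 1) = 0 -> v s 6 = K -> K < S -> wfQ n Q0 m ->
  chain n r m Q0 Sp (mkseq (opat s) K) [:: FK] E ->
  wp Csearch (fun s' => tm s' <= tm s + (weight n * (leaf_cost K).+1 + 3) /\
    exists phi, [/\ col n r phi, forall u, u < n -> ia s' 0 u = phi u,
      w s' 0 = F n r Q0 (table0 s) phi &
      forall psi, col n r psi -> (F n r Q0 (table0 s) psi <= w s' 0)%R]) s.
Proof.
move=> rg bs ds c0 vK KS wf0 ch.
have hz := zr_S n_gt0 r_gt1 S_def.
have sf k : k < K -> opsafe n r m (opat s k).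
  by move=> kK; have := chain_safe r_gt0 (opat s 0) ch (k := k); rewrite size_mkseq nth_mkseq //; apply.
apply: wp_seq; apply: wp_set => //; first by rewrite /=; lia.
apply: wp_seq; apply: wp_set => //; set s0 := setv _ 27 _.
have f0 : fr (Seq (ISet 28 (Cst 0)) (ISet 27 (Cst 0))) s s0.
  split=> [j|//|//|//|[h1 h2]]; first by rewrite !inE /s0 /= /upd => /norP[/negPf -> /negPf ->].
  by split=> // j; rewrite /s0 /= /upd; case: ifP => _; [lia|]; case: ifP => _; [lia|exact: h1].
have rg0 := regs_fr f0 rg isT; have bs0 := fr_b f0 bs.
pose good t (s1 : st) := exists phi, [/\ col n r phi, forall u, u < n -> ia s1 0 u = phi u,
      w s1 0 = F n r Q0 (table0 s) phi &
      forall psi, col n r psi -> code n psi < t -> (F n r Q0 (table0 s) psi <= w s1 0)%R].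
pose Inv j (s1 : st) := exists t, [/\ j = weight n - t, dstate (ia s1 1) (ia s1 2),
  v s1 28 = 1 /\ t = code n (ia s1 1) \/ v s1 28 = 0 /\ t = weight n &
  t = 0 /\ v s1 27 = 0 \/ [/\ 0 < t, v s1 27 = 1 & good t s1]].
apply: (@wp_while _ _ _ _ _ _ (weight n) (leaf_cost K) Inv).
- exists 0; rewrite subn0; split=> //=; first by left.
  by left.
- move=> s1 j f1 [t [ej ds1 gt bt]]; split=> //= go1.
  have {}gt : t = code n (ia s1 1) by case: gt => [[]|[g _]] //; move: go1; rewrite g.
  have rg1 := regs_fr f1 rg0 isT; have bs1 := fr_b f1 bs0.
  have dm := dstate_dom ds1.
  have tlt : t < weight n.
    by rewrite gt; apply: code_lt => // u un su; apply: dstate_lt ds1 un su.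
  apply: wp_seq; apply: (wp_use (wp_copy n_gt0 r_gt1 S_def rg1)) => s2 f2 [t2 cp1 cp2].
  have rg2 := regs_fr f2 rg1 isT; have bs2 := fr_b f2 bs1.
  have op2 : opat s2 =1 opat s.
    by move=> k; rewrite (opat_fr f2 isT) (opat_fr f1 isT).
  have sf2 k : k < K -> opsafe n r m (opat s2 k) by rewrite op2; apply: sf.
  have K2 : v s2 6 = K by rewrite (fr_v f2) // (fr_v f1).
  have lo2 : ia s2 1 = ia s1 1 by rewrite (fr_i f2).
  have hi2 : ia s2 2 = ia s1 2 by rewrite (fr_i f2).
  apply: wp_seq; apply: (wp_use (wp_eval n_gt0 r_gt1 S_def rg2 bs2 lo2 hi2 dm K2 KS sf2)).
  move=> s3 f3 [t3 [Ts [T0 TK Tp]]].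
  have rg3 := regs_fr f3 rg2 isT; have bs3 := fr_b f3 bs2.
  have op3 : opat s3 =1 opat s by move=> k; rewrite (opat_fr f3 isT) op2.
  have Tp' k : k < size (mkseq (opat s) K) ->
      op_post r (ia s1 1) (ia s1 2) (nth (opat s 0) (mkseq (opat s) K) k) (Ts k) (Ts k.+1).
    by rewrite size_mkseq => kK; rewrite nth_mkseq // -op2; apply: Tp.
  have z0 : zeros n r m m (Ts 0).
    by move=> i hi; rewrite T0; apply: cp2; lia.
  have F0 phi : col n r phi -> F n r Q0 (Ts 0) phi = F n r Q0 (table0 s) phi.
    move=> cphi; apply: (eq_F wf0 _ cphi); first by lia.
    move=> i hi; rewrite T0 /table0; case: ltnP => il; first by rewrite cp1 // (fr_r f1).
    by apply: cp2; lia.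
  have [_ opt] := chain_opt r_gt0 ch dm z0 Tp'.
  rewrite size_mkseq TK in opt.
  have FKE psi : F n r [:: FK] (ra s3 1) psi = ra s3 1 0 by rewrite /F big_seq1.
  apply: wp_seq; apply: wp_rld => //=; first by lia.
  set s4 := setw _ _ _.
  have f4 : fr (RSum 3 3 3) s3 s4.
    by split=> // i; rewrite inE /s4 /= /upd => /negPf ->.
  (* A colouring with code t agrees on [Sp] with the current bounds by [code_inj], so it lies in the
     domain of this leaf. *)
  have lt_t psi : col n r psi -> code n psi = t -> (F n r Q0 (table0 s) psi <= ra s3 1 0)%R.
    move=> [cpsi cpsi0] ct; rewrite -F0 // -(FKE psi); apply: opt => u un.
    case: (ltnP u n) => [un'|nu]; last first.
      have -> : u = n by lia.
      by case: dm => _ -> -> _; rewrite cpsi0.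
    case: (ds1) => /(_ u un') + _ _; case: ifP => [su [hu lu]|_ [-> ->]]; last exact: cpsi.
    have -> : psi u = ia s1 1 u.
      apply: (@code_inj r Sp r_gt0 n) => //; last by rewrite ct gt.
      - by move=> u' u'n _; apply: cpsi.
      - by move=> u' u'n su'; apply: dstate_lt ds1 u'n su'.
    by lia.
  (* The continuation shared by a leaf that improves the best score and one that does not. *)
  have odo s5 (c := Seq (RSum 0 0 0) (Seq Cupdate (RSum 3 3 3))) : fr c s3 s5 ->
     tm s5 <= tm s4 + (3 * n + K * (28 * r) + 11) ->
     v s5 27 = 1 -> good t.+1 s5 ->
     wp Codo (fun s6 => tm s6 <= tm s1 + leaf_cost K /\ exists2 k', k' < j & Inv k' (tick s6)) s5.
    move=> f5 t5 fl5 g5.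
    have rg5 := regs_fr f5 rg3 isT; have bs5 := fr_b f5 bs3.
    have lo5 : ia s5 1 = ia s1 1 by rewrite (fr_i f5) // (fr_i f3).
    have hi5 : ia s5 2 = ia s1 2 by rewrite (fr_i f5) // (fr_i f3).
    apply: (wp_use (wp_odo rg5 bs5 lo5 hi5 ds1)) => s6 f6 [t6 [ds6 gc]].
    split; first by move: t2 t3 t5 t6; rewrite /leaf_cost /s4 /=; lia.
    exists (weight n - t.+1); first by lia.
    exists t.+1; split=> //=.
    - by case: gc => [[-> ->]|[-> ->]]; [left|right]; rewrite gt.
    - right; split=> //; first by rewrite (fr_v f6).
      case: g5 => phi [p1 p2 p3 p4]; exists phi; split=> //=.
      + by move=> u un; rewrite (fr_i f6) // p2.
      + by rewrite (fr_w f6).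
      + by move=> psi cpsi ct; rewrite (fr_w f6) //; apply: p4.
  have upd5 s5 : fr (RSum 3 3 3) s3 s5 -> w s5 3 = ra s3 1 0 -> tm s5 <= tm s4 + 2 ->
    (0 < t -> good t s1 /\ (w s1 0 <= ra s3 1 0)%R) ->
    wp Cupdate (wp Codo (fun s6 => tm s6 <= tm s1 + leaf_cost K /\ exists2 k', k' < j & Inv k' (tick s6))) s5.
    move=> f5 w5 t5 hb.
    have rg5 := regs_fr f5 rg3 isT; have bs5 := fr_b f5 bs3.
    apply: wp_seq; apply: wp_set => //=; first by lia.
    apply: wp_seq; apply: wp_rsum => /=; rewrite w5 (rg_0 rg5) GRing.addr0.
    set s6 := setw _ _ _.
    have f6 : fr (Seq (ISet 27 (Cst 0)) (RSum 0 0 0)) s5 s6.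
      split=> [k|k|//|//|[h1 h2]].
      - by rewrite /= !inE /upd => /negPf ->.
      - by rewrite /= !inE /upd => /negPf ->.
      - by split=> // k; rewrite /= /upd; case: ifP => // _; lia.
    have rg6 := regs_fr f6 rg5 isT; have bs6 := fr_b f6 bs5.
    have op6 : opat s6 =1 opat s.
      by move=> k; rewrite (opat_fr f6 isT) (opat_fr f5 isT) op3.
    have lo6 : ia s6 1 = ia s1 1 by rewrite (fr_i f6) // (fr_i f5) // (fr_i f3).
    have hi6 : ia s6 2 = ia s1 2 by rewrite (fr_i f6) // (fr_i f5) // (fr_i f3).
    have K6 : v s6 6 = K by rewrite (fr_v f6) // (fr_v f5) // (fr_v f3).
    have T6 : ra s6 1 = ra s3 1 by rewrite (fr_r f6) // (fr_r f5).
    have sf6 k : k < K -> opsafe n r m (opat s6 k) by rewrite op6; apply: sf.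
    apply: (wp_use (wp_recover n_gt0 r_gt1 S_def rg6 bs6 lo6 hi6 T6 dm K6 KS sf6)).
    move=> s7 f7 [t7 [phis [ph0 phin phst]]].
    have ip0 : indom n (ia s1 1) (ia s1 2) (phis 0) by apply: phin.
    have cp0 := indom_col r_gt0 dm ip0.
    have Fval : F n r Q0 (table0 s) (phis 0) = ra s3 1 0.
      rewrite -F0 // -(FKE (phis K)) -TK.
      have := chain_rec r_gt0 ch dm z0 Tp' (Te := ra s3 1) (phis := phis); rewrite size_mkseq; apply.
      - by move=> i _ _; rewrite TK.
      - exact: phin.
      - move=> k kK /=; rewrite nth_mkseq //; have := phst k kK; rewrite op6.
        by case=> c bc ec; exists c.
    apply: odo.
    - case: f5 => a1 a2 a3 a4 a5; case: f6 => b1 b2 b3 b4 b5; case: f7 => d1 d2 d3 d4 d5.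
      have sub (l l' : seq nat) k : {subset l <= l'} -> k \notin l' -> k \notin l.
        by move=> ll /negP h; apply/negP => /ll.
      split.
      + by move=> k h; rewrite d1 ?b1 ?a1 //; apply: sub h => i; rewrite !inE => ->; rewrite ?orbT.
      + by move=> k h; rewrite d2 ?b2 ?a2 //; apply: sub h => i; rewrite /= !inE; lia.
      + by move=> k h; rewrite d3 ?b3 ?a3.
      + by move=> k h; rewrite d4 ?b4 ?a4.
      + by move/a5/b5/d5.
    - by move: t7 t5; rewrite /s6 /=; lia.
    - by rewrite (fr_v f7).
    - have w7 : w s7 0 = ra s3 1 0 by rewrite (fr_w f7).
      exists (phis 0); split=> //.
      + by move=> u un; rewrite ph0.
      + by rewrite w7 Fval.
      + move=> psi cpsi; rewrite ltnS leq_eqVlt => /orP[/eqP ct|ct]; first by rewrite w7; apply: lt_t.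
        have [[phi [_ _ _ p4]] le1] := hb (leq_ltn_trans (leq0n _) ct).
        by rewrite w7; apply: Order.POrderTheory.le_trans (p4 _ cpsi ct) le1.
  apply: wp_seq; apply: wp_if => //=.
  + rewrite (fr_v f3) // (fr_v f2) // leqn0 => /eqP fl0; apply: upd5; [by case: f4|by []|by rewrite /=; lia|].
    by case: bt => [[-> _]//|[_ fl1 _]]; rewrite fl1 in fl0.
  + rewrite (fr_v f3) // (fr_v f2) // => fl1.
    have {bt} [t0 fl gd] : [/\ 0 < t, v s1 27 = 1 & good t s1].
      by case: bt => // -[_ fl0]; rewrite fl0 in fl1.
    apply: wp_ifr => /= cmp.
    * apply: wp_skip; apply: odo => //=; try by lia.
      -- by split=> // k; rewrite /= /upd; case: (k =P 3) => // ->.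
      -- by rewrite (fr_v f3) // (fr_v f2).
      -- case: gd => phi [p1 p2 p3 p4]; exists phi; split=> //=.
         ++ by move=> u un; rewrite (fr_i f3) // (fr_i f2) // p2.
         ++ by rewrite /upd /= (fr_w f3) // (fr_w f2).
         ++ move=> psi cpsi; rewrite /upd /= (fr_w f3) // (fr_w f2) //.
            rewrite ltnS leq_eqVlt => /orP[/eqP ct|ct]; last exact: p4.
            apply: (Order.POrderTheory.le_trans (lt_t _ cpsi ct)).
            by move: cmp; rewrite /upd /= (fr_w f3) // (fr_w f2).
    * apply: upd5; [by case: f4|by []|by rewrite /=; lia|].
      move=> _; split=> //; move: cmp; rewrite /upd /= (fr_w f3) // (fr_w f2) //.
      exact: Order.POrderTheory.ltW.
- move=> s1 j f1 [t [ej ds1 gt bt]] /= go0 t1.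
  have {}gt : t = weight n by case: gt => [[g _]|[]] //; rewrite g in go0.
  have w0 := weight_gt0 Sp r_gt0 n.
  split; first by move: t1; rewrite /s0 /=; lia.
  case: bt => [[t0 _]|[_ _ [phi [p1 p2 p3 p4]]]]; first by lia.
  exists phi; split=> //= psi cpsi; apply: p4 => //; rewrite gt.
  by apply: code_lt => // u un _; case: cpsi => h _; apply: h.
Qed.
End Search.

(** * Graphs as arrays of end points, degrees, weights and factors *)

Section Graph.
Variable n : nat.
Local Open Scope nat_scope.
Implicit Types (M el hi : nat -> nat) (E : nat).

(* A graph is an array M of end points: edge e joins M (2e) and M (2e+1), and a
   deleted edge has both its ends at the dummy vertex n. *)
Definition gwf M E := forall e, e < E ->
  (M (2 * e) = n /\ M (2 * e + 1) = n) \/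
  [/\ M (2 * e) < n, M (2 * e + 1) < n & M (2 * e) != M (2 * e + 1)].

Definition joins M e u u' :=
  (M (2 * e) == u) && (M (2 * e + 1) == u') || (M (2 * e) == u') && (M (2 * e + 1) == u).

Definition simple M E := forall e e' u u', e < E -> e' < E -> u < n -> u' < n ->
  joins M e u u' -> joins M e' u u' -> e = e'.

Definition deg M E u := \sum_(0 <= e < E) ((M (2 * e) == u) + (M (2 * e + 1) == u)).
Definition nlive M E := \sum_(0 <= e < E) (M (2 * e) < n).
Definition kill M j := upd (upd M (2 * j) n) (2 * j + 1) n.
Definition addedge M E x z := upd (upd M (2 * E) x) (2 * E + 1) z.

Lemma sum_change (f g : nat -> nat) E j c : j < E -> f j = g j + c ->
  (forall e, e < E -> e != j -> f e = g e) ->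
  \sum_(0 <= e < E) f e = \sum_(0 <= e < E) g e + c.
Proof.
elim: E => // E IH jE fj h; rewrite !big_nat_recr //=.
have [jE'|jE'] := eqVneq j E.
  have -> : \sum_(0 <= e < E) f e = \sum_(0 <= e < E) g e.
    by apply: eq_big_nat => e /andP[_ eE]; apply: h; lia.
  by rewrite -jE' fj addnA.
have hE : f E = g E by apply: h; rewrite // eq_sym.
rewrite IH ?hE //; first by lia.
  by lia.
by move=> e eE; apply: h; lia.
Qed.

Lemma sum_indicator E u : \sum_(0 <= e < E) (u == e) = (u < E).
Proof.
elim: E => [|E IH]; first by rewrite big_geq.
by rewrite big_nat_recr //= IH; lia.
Qed.

Lemma kill0 M j e : kill M j (2 * e) = if e == j then n else M (2 * e).
Proof. by rewrite /kill !updE; repeat case: eqP => //; lia. Qed.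

Lemma kill1 M j e : kill M j (2 * e + 1) = if e == j then n else M (2 * e + 1).
Proof. by rewrite /kill !updE; repeat case: eqP => //; lia. Qed.

Lemma add0 M E x z e : addedge M E x z (2 * e) = if e == E then x else M (2 * e).
Proof. by rewrite /addedge !updE; repeat case: eqP => //; lia. Qed.

Lemma add1 M E x z e : addedge M E x z (2 * e + 1) = if e == E then z else M (2 * e + 1).
Proof. by rewrite /addedge !updE; repeat case: eqP => //; lia. Qed.

Lemma deg_kill M E j u : j < E -> u < n ->
  deg M E u = deg (kill M j) E u + ((M (2 * j) == u) + (M (2 * j + 1) == u)).
Proof.
move=> jE un; apply: (sum_change jE) => [|e _ ej]; rewrite kill0 kill1 ?eqxx ?(negPf ej) //.
by have -> : (n == u) = false by [lia].
Qed.

Lemma nlive_kill M E j : j < E -> M (2 * j) < n -> nlive M E = nlive (kill M j) E + 1.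
Proof.
move=> jE lj; apply: (sum_change jE) => [|e _ ej]; rewrite kill0 ?eqxx ?(negPf ej) //.
by rewrite lj ltnn.
Qed.

Lemma gwf_kill M E j : gwf M E -> gwf (kill M j) E.
Proof. by move=> h e eE; rewrite kill0 kill1; case: eqP => [_|_]; [left|apply: h]. Qed.

Lemma joins_kill M j e u u' : u < n -> u' < n -> joins (kill M j) e u u' = (e != j) && joins M e u u'.
Proof.
move=> un un'; rewrite /joins kill0 kill1; case: (e =P j) => //= _.
have -> : (n == u) = false by lia.
by have -> : (n == u') = false by [lia].
Qed.

Lemma simple_kill M E j : simple M E -> simple (kill M j) E.
Proof.
move=> h e e' u u' eE eE' un un'; rewrite !joins_kill // => /andP[_ h1] /andP[_ h2].
exact: h eE eE' un un' h1 h2.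
Qed.

Lemma deg_add M E x z u : deg (addedge M E x z) E.+1 u = deg M E u + ((x == u) + (z == u)).
Proof.
rewrite /deg big_nat_recr //= add0 add1 eqxx; congr (_ + _).
rewrite !big_nat; apply: eq_bigr => e /andP[_ eE]; rewrite add0 add1.
by have -> : (e == E) = false by [lia].
Qed.

Lemma nlive_add M E x z : x < n -> nlive (addedge M E x z) E.+1 = nlive M E + 1.
Proof.
move=> xn; rewrite /nlive big_nat_recr //= add0 eqxx xn; congr (_ + _).
rewrite !big_nat; apply: eq_bigr => e /andP[_ eE]; rewrite add0.
by have -> : (e == E) = false by [lia].
Qed.

Lemma gwf_add M E x z : gwf M E -> x < n -> z < n -> x != z -> gwf (addedge M E x z) E.+1.
Proof.
move=> h xn zn xz e eE; rewrite add0 add1; case: (e =P E) => [_|ne]; first by right.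
by apply: h; lia.
Qed.

Lemma joins_add M E x z e u u' : joins (addedge M E x z) e u u' =
  if e == E then (x == u) && (z == u') || (x == u') && (z == u) else joins M e u u'.
Proof. by rewrite /joins add0 add1; case: ifP. Qed.

Lemma simple_add M E x z : simple M E -> (forall e, e < E -> ~~ joins M e x z) ->
  simple (addedge M E x z) E.+1.
Proof.
move=> h nj e e' u u' eE eE' un un'; rewrite !joins_add.
have P a : a < E -> joins M a u u' -> (x == u) && (z == u') || (x == u') && (z == u) -> False.
  move=> aE ja xz; move: ja xz (nj a aE); rewrite /joins.
  by move=> /orP[]/andP[/eqP-> /eqP->] /orP[]/andP[/eqP-> /eqP->]; rewrite ?eqxx ?orbT.
case: (e =P E) => e1; case: (e' =P E) => e2.
- by move=> _ _; lia.
- by move=> h1 h2; case: (P e') => //; lia.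
- by move=> h1 h2; case: (P e) => //; lia.
- by apply: h => //; lia.
Qed.

Lemma deg_ge M E e u : e < E -> (M (2 * e) == u) || (M (2 * e + 1) == u) -> 0 < deg M E u.
Proof.
move=> eE h; rewrite /deg (@big_cat_nat _ _ _ e 0 E) ?(ltnW eE) //= (@big_ltn _ _ _ e E) //=.
by move: h; case: eqP; case: eqP => //=; lia.
Qed.

Lemma deg0P M E u : deg M E u = 0 -> forall e, e < E -> M (2 * e) <> u /\ M (2 * e + 1) <> u.
Proof.
move=> d0 e eE; have := @deg_ge M E e u eE; rewrite d0.
by case: eqP => //= ?; first (by move=> /(_ isT)); case: eqP => //= ? /(_ isT).
Qed.

Lemma deg_le M E u : deg M E u <= 2 * E.
Proof.
elim: E => [|E IH]; first by rewrite /deg big_geq.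
rewrite /deg big_nat_recr //= -/(deg M E u); lia.
Qed.

Lemma deg_le_live M E u : gwf M E -> u < n -> deg M E u <= 2 * nlive M E.
Proof.
move=> h un; rewrite /deg /nlive big_distrr /= !big_nat; apply: leq_sum => e /andP[_ eE].
by case: (h e eE) => [[-> ->]|[-> _ _]]; lia.
Qed.

(** The value 5 is forced by 2d for d >= 4. A branching at degree 3 lowers the total by 4 times the
    weight of degree 3, so this weight must be at least 5. At degree 4, where a neighbour of degree
    4 may fall to degree 3, the bound 8 + 4 * (8 - 5) = 20 lets it be at most 5. *)
Definition wt d := if d <= 2 then 0 else if d == 3 then 5 else 2 * d.

Lemma wt_mono d d' : d <= d' -> wt d <= wt d'.
Proof. by rewrite /wt; repeat case: ifP; lia. Qed.

Lemma wt_le d : wt d <= 2 * d.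
Proof. by rewrite /wt; repeat case: ifP; lia. Qed.

Definition pot M E := \sum_(0 <= u < n) wt (deg M E u).

Lemma pot_le M E : pot M E <= 4 * E.
Proof.
apply: (@leq_trans (2 * \sum_(0 <= u < n) deg M E u)).
  by rewrite big_distrr; apply: leq_sum => u _; apply: wt_le.
(* Double counting of the ends of edges; ends at the dummy vertex are not counted on the left,
   whence only an inequality. *)
have : \sum_(0 <= u < n) deg M E u <= 2 * E; last by lia.
rewrite /deg exchange_big /=; elim: E => [|E IH]; first by rewrite big_geq.
by rewrite big_nat_recr //= big_split /= !sum_indicator; lia.
Qed.

(** It applies to eliminations: a neighbour of y loses its edge to y and gains at most one new edge,
    so no degree rises. *)
Lemma pot_mono M E M' E' : (forall u, u < n -> deg M' E' u <= deg M E u) -> pot M' E' <= pot M E.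
Proof.
move=> h; rewrite /pot !big_nat; apply: leq_sum => u /andP[_ un].
exact/wt_mono/h.
Qed.

(** The factors still present. By [gwf], looking at one end is enough to tell a live edge from a
    deleted one. *)
Definition Qof el M E : seq factor := FK ::
  [seq FU u | u <- iota 0 n & el u == 0] ++
  [seq FE e (M (2 * e)) (M (2 * e + 1)) | e <- iota 0 E & M (2 * e) < n].

Lemma mem_Qof el M E (q : factor) : q \in Qof el M E =
  match q with
  | None => true
  | Some (inl u) => (u < n) && (el u == 0)
  | Some (inr (e, a, b)) => [&& e < E, a == M (2 * e), b == M (2 * e + 1) & a < n]
  end.
Proof.
rewrite inE mem_cat; case: q => [[u|[[e a] b]]|] //=.
- apply/orP/andP => [[/mapP[u' + [->]]|/mapP[? _]//]|[un eu]].
    by rewrite mem_filter mem_iota => /and3P[-> _ ->].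
  by left; apply/mapP; exists u; rewrite // mem_filter mem_iota eu.
- apply/orP/and4P => [[/mapP[? _]//|/mapP[e' + [-> -> ->]]]|[eE /eqP-> /eqP-> le]].
    by rewrite mem_filter mem_iota => /and3P[-> _ ->].
  by right; apply/mapP; exists e; rewrite // mem_filter mem_iota le.
Qed.

Lemma uniq_Qof el M E : uniq (Qof el M E).
Proof.
rewrite /Qof /= mem_cat negb_or cat_uniq.
apply/andP; split; first by apply/andP; split; apply/mapP => -[].
apply/and3P; split.
- by rewrite map_inj_uniq ?filter_uniq ?iota_uniq // => u u' [].
- by apply/hasPn => q /mapP[e _ ->]; apply/mapP => -[].
- by rewrite map_inj_uniq ?filter_uniq ?iota_uniq // => u u' [].
Qed.

Lemma wfQ_Qof el M E : gwf M E -> wfQ n (Qof el M E) E.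
Proof.
move=> h; split.
- exact: uniq_Qof.
- move=> q; rewrite mem_Qof; case: q => [[u|[[e a] b]]|] //=; first by case/andP.
  move=> /and4P[eE /eqP-> /eqP-> le]; rewrite eE le /=.
  by case: (h e eE) => [[e1 e2]|[]] //; move: le; rewrite e1 ltnn.
- move=> e a b a' b'; rewrite !mem_Qof => /and4P[_ /eqP-> /eqP-> _] /and4P[_ /eqP-> /eqP-> _].
  by [].
Qed.

Lemma Qof_kill el M E j : j < E -> M (2 * j) < n ->
  perm_eq (Qof el M E) (FE j (M (2 * j)) (M (2 * j + 1)) :: Qof el (kill M j) E).
Proof.
move=> jE lj; apply: uniq_perm => [||q]; [exact: uniq_Qof|rewrite cons_uniq uniq_Qof andbT|].
  by rewrite mem_Qof /= kill0 eqxx; apply/negP => /and4P[_ /eqP-> _]; rewrite ltnn.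
rewrite [in RHS]in_cons !mem_Qof; case: q => [[u|[[e a] b]]|] //=.
rewrite kill0 kill1; case: (e =P j) => [->|ej].
  have -> : (Some (inr (j, a, b)) == FE j (M (2 * j)) (M (2 * j + 1))) = (a == M (2 * j)) && (b == M (2 * j + 1)).
    by apply/eqP/andP => [[-> ->]|[/eqP-> /eqP->]].
  rewrite jE /=; apply/and3P/orP => [[-> -> _]|[/andP[/eqP-> ->]|/and3P[/eqP-> _]]]; [by left|by rewrite eqxx lj|by rewrite ltnn].
have -> // : (Some (inr (e, a, b)) == FE j (M (2 * j)) (M (2 * j + 1))) = false.
by apply/eqP => -[].
Qed.

Lemma Qof_el el M E y : y < n -> el y = 0 ->
  perm_eq (Qof el M E) (FU y :: Qof (upd el y 1) M E).
Proof.
move=> yn ey; apply: uniq_perm => [||q]; [exact: uniq_Qof|rewrite cons_uniq uniq_Qof andbT|].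
  by rewrite mem_Qof /= updE eqxx andbF.
rewrite [in RHS]in_cons !mem_Qof; case: q => [[u|[[e a] b]]|] //=.
rewrite updE; case: (u =P y) => [->|uy]; first by rewrite yn ey !eqxx.
have -> // : (Some (inl u) == FU y) = false.
by apply/eqP => -[/uy].
Qed.

Lemma Qof_add el M E x z : x < n ->
  perm_eq (Qof el (addedge M E x z) E.+1) (FE E x z :: Qof el M E).
Proof.
move=> xn; apply: uniq_perm => [||q]; [exact: uniq_Qof|rewrite cons_uniq uniq_Qof andbT|].
  by rewrite mem_Qof /= ltnn.
rewrite [in RHS]in_cons !mem_Qof; case: q => [[u|[[e a] b]]|] //=.
rewrite add0 add1; case: (e =P E) => [->|ne].
  have -> : (Some (inr (E, a, b)) == FE E x z) = (a == x) && (b == z).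
    by apply/eqP/andP => [[-> ->]|[/eqP-> /eqP->]].
  rewrite ltnSn ltnn /= orbF; apply/and3P/andP => [[-> -> _]|[/eqP-> ->]] //.
have -> : (Some (inr (e, a, b)) == FE E x z) = false by apply/eqP => -[].
by have -> : (e < E.+1) = (e < E) by [lia].
Qed.

End Graph.

(** * Each kind of operation is a step between the factors of two graphs *)

Section Steps.
Variables (n r m : nat).
Hypothesis r_gt1 : (1 < r)%N.
Local Open Scope nat_scope.

Let r_gt0 : 0 < r. Proof. exact: ltnW. Qed.

Lemma baseE e : base n r e = 1 + n * r + e * (r * r).
Proof. by []. Qed.

Lemma pair_lt a c : a < r -> c < r -> a * r + c < r * r.
Proof. by move=> ar cr; have : a.+1 * r <= r * r; [rewrite leq_mul2r ar orbT|lia]. Qed.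

Lemma pair_inj a c a' c' : c < r -> c' < r -> a * r + c = a' * r + c' -> a = a' /\ c = c'.
Proof.
move=> cr cr' e; have ea : a = a'.
  by have := congr1 (divn^~ r) e; rewrite /= !divnMDl // !divn_small // !addn0.
by split=> //; move: e; rewrite ea; lia.
Qed.

Variables (el M : nat -> nat) (E : nat).
Hypothesis gM : gwf n M E.
Hypothesis E2 : E <= 2 * m.

Local Notation base := (base n r).
Local Notation ubase := (ubase r).
Local Notation zbase := (zbase n r m).
Local Notation slot := (slot n r m).
Local Notation elim_step := (elim_step n r m).

Lemma cb_n : cb n r n = 1. Proof. by rewrite /cb ltnn. Qed.

Lemma cb_lt u : u < n -> cb n r u = r. Proof. by rewrite /cb => ->. Qed.

Lemma slot_U y x : slot [:: FU y] y x (fun c _ => ubase y + c).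
Proof. by right; exists (FU y); split=> // c a cr _; rewrite /inblk /=; lia. Qed.

Lemma slot_Zu y x : slot [::] y x (fun c _ => zbase + c).
Proof. by left; split=> // c a cr _; lia. Qed.

(** The dummy vertex only has a = 0, so the address stays within the r zero cells in spite of the
    stride r. *)
Lemma slot_Z y : slot [::] y n (fun c a => zbase + c * 1 + a * (r + 1 - 1)).
Proof. by left; split=> // c a cr; rewrite cb_n => a0; nia. Qed.

(* [ec] is the stride of the colour of y in the table of edge j; that of the
   colour of x is r + 1 - ec. *)
Definition side (N : nat -> nat) j y x ec :=
  [/\ N (2 * j) = y, N (2 * j + 1) = x & ec = r] \/
  [/\ N (2 * j) = x, N (2 * j + 1) = y & ec = 1].

Lemma slot_E N j y x ec : y < n -> x < n -> side N j y x ec ->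
  slot [:: FE j (N (2 * j)) (N (2 * j + 1))] y x
    (fun c a => base j + c * ec + a * (r + 1 - ec)).
Proof.
move=> yn xn [[-> -> ->]|[-> -> ->]]; right.
  exists (FE j y x); split=> // [c a cr|phi _].
    by rewrite cb_lt // /inblk /= => ar; nia.
  by rewrite /=; lia.
exists (FE j x y); split=> // [c a cr|phi _].
  by rewrite cb_lt // /inblk /= => ar; nia.
by rewrite /=; lia.
Qed.

(** Without live edges, the monadic table of y is all that depends on y. *)
Lemma step_final Sp y : y < n -> el y = 0 -> gwf n M E -> (forall e, e < E -> n <= M (2 * e)) ->
  elim_step Sp (Op y n n (ubase y) zbase 1 zbase 1 0 1) (Qof n el M E) E (Qof n (upd el y 1) M E) E.
Proof.
move=> yn ey _ dead; apply: (@Step _ _ _ _ _ _ _ _ _ [:: FU y] [::] [::] (Qof n (upd el y 1) M E) FK) => //=.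
- exact: Qof_el.
- exact: slot_U.
- exact: slot_Z.
- exact: slot_Z.
- by move=> a b; rewrite cb_n /inblk /adg /=; nia.
- by move=> a b a' b'; rewrite cb_n; lia.
- by move=> phi [_ p0]; rewrite /adg /= p0; lia.
- by left; rewrite mem_Qof.
- by split=> //; lia.
- right=> q; rewrite mem_Qof; case: q => [[u|[[e a] b]]|] //=.
    by rewrite updE; case: (u =P y) => //= _; rewrite andbF.
  by move=> /and4P[eE /eqP-> _ le]; have := dead e eE; lia.
- exact: wfQ_Qof.
- exact: wfQ_Qof.
Qed.

(** Nothing is eliminated: y keeps its monadic table and its other edges, which [Sp y] permits. One
    edge of a branching is removed in this way. *)
Lemma step_fold (Sp : pred nat) j y x ec : j < E -> y < n -> x < n -> x != y -> Sp y ->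
  side M j y x ec -> el x = 0 ->
  elim_step Sp (Op y x n zbase (base j) ec zbase 1 (ubase x) 1)
    (Qof n el M E) E (Qof n el (kill n M j) E) E.
Proof.
move=> jE yn xn xy sy sd ex.
have lj : M (2 * j) < n by case: sd => -[-> _ _].
apply: (@Step _ _ _ _ _ _ _ _ _ [::] [:: FE j (M (2 * j)) (M (2 * j + 1))] [::]
  (Qof n el (kill n M j) E) (FU x)) => //=.
- exact: Qof_kill.
- exact: slot_Zu.
- exact: slot_E.
- exact: slot_Z.
- by move=> a b; rewrite cb_n cb_lt // /inblk /adg /=; nia.
- by move=> a b a' b'; rewrite cb_n cb_lt // /adg /=; nia.
- by move=> phi [_ p0]; rewrite /adg /= p0; lia.
- by left; rewrite mem_Qof /= xn ex.
- by split=> //; lia.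
- by left.
- exact: wfQ_Qof.
- by apply/wfQ_Qof/gwf_kill.
Qed.

Lemma step_elim1 Sp j y z fc : j < E -> y < n -> z < n -> z != y ->
  el y = 0 -> side M j y z fc -> el z = 0 -> deg (kill n M j) E y = 0 ->
  elim_step Sp (Op y n z (ubase y) zbase 1 (base j) fc (ubase z) r)
    (Qof n el M E) E (Qof n (upd el y 1) (kill n M j) E) E.
Proof.
move=> jE yn zn zy ey sd ez d0.
have lj : M (2 * j) < n by case: sd => -[-> _ _].
apply: (@Step _ _ _ _ _ _ _ _ _ [:: FU y] [::] [:: FE j (M (2 * j)) (M (2 * j + 1))]
  (Qof n (upd el y 1) (kill n M j) E) (FU z)) => //=.
- rewrite (permPl (Qof_el _ _ yn ey)) perm_cons; exact: Qof_kill.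
- exact: slot_U.
- exact: slot_Z.
- exact: slot_E.
- by move=> a b; rewrite cb_n cb_lt // /inblk /adg /=; nia.
- by move=> a b a' b'; rewrite cb_n cb_lt // /adg /=; nia.
- by move=> phi [_ p0]; rewrite /adg /= p0; lia.
- by left; rewrite mem_Qof /= zn updE (negPf zy) ez.
- by split=> //; lia.
- right=> q; rewrite mem_Qof; case: q => [[u|[[e a] b]]|] //=.
    by rewrite updE; case: (u =P y) => //= _; rewrite andbF.
  move=> /and4P[eE /eqP-> /eqP-> le]; have [h1 h2] := deg0P d0 eE.
  by apply/norP; split; apply/eqP.
- exact: wfQ_Qof.
- by apply/wfQ_Qof/gwf_kill.
Qed.

(** The two alternatives are an existing edge xz, whose table may have either orientation, and a
    fresh one, laid out with x as the first end. *)
Lemma step_elim2 Sp i j y x z ec fc gb ga M' E' : i < E -> j < E ->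
  y < n -> x < n -> z < n -> x != y -> z != y -> x != z -> el y = 0 ->
  let M2 := kill n (kill n M i) j in
  side M i y z fc -> side (kill n M i) j y x ec -> deg M2 E y = 0 ->
  (exists2 e, [/\ e < E, M' = M2 & E' = E] & gb = base e /\ side M2 e x z ga) \/
  [/\ M' = addedge M2 E x z, E' = E.+1, E' <= 2 * m & gb = base E /\ ga = r] ->
  elim_step Sp (Op y x z (ubase y) (base j) ec (base i) fc gb ga)
    (Qof n el M E) E (Qof n (upd el y 1) M' E') E'.
Proof.
move=> iE jE yn xn zn xy zy xz ey M2 sd1 sd2 d0 cs.
have li : M (2 * i) < n by case: sd1 => -[-> _ _].
have lj : kill n M i (2 * j) < n by case: sd2 => -[-> _ _].
have g2 : gwf n M2 E by do 2 apply: gwf_kill.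
(* Division recovers the number of the edge from the address [gb], so that g can be named before the
   two cases are separated. *)
pose g := if E' == E then FE ((gb - base 0) %/ (r * r)) (if ga == r then x else z) (if ga == r then z else x) else FE E x z.
have gE e : gb = base e -> (gb - base 0) %/ (r * r) = e.
  by move=> ->; rewrite !baseE mul0n addn0 addKn mulnK // muln_gt0 r_gt0.
have ga1 : ga = r \/ ga = 1.
  by case: cs => [[e _ [_ [[_ _ ->]|[_ _ ->]]]]|[_ _ _ [_ ->]]]; [left|right|left].
have r1 : (1 == r) = false by lia.
have adgE : exists2 b, gb = base b & g = FE b (if ga == r then x else z) (if ga == r then z else x).
  case: cs => [[e [_ _ eE] [gbe _]]|[_ eE _ [gbe ->]]].
    by exists e; rewrite // /g eE eqxx (gE _ gbe).
  by exists E; rewrite // /g eE eqxx (gtn_eqF (ltnSn E)).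
have [b gbb gb'] := adgE.
have [q1 q2] : r + 1 - r = 1 /\ r + 1 - 1 = r by lia.
apply: (@Step _ _ _ _ _ _ _ _ _ [:: FU y] [:: FE j (kill n M i (2 * j)) (kill n M i (2 * j + 1))]
  [:: FE i (M (2 * i)) (M (2 * i + 1))] (Qof n (upd el y 1) M2 E) g) => //=.
- rewrite (permPl (Qof_el _ _ yn ey)) perm_cons.
  rewrite (permPl (Qof_kill _ iE li)).
  rewrite -[X in perm_eq _ X]/([:: _] ++ [:: _] ++ Qof n (upd el y 1) M2 E).
  rewrite perm_sym perm_catCA /= perm_cons perm_sym; exact: Qof_kill.
- exact: slot_U.
- exact: slot_E.
- exact: slot_E.
- move=> a c; rewrite !cb_lt // gb' /inblk /adg /= gbb.
  move=> ar cr; have := pair_lt ar cr; have := pair_lt cr ar.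
  by case: ga1 => ->; rewrite ?q1 ?q2; lia.
- move=> a c a' c'; rewrite !cb_lt // /adg /=.
  move=> ar cr ar' cr' e.
  have [e1|e1] : a * r + c = a' * r + c' \/ c * r + a = c' * r + a'.
    by case: ga1 e => ->; rewrite ?q1 ?q2; lia.
  - exact: pair_inj cr cr' e1.
  - by have [-> ->] := pair_inj ar ar' e1.
- move=> phi _; rewrite gb' /adg /= gbb.
  by case: ga1 => ->; rewrite ?eqxx ?r1; lia.
- case: cs => [[e [eE -> ->] [gbe sd]]|[eM eE E2' [gbe _]]].
    left; split=> //; split=> //; rewrite gb'.
    have -> : b = e by rewrite -(gE _ gbb) (gE _ gbe).
    by rewrite mem_Qof /= eE; case: sd => -[-> -> ->]; rewrite ?r1 !eqxx.
  have gEE : g = FE E x z by rewrite /g eE (gtn_eqF (ltnSn E)).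
  right; rewrite gEE eM eE; rewrite eE in E2'; split=> //=; first exact: Qof_add.
  by rewrite !baseE; lia.
- by split=> //; rewrite 1?eq_sym //; lia.
- right=> q; rewrite mem_Qof; case: q => [[u|[[e a] c]]|] //=.
    by rewrite updE; case: (u =P y) => //= _; rewrite andbF.
  move=> /and4P[eE /eqP-> /eqP-> le]; have [h1 h2] := deg0P d0 eE.
  by apply/norP; split; apply/eqP.
- exact: wfQ_Qof.
- case: cs => [[e [eE -> ->] _]|[-> -> _ _]]; first exact: wfQ_Qof.
  by apply/wfQ_Qof/gwf_add.
Qed.

End Steps.

(** * Recording an operation *)

Section Emit.
Variables (R : realType) (S : nat).
Local Open Scope nat_scope.
Local Notation st := (st R).
Local Notation wp := (@wp R S).
Local Notation bnd := (bnd S).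

Definition oregs (s : st) := Op (v s 9) (v s 13) (v s 14) (v s 19) (v s 15) (v s 16)
  (v s 17) (v s 18) (v s 20) (v s 21).

Lemma wp_stores l s : uniq [seq p.2 | p : nat * nat <- l] -> bnd s -> v s 6 < S ->
  wp (Cstores l) (fun s' => [/\ tm s' <= tm s + size l, v s' = v s &
     forall d a, (d, a) \in l -> ia s' a = upd (ia s a) (v s 6) (v s d)]) s.
Proof.
elim: l s => [|[d a] l IH] s /=; first by move=> *; apply: wp_skip; split=> //; lia.
move=> /andP[al ul] bs kS.
apply: wp_seq; apply: wp_st; rewrite //=; first by apply: bs.1.
set s1 := seti _ _ _ _.
have b1 : bnd s1.
  case: bs => h1 h2; split=> // b i iS; rewrite /= upd2E; case: ifP => // _; exact: h2.
apply: (wp_use (IH s1 ul b1 kS)) => s2 f2 [t2 e2 h2]; split=> //.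
  by move: t2; rewrite /=; lia.
move=> d' a'; rewrite inE => /orP[/eqP[-> ->]|h].
  rewrite (fr_i f2) /= ?updE ?eqxx //.
  by move: al; elim: (l) => //= -[d1 a1] l' IHl; rewrite !inE /= !negb_or => /andP[-> /IHl].
rewrite (h2 d' a' h) /= updE; case: eqP => // e.
by case/negP: al; rewrite -e; apply/mapP; exists (d', a').
Qed.

Lemma wp_emit s k : bnd s -> v s 6 = k -> k < S ->
  wp Cemit (fun s' => [/\ tm s' <= tm s + 11, v s' 6 = k.+1 &
    mkseq (opat s') k.+1 = rcons (mkseq (opat s) k) (oregs s)]) s.
Proof.
move=> bs vk kS; apply: wp_seq; apply: (wp_use (wp_stores (l := _) _ bs _)) => //; first by rewrite vk.
move=> s1 f1 [t1 e1 h1]; apply: wp_set; rewrite //= e1 vk; first by lia.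
split; first by move: t1; rewrite /=; lia.
  by rewrite /upd /= addn1.
rewrite mkseqS; congr rcons; last first.
  by rewrite /opat /oregs /= (h1 9 4) // (h1 13 5) // (h1 14 6) // (h1 19 7) // (h1 15 8) // (h1 16 9) // (h1 17 10) // (h1 18 11) // (h1 20 12) // (h1 21 13) // vk /upd !eqxx.
apply/eq_in_map => i; rewrite mem_iota add0n => /andP[_ ik].
rewrite /opat /= (h1 9 4) // (h1 13 5) // (h1 14 6) // (h1 19 7) // (h1 15 8) // (h1 16 9) // (h1 17 10) // (h1 18 11) // (h1 20 12) // (h1 21 13) // vk /upd.
by have -> : (i == k) = false by [lia].
Qed.

End Emit.

(** * Scans of the edge list: degrees, an edge at y, the edge xz *)

Section Plan.
Variables (R : realType) (S n r m : nat).
Hypothesis n_gt0 : (0 < n)%N.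
Hypothesis r_gt1 : (1 < r)%N.
Hypothesis S_def : S = (8 * base n r m)%N.
Local Open Scope nat_scope.
Local Notation st := (st R).
Local Notation regs := (@regs R n r m).
Local Notation wp := (@wp R S).
Local Notation fr := (fr S).
Local Notation bnd := (bnd S).

Let r_gt0 : 0 < r. Proof. exact: ltnW. Qed.

Lemma mS : 5 * m + 5 < S. Proof.
have : m * (2 * 2) <= m * (r * r) by rewrite !leq_mul.
by rewrite S_def /base; lia.
Qed.

Lemma base_S e : e <= 2 * m -> base n r e <= S.
Proof.
move=> em; have := base_mono n r_gt0 em; have := zr_S n_gt0 r_gt1 S_def.
by rewrite -/(zbase n r m) S_def; lia.
Qed.

Lemma ubase_S u : u < n -> 0 < ubase r u <= S.
Proof. by move=> un; have := ubase_lt r_gt0 un r_gt0; have := base_S (leq0n _); rewrite /ubase; lia. Qed.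

Section Scans.
Variables (s : st) (M : nat -> nat) (E : nat).
Hypothesis rg : regs s.
Hypothesis bs : bnd s.
Hypothesis vM : ia s 0 = M.
Hypothesis vE : v s 5 = E.
Hypothesis E2 : E <= 2 * m.

Lemma M_S e : e <= E -> M (2 * e) <= S /\ M (2 * e + 1) <= S.
Proof.
move=> eE; have := mS; case: bs => _ h hS; rewrite -vM; split; apply: h; lia.
Qed.

Definition key u := let d := deg M E u in if 1 <= d <= 2 then base n r m else d.

Lemma wp_choose : gwf n M E -> nlive n M E <= m ->
  wp Cchoose (fun s' => [/\ tm s' <= tm s + (n * (3 * E + 12) + 3),
    v s' 8 = 0 \/ v s' 9 < n /\ v s' 8 = key (v s' 9) &
    forall u, u < n -> key u <= v s' 8]) s.
Proof.
move=> gM lM; have hm := mS; have hn := nS n_gt0 r_gt1 S_def; have bm := base_S (leq_pmull m (isT : 0 < 2)).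
pose Inv k (s1 : st) := (v s1 8 = 0 \/ v s1 9 < n /\ v s1 8 = key (v s1 9)) /\
    forall u, u < k -> key u <= v s1 8.
apply: wp_seq; apply: wp_set => //; set s0 := setv _ _ _.
have b0 : bnd s0 by case: bs => h1 h2; split=> // j; rewrite /= updE; case: ifP.
apply: (@wp_for _ _ _ _ _ _ _ 0 n (3 * E + 10) Inv).
- by [].
- by [].
- by lia.
- by lia.
- by [].
- by move=> s1 k _ f _ _; rewrite /= (fr_v f) // /s0 /= /upd /= (rg_n rg).
- by split=> //; left.
- move=> s1 u /andP[_ un] f vu [i1 i2].
  have bs1 := fr_b f b0.
  have vE1 : v s1 5 = E by rewrite (fr_v f).
  have vM1 : ia s1 0 = M by rewrite (fr_i f).
  apply: wp_seq; apply: wp_seq; apply: wp_set => //; set s2 := setv _ _ _.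
  apply: (@wp_for_tick _ _ _ _ _ _ _ 0 E 1 (fun k s3 => v s3 11 = deg M k u)).
  + by [].
  + by [].
  + by [].
  + by lia.
  + by lia.
  + by [].
  + by move=> s3 k _ f3 _ _; rewrite /= (fr_v f3).
  + by rewrite /= /deg big_geq.
  + move=> s3 e /andP[_ eE] f3 ve inv.
    have vu3 : v s3 10 = u by rewrite (fr_v f3).
    have vM3 : ia s3 0 = M by rewrite (fr_i f3).
    apply: wp_set; rewrite /= ve ?vu3 ?vM3 ?eqeE ?inv; first by lia.
    * by have := deg_le M e u; lia.
    * split; first by rewrite /=; lia.
      by rewrite /= /upd /= /deg big_nat_recr.
  move=> s3 f3 _ dE t3; rewrite /= in t3.
  have bs3 : bnd s3.
    by apply: (fr_b f3); case: bs1 => h1 h2; split=> // j; rewrite /= updE; case: ifP.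
  have rg3 : regs s3.
    have rg2 : regs s0 by case: rg => *; split.
    have rg1 := regs_fr f rg2 isT.
    by apply: (regs_fr f3) => //; case: rg1 => *; split.
  have v8 : v s3 8 = v s1 8 by rewrite (fr_v f3).
  have v9 : v s3 9 = v s1 9 by rewrite (fr_v f3).
  have v10 : v s3 10 = u by rewrite (fr_v f3).
  have d2 : deg M E u <= 2 * m by have := deg_le_live gM un; lia.
  apply: wp_seq; apply: wp_set; rewrite //= dE; first by lia.
  have fin s5 : v s5 8 = v s1 8 -> v s5 9 = v s1 9 -> v s5 10 = u -> v s5 33 = key u ->
     tm s5 <= tm s3 + 4 ->
     wp (If (Var kk_) (Var best_) Skip (Seq (ISet best_ (Var kk_)) (ISet y_ (Var u_))))
       (fun s6 => tm s6 <= tm s1 + (3 * E + 10) /\ Inv u.+1 (tick (setv s6 10 u.+1))) s5.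
    move=> e8 e9 e10 e33 t5.
    have kS : key u <= S by rewrite /key; case: ifP => _; lia.
    apply: wp_if => //=; rewrite e33 e8 => le.
      apply: wp_skip; split; first by rewrite /=; lia.
      rewrite /Inv /= /upd /= e8 e9; split=> // u'; rewrite ltnS leq_eqVlt => /orP[/eqP->//|].
      exact: i2.
    apply: wp_seq; apply: wp_set; rewrite //= e33 //.
    apply: wp_set; rewrite //= /upd /= e10; first by lia.
    split; first by rewrite /=; lia.
    rewrite /Inv /= /upd /=; split; first by right.
    move=> u'; rewrite ltnS leq_eqVlt => /orP[/eqP->//|/i2]; lia.
  apply: wp_seq; apply: wp_if => //=.
  + rewrite /upd /= dE => d1; apply: wp_if => //=; rewrite /upd /= dE => d3.
      apply: wp_set; rewrite //= /upd /= (rg_L rg3) //.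
      apply: fin; rewrite //= /upd //=; last by lia.
      by rewrite /key d1 d3.
    apply: wp_skip; apply: fin; rewrite //= /upd //=; last by lia.
    rewrite /key; case: ifP => //; lia.
  + rewrite /upd /= ?dE => d1; apply: wp_skip; apply: fin; rewrite //= /upd //=; last by lia.
    rewrite /key; case: ifP => //; lia.
- move=> s1 f vk [i1 i2] t1; split=> //.
  by move: t1; rewrite /s0 /=; lia.
Qed.

Lemma wp_take y : gwf n M E -> v s 9 = y -> y < n ->
  wp Ctake (fun s' => tm s' <= tm s + (4 * E + 12) /\
    ([/\ deg M E y = 0, ia s' 0 = M & [/\ v s' 13 = n, v s' 15 = zbase n r m & v s' 16 = 1]] \/
     exists j, [/\ j < E, v s' 15 = base n r j, ia s' 0 = kill n M j &
        [/\ side r M j y (v s' 13) (v s' 16), v s' 13 < n & v s' 13 != y]])) s.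
Proof.
move=> gM vy yn; have hm := mS; have hn := nS n_gt0 r_gt1 S_def; have hr := rS n_gt0 r_gt1 S_def.
pose inc e := (M (2 * e) == y) || (M (2 * e + 1) == y).
pose Inv k (s1 : st) := (v s1 29 = E /\ forall e, e < k -> ~~ inc e) \/ (v s1 29 < E /\ inc (v s1 29)).
apply: wp_seq; apply: wp_seq; apply: wp_set; rewrite //= ?vE; first by lia.
set s0 := setv _ _ _.
have b0 : bnd s0 by case: bs => h1 h2; split=> // j; rewrite /= updE; case: ifP => //; lia.
apply: (@wp_for_tick _ _ _ _ _ _ _ 0 E 2 Inv).
- by [].
- by [].
- by [].
- by lia.
- by lia.
- by [].
- by move=> s1 k _ f _ _; rewrite /= (fr_v f).
- by left.
- move=> s1 e /andP[_ eE] f ve inv.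
  have vM1 : ia s1 0 = M by rewrite (fr_i f).
  have vy1 : v s1 9 = y by rewrite (fr_v f).
  apply: wp_if => //=; rewrite ?ve ?vM1 ?vy1 ?eqeE; first by lia.
    move=> h; apply: wp_set; rewrite //= ve; first by lia.
    split; first by rewrite /=; lia.
    right; rewrite /= /upd /=; split=> //; rewrite /inc; move: h; do 2 case: eqP => //.
  move=> h; apply: wp_skip; split; first by rewrite /=; lia.
  rewrite /Inv /= /upd /=; case: inv => [[j1 j2]|inv]; [left|by right].
  split=> // e'; rewrite ltnS leq_eqVlt => /orP[/eqP->|/j2//].
  by rewrite /inc; move: h; do 2 case: eqP => //.
move=> s1 f1 _ inv t1; rewrite /s0 /= in t1.
have rg1 : regs s1.
  have rg0 : regs s0 by case: rg => *; split.
  exact: regs_fr f1 rg0 isT.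
have vM1 : ia s1 0 = M by rewrite (fr_i f1).
have vE1 : v s1 5 = E by rewrite (fr_v f1).
have vy1 : v s1 9 = y by rewrite (fr_v f1).
apply: wp_if => //=; rewrite vE1.
- move=> Ej; apply: wp_seq; apply: wp_set; rewrite //= (rg_n rg1); first by lia.
  apply: wp_seq; apply: wp_set; rewrite //= /upd /= (rg_z rg1); first by apply: base_S.
  apply: wp_set; rewrite //=; first by lia.
  split; first by rewrite /=; lia.
  left; split=> //.
  case: inv => [[_ no]|[]]; last by lia.
  rewrite /deg big_nat big1 // => e /andP[_ eE]; have := no e eE.
  by rewrite /inc; do 2 case: eqP.
- case: inv => [[-> _]|[jE ij]]; first by rewrite ltnn.
  have m0 : 0 < m by lia.
  move=> _; move: jE ij; have [j vj] : exists j, v s1 29 = j by eexists.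
  rewrite vj => jE ij.
  have [|[M1 M2]] := M_S (e := j); first by lia.
  have ej : (M (2 * j) < n) && (M (2 * j + 1) < n) && (M (2 * j) != M (2 * j + 1)).
    case: (gM j jE) => [[e1 e2]|[-> -> ->]//].
    by move: ij; rewrite /inc e1 e2 => /orP[]/eqP e; rewrite e ltnn in yn.
  have [/andP[m1n m2n] m12] := andP ej.
  apply: wp_seq; apply: wp_set; rewrite //= ?vj (rg_B rg1) (rg_rr rg1 m0) -/(base n r j).
    by apply: base_S; lia.
  set s2 := setv _ _ _.
  have kl s3 x ec : v s3 29 = j -> v s3 0 = n -> ia s3 0 = M -> v s3 13 = x -> v s3 15 = base n r j ->
     v s3 16 = ec -> tm s3 <= tm s1 + 5 -> side r M j y x ec -> x < n -> x != y ->
     wp (Seqs [:: ISt 0 (Mul (Cst 2) (Var j_)) (Var n_); ISt 0 (Add (Mul (Cst 2) (Var j_)) (Cst 1)) (Var n_)])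
      (fun s' => tm s' <= tm s + (4 * E + 12) /\
    ([/\ deg M E y = 0, ia s' 0 = M & [/\ v s' 13 = n, v s' 15 = zbase n r m & v s' 16 = 1]] \/
     exists j, [/\ j < E, v s' 15 = base n r j, ia s' 0 = kill n M j &
        [/\ side r M j y (v s' 13) (v s' 16), v s' 13 < n & v s' 13 != y]])) s3.
    move=> a1 a2 a3 a4 a5 a6 t3 sd xn xy.
    apply: wp_seq; apply: wp_st; rewrite //= ?a1 ?a2; try by lia.
    apply: wp_st; rewrite //= ?a1 ?a2; try by lia.
    split; first by rewrite /=; lia.
    right; exists j; split; rewrite //= ?a3 ?a4 ?a6 //.
  apply: wp_seq; apply: wp_if => //=; rewrite /upd /= ?vj ?vM1 ?vy1 ?eqeE; first by lia.
  + case: eqP => // e1 _.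
    apply: wp_seq; apply: wp_set; rewrite //= /upd /= ?vj ?vM1; try by lia.
    apply: wp_set; rewrite //= /upd /= (rg_r rg1); first by lia.
    apply: (kl _ (M (2 * j + 1)) r); rewrite //= /upd //= ?(rg_n rg1) //; try by lia.
    by left.
  + case: eqP => // e1 _.
    have e2 : M (2 * j + 1) = y by move: ij; rewrite /inc => /orP[/eqP//|/eqP].
    apply: wp_seq; apply: wp_set; rewrite //= /upd /= ?vj ?vM1; try by lia.
    apply: wp_set; rewrite //=; first by lia.
    apply: (kl _ (M (2 * j)) 1); rewrite //= /upd //= ?(rg_n rg1) //; try by lia.
    by right.
Qed.

Lemma wp_target x z : gwf n M E -> v s 13 = x -> v s 14 = z -> x < n -> z < n -> x != z ->
  E < 2 * m ->
  wp Ctarget (fun s' => tm s' <= tm s + (8 * E + 10) /\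
    ((exists2 e, e < E & [/\ ia s' 0 = M, v s' 5 = E, v s' 20 = base n r e & side r M e x z (v s' 21)]) \/
     [/\ forall e, e < E -> ~~ joins M e x z, ia s' 0 = addedge M E x z, v s' 5 = E.+1,
        v s' 20 = base n r E & v s' 21 = r])) s.
Proof.
move=> gM vx vz xn zn xz Elt; have m0 : 0 < m by [lia]; have hm := mS; have hn := nS n_gt0 r_gt1 S_def; have hr := rS n_gt0 r_gt1 S_def.
pose Inv k (s1 : st) := (v s1 20 = 0 /\ forall e, e < k -> ~~ joins M e x z) \/
  exists2 e, e < E & v s1 20 = base n r e /\ side r M e x z (v s1 21).
have bpos e : 0 < base n r e by rewrite /base.
apply: wp_seq; apply: wp_set => //; set s0 := setv _ _ _.
have b0 : bnd s0 by case: bs => h1 h2; split=> // j; rewrite /= updE; case: ifP => //; lia.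
have rg0 : regs s0 by case: rg => *; split.
apply: wp_seq; apply: (@wp_for_tick _ _ _ _ _ _ _ 0 E 6 Inv).
- by [].
- by [].
- by [].
- by lia.
- by lia.
- by [].
- by move=> s1 k _ f _ _; rewrite /= (fr_v f).
- by left.
- move=> s1 e /andP[_ eE] f ve inv.
  have rg1 := regs_fr f rg0 isT.
  have vM1 : ia s1 0 = M by rewrite (fr_i f).
  have vx1 : v s1 13 = x by rewrite (fr_v f).
  have vz1 : v s1 14 = z by rewrite (fr_v f).
  have be : base n r e <= S by apply: base_S; lia.
  have mul1 (a b : bool) : (0 < a * b) = a && b by case: a; case: b.
  have second s2 (P : bool) : ia s2 0 = M -> v s2 13 = x -> v s2 14 = z -> v s2 12 = e ->
    v s2 30 = 1 + n * r -> v s2 31 = r * r -> tm s2 <= tm s1 + 3 ->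
    (if P then v s2 20 = base n r e /\ side r M e x z (v s2 21) else v s2 20 = v s1 20 /\ v s2 21 = v s1 21) ->
    P = (M (2 * e) == x) && (M (2 * e + 1) == z) ->
    wp (If (Cst 1) (Mul (eqe (eu (Var e_)) (Var z_)) (eqe (ev (Var e_)) (Var x_)))
      (Seq (ISet gb_ (basee (Var e_))) (ISet ga_ (Cst 1))) Skip)
     (fun s3 => tm s3 <= tm s1 + 6 /\ Inv e.+1 (tick (setv s3 12 e.+1))) s2.
    move=> a1 a2 a3 a4 a5 a6 t2 hP eP.
    apply: wp_if => //=; rewrite ?a1 ?a2 ?a3 ?a4 ?eqeE; first by lia.
      rewrite mul1 => /andP[/eqP e1 /eqP e2].
      apply: wp_seq; apply: wp_set; rewrite //= a4 a5 a6 -/(base n r e) //.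
      apply: wp_set; rewrite //=; first by lia.
      split; first by rewrite /=; lia.
      right; exists e => //=; rewrite /upd /=; split=> //; by right.
    rewrite ltnS leqn0 => h0; apply: wp_skip; split; first by rewrite /=; lia.
    rewrite /Inv /= /upd /=; case: P hP eP => [hP _|[-> ->] eP]; first by right; exists e.
    case: inv => [[i1 i2]|inv]; [left|by right]; split=> // e'.
    rewrite ltnS leq_eqVlt => /orP[/eqP->|/i2//].
    by rewrite /joins -eP /=; move: h0; case: (_ == z); case: (_ == x).
  apply: wp_seq; apply: wp_if => //=; rewrite ?vx1 ?vz1 ?vM1 ?ve ?eqeE; first by lia.
    rewrite mul1 => h; have [/eqP e1 /eqP e2] := andP h.
    apply: wp_seq; apply: wp_set; rewrite //= ve (rg_B rg1) (rg_rr rg1 m0) -/(base n r e) //.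
    apply: wp_set; rewrite //= /upd /= (rg_r rg1); first by lia.
    apply: (second _ true); rewrite //= /upd //= ?(rg_B rg1) ?(rg_rr rg1 m0) //; first by lia.
    by split=> //; left.
  rewrite ltnS leqn0 => h; apply: wp_skip; apply: (second _ false); rewrite //= ?(rg_B rg1) ?(rg_rr rg1 m0) //; first by lia.
  by move: h; case: (_ == x); case: (_ == z).
move=> s1 f1 _ inv t1; rewrite /s0 /= in t1.
have rg1 := regs_fr f1 rg0 isT.
have vM1 : ia s1 0 = M by rewrite (fr_i f1).
have vE1 : v s1 5 = E by rewrite (fr_v f1).
have vx1 : v s1 13 = x by rewrite (fr_v f1).
have vz1 : v s1 14 = z by rewrite (fr_v f1).
apply: wp_if => //=; rewrite ?leqn0.
- move=> /eqP g0; case: inv => [[_ no]|[e _ [ge _]]]; last by have := bpos e; lia.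
  apply: wp_seq; apply: wp_st; rewrite //= ?vE1 ?vx1; try by lia.
  apply: wp_seq; apply: wp_st; rewrite //= ?vE1 ?vz1; try by lia.
  apply: wp_seq; apply: wp_set; rewrite //= ?vE1 (rg_B rg1) (rg_rr rg1 m0) -/(base n r E).
    by apply: base_S; lia.
  apply: wp_seq; apply: wp_set; rewrite //= /upd /= (rg_r rg1); first by lia.
  apply: wp_set; rewrite //= /upd /= vE1; first by lia.
  split; first by rewrite /=; lia.
  by right; split; rewrite //= /upd /= ?vM1 // addn1.
- move=> g0; case: inv => [[ge _]|[e eE [ge sd]]]; first by rewrite ge in g0.
  apply: wp_skip; split; first by rewrite /=; lia.
  by left; exists e.
Qed.

End Scans.

End Plan.

(** * Loss of weight at a branching *)

Section Measure.
Local Open Scope nat_scope.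

(** The differences of [wt] at 3, at 4 and at larger degrees are 5, 3 and 2. They do not increase,
    so that at d is the least loss of a vertex of degree between 3 and d when one of its edges is
    deleted. *)
Definition drop_ d := if d == 3 then 5 else if d == 4 then 3 else 2.

Lemma wt_drop a d : 3 <= a <= d -> wt a.-1 + drop_ d <= wt a.
Proof. by rewrite /wt /drop_; repeat case: ifP; lia. Qed.

(** Equality holds at 3, 4 and 5: 5 + 3 * 5, 8 + 4 * 3 and 10 + 5 * 2. From 5 on the sum is 4d. *)
Lemma wt_total d : 3 <= d -> 20 <= wt d + d * drop_ d.
Proof. by rewrite /wt /drop_; repeat case: ifP; lia. Qed.

Lemma side_deg r M j y x ec (u : nat) : side r M j y x ec ->
  (M (2 * j) == u) + (M (2 * j + 1) == u) = (y == u) + (x == u).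
Proof. by case=> -[-> -> _] //; rewrite addnC. Qed.

Lemma side_joins r M j y x ec : side r M j y x ec -> joins M j y x.
Proof. by rewrite /joins; case=> -[-> -> _]; rewrite !eqxx ?orbT. Qed.

Lemma side_live n r M j y x ec : side r M j y x ec -> y < n -> x < n -> M (2 * j) < n.
Proof. by case=> -[-> _ _]. Qed.

Lemma deg_ex M E u : 0 < deg M E u -> exists2 e, e < E & M (2 * e) = u \/ M (2 * e + 1) = u.
Proof.
elim: E => [|E IH]; first by rewrite /deg big_geq.
rewrite /deg big_nat_recr //= -/(deg M E u).
case: (M (2 * E) =P u) => [h|_]; first by exists E; [|left].
case: (M (2 * E + 1) =P u) => [h|_]; first by exists E; [|right].
rewrite addn0 => /IH[e eE h]; exists e => //; lia.
Qed.

(** The weight of y is set apart because it falls irregularly while the edges at y are deleted one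
    by one; it is accounted for as a whole at the end. *)
Definition potx n M E y := \sum_(0 <= u < n) (if u == y then 0 else wt (deg M E u)).

Lemma pot_potx n M E y : y < n -> pot n M E = potx n M E y + wt (deg M E y).
Proof.
move=> yn; apply: (sum_change yn); first by rewrite eqxx.
by move=> u _ /negPf ->.
Qed.

Lemma potx_kill r n M E j y x ec d : j < E -> y < n -> x < n -> x != y ->
  side r M j y x ec -> 3 <= deg M E x <= d -> potx n (kill n M j) E y + drop_ d <= potx n M E y.
Proof.
move=> jE yn xn xy sd dx.
have dk u : u < n -> deg M E u = deg (kill n M j) E u + ((y == u) + (x == u)).
  by move=> un; rewrite (deg_kill M jE un) (side_deg _ sd).
have ex := dk x xn; rewrite eqxx [y == x]eq_sym (negPf xy) in ex.
rewrite /potx (@sum_change (fun u => if u == y then 0 else wt (deg M E u)) (fun u => if u == y then 0 else wt (deg (kill n M j) E u)) n x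
  (wt (deg M E x) - wt (deg (kill n M j) E x)) xn).
- have := wt_drop dx; rewrite (_ : (deg M E x).-1 = deg (kill n M j) E x); last by lia.
  rewrite leq_add2l; lia.
- rewrite (negPf xy); have : wt (deg (kill n M j) E x) <= wt (deg M E x) by apply: wt_mono; lia.
  by lia.
- move=> u un ux; case: eqP => // uy; rewrite (dk u un).
  rewrite [x == u]eq_sym (negPf ux).
  have -> : (y == u) = false by apply/eqP => e; case: uy.
  by rewrite addn0.
Qed.

Lemma count_iota (P : pred nat) n : count P (iota 0 n) = \sum_(0 <= u < n) P u.
Proof. by rewrite -sum1_count big_mkcond /index_iota subn0. Qed.

End Measure.

(** * Rounds of the planning phase and their invariant *)

Section Plan.
Variables (R : realType) (S n r m : nat).
Hypothesis n_gt0 : (0 < n)%N.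
Hypothesis r_gt1 : (1 < r)%N.
Hypothesis S_def : S = (8 * base n r m)%N.
Variable Q0 : seq factor.
Local Open Scope nat_scope.
Local Notation st := (st R).
Local Notation regs := (@regs R n r m).
Local Notation wp := (@wp R S).
Local Notation fr := (fr S).
Local Notation bnd := (bnd S).

Let r_gt0 : 0 < r. Proof. exact: ltnW. Qed.

Definition branching (hi : nat -> nat) : pred nat := fun u => hi u <= 1.

(** The vertex y is the one being branched on, which may have [hi] = 1 while it still has edges; y =
    n grants no exception. [gk_E] keeps the number of edge tables within 2m, since a new edge
    replaces two live ones. [gk_k] bounds the operations recorded so far, each of which deletes a
    live edge. *)
Record graph_ok y (s : st) : Prop := GraphOk {
  gk_wf : gwf n (ia s 0) (v s 5);
  gk_s : simple n (ia s 0) (v s 5);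
  gk_E : v s 5 + nlive n (ia s 0) (v s 5) <= 2 * m;
  gk_k : v s 6 + nlive n (ia s 0) (v s 5) <= m;
  gk_el : forall e u, e < v s 5 -> u < n ->
    ia s 0 (2 * e) = u \/ ia s 0 (2 * e + 1) = u -> ia s 3 u = 0 /\ (ia s 2 u = r \/ u = y);
  gk_hi : forall u, u < n -> ia s 2 u = 1 \/ ia s 2 u = r;
  gk_hin : ia s 2 n = 1;
  gk_ch : chain n r m Q0 (branching (ia s 2)) (mkseq (opat s) (v s 6))
    (Qof n (ia s 3) (ia s 0) (v s 5)) (v s 5) }.

Lemma wp_elim (s : st) y : regs s -> bnd s -> graph_ok n s -> v s 9 = y -> y < n ->
  1 <= deg (ia s 0) (v s 5) y <= 2 ->
  wp Celim (fun s' => [/\ tm s' <= tm s + (16 * (2 * m) + 60), graph_ok n s',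
    nlive n (ia s' 0) (v s' 5) < nlive n (ia s 0) (v s 5) &
    pot n (ia s' 0) (v s' 5) <= pot n (ia s 0) (v s 5)]) s.
Proof.
move=> rg bs [gM sM gE gk gel ghi ghin gch] vy yn dy.
have hm := mS n_gt0 r_gt1 S_def; have hn := nS n_gt0 r_gt1 S_def; have hr := rS n_gt0 r_gt1 S_def.
have [M eM] : exists M, M = ia s 0 by eexists.
have [E eE] : exists E, E = v s 5 by eexists.
have [k ek] : exists k, k = v s 6 by eexists.
have [el eel] : exists el, el = ia s 3 by eexists.
have [hi ehi] : exists hi, hi = ia s 2 by eexists.
rewrite -?eM -?eE -?ek -?eel -?ehi in gM sM gE gk gel ghi ghin gch dy *.
have E2 : E <= 2 * m by lia.
have ely : el y = 0.
  by have [|e eE' h] := @deg_ex M E y; [lia|case: (gel e y eE' yn h)].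
have uS u : u < n -> ubase r u <= S.
  by move=> un; have := ubase_S n_gt0 r_gt1 S_def un; lia.
apply: wp_seq; apply: wp_st; rewrite //= ?vy; try by lia.
apply: wp_seq; apply: wp_set; rewrite //= ?vy ?(rg_r rg) -/(ubase r y); first exact: uS.
set s1 := setv _ _ _.
have f1 : fr (Seq (ISt 3 (Cst 0) (Cst 0)) (ISet 19 (Cst 0))) s s1.
  split=> [j|//|a|//|[h1 h2]].
  - by rewrite !inE /= /upd => /negPf ->.
  - by rewrite !inE /= /upd => /negPf ->.
  split=> [j|a i iS]; rewrite /= /upd.
    by case: ifP => // _; apply: uS.
  by case: ifP => // _; [case: ifP => // _; [lia|apply: h2]|apply: h2].
have rg1 := regs_fr f1 rg isT; have bs1 := fr_b f1 bs.
have el1 : ia s1 3 = upd el y 1 by rewrite eel.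
have op1 : opat s1 =1 opat s by apply: (opat_fr f1 isT).
have M1 : ia s1 0 = M by rewrite (fr_i f1).
have vE1 : v s1 5 = E by rewrite (fr_v f1).
have vy1 : v s1 9 = y by rewrite (fr_v f1).
apply: wp_seq; apply: (wp_use (wp_take n_gt0 r_gt1 S_def rg1 bs1 M1 vE1 E2 gM vy1 yn)).
move=> s2 f2 [t2 [[d0 _ _]|[i [iE fb2 M2 [sd1 zn zy]]]]]; first by rewrite d0 in dy.
have [z vz2] : exists z, z = v s2 13 by eexists.
have [fc vfc2] : exists fc, fc = v s2 16 by eexists.
rewrite -vz2 -vfc2 in sd1 zn zy.
have li := side_live sd1 yn zn.
have rg2 := regs_fr f2 rg1 isT; have bs2 := fr_b f2 bs1.
have op2 : opat s2 =1 opat s by move=> q; rewrite (opat_fr f2 isT) op1.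
have gM1 : gwf n (kill n M i) E by apply: gwf_kill.
have dk1 u : u < n -> deg M E u = deg (kill n M i) E u + ((y == u) + (z == u)).
  by move=> un; rewrite (deg_kill M iE un) (side_deg _ sd1).
have dy1 : deg (kill n M i) E y <= 1.
  by have := dk1 y yn; rewrite eqxx (negPf zy); lia.
have bi : base n r i <= S by apply: (base_S n_gt0 r_gt1 S_def); lia.
have fcS : fc <= S by case: sd1 => -[_ _ ->]; lia.
apply: wp_seq; apply: wp_set; rewrite //= -?vz2; first by lia.
apply: wp_seq; apply: wp_set; rewrite //= /upd /= ?fb2 //.
apply: wp_seq; apply: wp_set; rewrite //= /upd /= -?vfc2 //.
set s3 := setv _ 18 _.
have f3 : fr (Seq (ISet 14 (Cst 0)) (Seq (ISet 17 (Cst 0)) (ISet 18 (Cst 0)))) s2 s3.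
  split=> [j|//|//|//|[h1 h2]].
    by rewrite !inE /= /upd => /norP[/negPf -> /norP[/negPf -> /negPf ->]].
  by split=> // j; rewrite /= /upd; do 3 (case: ifP => _; [lia|]); apply: h1.
have rg3 := regs_fr f3 rg2 isT; have bs3 := fr_b f3 bs2.
have op3 : opat s3 =1 opat s by move=> q; rewrite (opat_fr f3 isT) op2.
have M3 : ia s3 0 = kill n M i by rewrite (fr_i f3).
have vE3 : v s3 5 = E by rewrite (fr_v f3) // (fr_v f2).
have vy3 : v s3 9 = y by rewrite (fr_v f3) // (fr_v f2).
have v3 : [/\ v s3 14 = z, v s3 17 = base n r i & v s3 18 = fc] by [].
have t3 : tm s3 <= tm s + (4 * E + 17) by move: t2; rewrite /s3 /s1 /=; lia.
apply: wp_seq; apply: (wp_use (wp_take n_gt0 r_gt1 S_def rg3 bs3 M3 vE3 E2 gM1 vy3 yn)).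
move=> s4 f4 [t4 cs4].
have rg4 := regs_fr f4 rg3 isT; have bs4 := fr_b f4 bs3.
have op4 : opat s4 =1 opat s by move=> q; rewrite (opat_fr f4 isT) op3.
have el4 : ia s4 3 = upd el y 1 by rewrite (fr_i f4) // (fr_i f3) // (fr_i f2).
have hi4 : ia s4 2 = hi by rewrite (fr_i f4) // (fr_i f3) // (fr_i f2) // (fr_i f1).
have vE4 : v s4 5 = E by rewrite (fr_v f4).
have k4 : v s4 6 = k by rewrite (fr_v f4) // (fr_v f3) // (fr_v f2) // (fr_v f1).
have ub4 : v s4 19 = ubase r y by rewrite (fr_v f4) // (fr_v f3) // (fr_v f2).
have y4 : v s4 9 = y by rewrite (fr_v f4).
have [z4 fb4 fc4] : [/\ v s4 14 = z, v s4 17 = base n r i & v s4 18 = fc].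
  by case: v3 => h1 h2 h3; rewrite !(fr_v f4).
have elz : el z = 0.
  by case: (gel i z iE zn) => //; case: sd1 => -[-> -> _]; [right|left].
have kS : k < S by lia.
(* Common end of the three cases: degree 1, an existing edge xz, a new edge xz. *)
have emit s5 M' E' : bnd s5 -> opat s5 =1 opat s -> ia s5 3 = upd el y 1 -> ia s5 2 = hi ->
    ia s5 0 = M' -> v s5 5 = E' -> v s5 6 = k -> tm s5 <= tm s + (16 * E + 45) ->
    gwf n M' E' -> simple n M' E' -> E' + nlive n M' E' <= 2 * m ->
    nlive n M' E' < nlive n M E ->
    (forall u, u < n -> deg M' E' u <= deg M E u) ->
    (forall e u, e < E' -> u < n -> M' (2 * e) = u \/ M' (2 * e + 1) = u ->
       u <> y /\ exists2 e', e' < E & M (2 * e') = u \/ M (2 * e' + 1) = u) ->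
    elim_step n r m (branching hi) (oregs s5) (Qof n el M E) E (Qof n (upd el y 1) M' E') E' ->
    wp Cemit (fun s' => [/\ tm s' <= tm s + (16 * (2 * m) + 60), graph_ok n s',
      nlive n (ia s' 0) (v s' 5) < nlive n M E & pot n (ia s' 0) (v s' 5) <= pot n M E]) s5.
  move=> bs5 op5 el5 hi5 M5 vE5 k5 t5 gM' sM' gE' lt' dle end' stp.
  apply: (wp_use (wp_emit bs5 k5 kS)) => s6 f6 [t6 k6 ops6].
  have M6 : ia s6 0 = M' by rewrite (fr_i f6).
  have E6 : v s6 5 = E' by rewrite (fr_v f6).
  have el6 : ia s6 3 = upd el y 1 by rewrite (fr_i f6).
  have hi6 : ia s6 2 = hi by rewrite (fr_i f6).
  rewrite M6 E6; split=> //; [by lia| |exact: pot_mono].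
  split; rewrite ?M6 ?E6 ?el6 ?hi6 ?k6 //; first by lia.
  - move=> e u eE' un h; have [uy [e' e'E h']] := end' e u eE' un h.
    by rewrite updE; case: eqP => // _; apply: gel e'E un h'.
  - by rewrite ops6 (eq_mkseq op5); apply: ChainS gch stp.
have kend N e j u : u < n -> kill n N j (2 * e) = u \/ kill n N j (2 * e + 1) = u ->
   N (2 * e) = u \/ N (2 * e + 1) = u.
  by move=> un; rewrite kill0 kill1; case: eqP => // _; case; lia.
case: cs4 => [[d0 M4 [x4 eb4 ec4]]|[j [jE eb4 M4 [sd2 xn xy]]]].
- apply: wp_seq; apply: wp_if; rewrite //= (rg_n rg4) x4 ?ltnn // => _.
  apply: wp_seq; apply: wp_set; rewrite //= z4 (rg_r rg4) -/(ubase r z); first exact: uS.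
  apply: wp_set; rewrite //= /upd /= (rg_r rg4); first by lia.
  set s5 := setv _ 21 _.
  have f5 : fr (Seq (ISet 20 (Cst 0)) (ISet 21 (Cst 0))) s4 s5.
    split=> [q|//|//|//|[h1 h2]].
      by rewrite !inE /= /upd => /norP[/negPf -> /negPf ->].
    split=> // q; rewrite /= /upd; do 1 (case: ifP => _; [lia|]); case: ifP => _; last exact: h1.
    exact: uS.
  have bs5 := fr_b f5 bs4.
  apply: (emit _ (kill n M i) E bs5); rewrite //=.
  + by rewrite /s5 /=; lia.
  + exact: simple_kill.
  + by have := nlive_kill iE li; lia.
  + by have := nlive_kill iE li; lia.
  + by move=> u un; rewrite (dk1 u un); lia.
  + move=> e u eE' un h; split; last by exists e; last exact: kend h.
    by have [h1 h2] := deg0P d0 eE'; move=> uy; rewrite uy in h; case: h.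
  + rewrite /oregs /= /upd /= y4 x4 z4 ub4 eb4 ec4 fb4 fc4.
    by apply: step_elim1.
- have [x x4] : exists x, x = v s4 13 by eexists.
  have [ec ec4] : exists ec, ec = v s4 16 by eexists.
  rewrite -x4 -ec4 in sd2 xn xy.
  set M2' := kill n (kill n M i) j in M4 *.
  have lj := side_live sd2 yn xn.
  have ij : j <> i by move=> e; move: lj; rewrite e kill0 eqxx ltnn.
  have dk2 u : u < n -> deg (kill n M i) E u = deg M2' E u + ((y == u) + (x == u)).
    by move=> un; rewrite (deg_kill _ jE un) (side_deg _ sd2).
  have d0 : deg M2' E y = 0.
    by have := dk2 y yn; rewrite eqxx (negPf xy); lia.
  (* Otherwise i and j would be parallel edges between y and z. *)
  have xz : x != z.
    apply/eqP => xz; apply: ij; apply: (sM j i y x) => //; last by rewrite xz; apply: side_joins sd1.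
    have := side_joins sd2; rewrite joins_kill // => /andP[] //.
  have nl1 := nlive_kill iE li; have nl2 := nlive_kill jE lj.
  have gM2 : gwf n M2' E by apply: gwf_kill.
  have sM2 : simple n M2' E by do 2 apply: simple_kill.
  have endx : exists2 e', e' < E & M (2 * e') = x \/ M (2 * e' + 1) = x.
    exists j => //; apply: (kend _ _ i) => //.
    by case: sd2 => -[-> -> _]; [right|left].
  have endz : exists2 e', e' < E & M (2 * e') = z \/ M (2 * e' + 1) = z.
    by exists i => //; case: sd1 => -[-> -> _]; [right|left].
  have endM e u : e < E -> u < n -> M2' (2 * e) = u \/ M2' (2 * e + 1) = u ->
      u <> y /\ exists2 e', e' < E & M (2 * e') = u \/ M (2 * e' + 1) = u.
    move=> eE' un h; split.
      by have [h1 h2] := deg0P d0 eE'; move=> uy; rewrite uy in h; case: h.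
    by exists e => //; apply: (kend _ _ i) => //; apply: kend h.
  apply: wp_seq; apply: wp_if; rewrite //= (rg_n rg4) -x4; first by lia.
  move=> _.
  have rg5 : regs (tick s4) by case: rg4.
  have bs5 : bnd (tick s4) by case: bs4.
  apply: (wp_use (wp_target n_gt0 r_gt1 S_def rg5 bs5 M4 vE4 E2 gM2 (esym x4) z4 xn zn xz _)); first by lia.
  move=> s6 f6 [t6 cs6].
  have bs6 := fr_b f6 bs5.
  have op6 : opat s6 =1 opat s by move=> q; rewrite -op4 (opat_fr f6 isT).
  have el6 : ia s6 3 = upd el y 1 by rewrite (fr_i f6).
  have hi6 : ia s6 2 = hi by rewrite (fr_i f6).
  have k6 : v s6 6 = k by rewrite (fr_v f6).
  have o6 : oregs s6 = Op y x z (ubase r y) (base n r j) ec (base n r i) fc (v s6 20) (v s6 21).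
    have h q : q \notin mv Ctarget -> v s6 q = v s4 q by move=> hq; apply: (fr_v f6).
    by rewrite /oregs (h 9) // (h 13) // (h 14) // (h 19) // (h 15) // (h 16) // (h 17) // (h 18) //
      y4 -x4 z4 ub4 eb4 -ec4 fb4 fc4.
  case: cs6 => [[e eE' [M6 E6 gb6 sd6]]|[nj M6 E6 gb6 ga6]].
  + apply: (emit _ M2' E bs6); rewrite //=.
    * by move: t6 => /=; lia.
    * by rewrite -/M2' in nl2; lia.
    * by rewrite -/M2' in nl2; lia.
    * by move=> u un; rewrite (dk1 u un) (dk2 u un); lia.
    * rewrite o6; apply: (@step_elim2 _ _ _ r_gt1 _ _ _ gM E2) => //.
      by left; exists e.
  + apply: (emit _ (addedge M2' E x z) E.+1 bs6); rewrite //=.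
    * by move: t6 => /=; lia.
    * exact: gwf_add.
    * exact: simple_add.
    * by rewrite nlive_add // -/M2' in nl2 *; lia.
    * by rewrite nlive_add // -/M2' in nl2 *; lia.
    * by move=> u un; rewrite deg_add (dk1 u un) (dk2 u un); lia.
    * move=> e u eE' un; rewrite add0 add1; case: eqP => [_|ne]; last by apply: endM => //; lia.
      by case=> <-; split=> //; apply/eqP.
    * rewrite o6; apply: (@step_elim2 _ _ _ r_gt1 _ _ _ gM E2) => //.
      by right; split=> //; rewrite -/M2' in nl2; lia.
Qed.

Definition nbranch (hi : nat -> nat) := count (branching hi) (iota 0 n).

(** Each of the d neighbours loses at least [drop_ d] and y loses [wt d]; by [wt_total] this pays
    the 20 charged for the new member of B. *)
Lemma wp_branch (s : st) y d : regs s -> bnd s -> graph_ok n s -> v s 9 = y -> y < n ->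
  v s 8 = d -> deg (ia s 0) (v s 5) y = d -> 3 <= d ->
  (forall u, u < n -> deg (ia s 0) (v s 5) u = 0 \/ 3 <= deg (ia s 0) (v s 5) u <= d) ->
  wp Cbranch (fun s' => [/\ tm s' <= tm s + (2 * m * (4 * (2 * m) + 26) + 10), graph_ok n s',
    nlive n (ia s' 0) (v s' 5) < nlive n (ia s 0) (v s 5) &
    pot n (ia s' 0) (v s' 5) + 20 * nbranch (ia s' 2) <=
    pot n (ia s 0) (v s 5) + 20 * nbranch (ia s 2)]) s.
Proof.
move=> rg bs [gM sM gE gk gel ghi ghin gch] vy yn vd dy d3 dmax.
have hm := mS n_gt0 r_gt1 S_def; have hn := nS n_gt0 r_gt1 S_def; have hr := rS n_gt0 r_gt1 S_def.
have [M eM] : exists M, M = ia s 0 by eexists.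
have [E eE] : exists E, E = v s 5 by eexists.
have [hi ehi] : exists hi, hi = ia s 2 by eexists.
rewrite -?eM -?eE -?ehi in gM sM gE gk gel ghi ghin gch dy dmax *.
have E2 : E <= 2 * m by lia.
have hiy : hi y = r.
  have [|e eE' h] := @deg_ex M E y; first by lia.
  by case: (gel e y eE' yn h) => _ [//|yn']; lia.
have d2 : d <= 2 * m by have := deg_le_live gM yn; lia.
have zS : zbase n r m <= S by apply: (base_S n_gt0 r_gt1 S_def).
apply: wp_seq; apply: wp_st; rewrite //= ?vy; try by lia.
apply: wp_seq; apply: wp_set; rewrite //= ?(rg_z rg) //.
apply: wp_seq; apply: wp_set; rewrite //= /upd /= ?(rg_n rg); first by lia.
apply: wp_seq; apply: wp_set; rewrite //= /upd /= ?(rg_z rg) //.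
apply: wp_seq; apply: wp_set; rewrite //=; first by lia.
apply: wp_seq; apply: wp_set; rewrite //=; first by lia.
set s1 := setv _ 21 _.
have f1 : fr (Seqs [:: ISt 2 (Cst 0) (Cst 0); ISet 19 (Cst 0); ISet 14 (Cst 0); ISet 17 (Cst 0);
    ISet 18 (Cst 0); ISet 21 (Cst 0)]) s s1.
  split=> [j|//|a|//|[h1 h2]].
  - rewrite /= !inE !negb_or => /and5P[/negPf e1 /negPf e2 /negPf e3 /negPf e4 /negPf e5].
    by rewrite /= /upd e1 e2 e3 e4 e5.
  - by rewrite !inE /= /upd => /negPf ->.
  split=> [j|a i iS]; rewrite /= /upd.
    by do 5 (case: ifP => _; [lia|]); apply: h1.
  by case: ifP => // _; [case: ifP => // _; [lia|apply: h2]|apply: h2].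
have rg1 := regs_fr f1 rg isT; have bs1 := fr_b f1 bs.
have op1 : opat s1 =1 opat s by apply: (opat_fr f1 isT).
have M1 : ia s1 0 = M by rewrite (fr_i f1).
have vE1 : v s1 5 = E by rewrite (fr_v f1).
have hi1 : ia s1 2 = upd hi y 1 by rewrite ehi.
have k1 : v s1 6 = v s 6 by rewrite (fr_v f1).
have r1 : [/\ v s1 19 = zbase n r m, v s1 14 = n, v s1 17 = zbase n r m, v s1 18 = 1 & v s1 21 = 1] by [].
have g1 : graph_ok y s1.
  split; rewrite ?M1 ?vE1 ?hi1 ?k1 //.
  - move=> e u eE' un h; case: (gel e u eE' un h) => h1 h2.
    rewrite (fr_i f1) // h1 updE; case: eqP => [->|_]; first by split=> //; right.
    by split=> //; case: h2 => [|u_n]; [left|lia].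
  - by move=> u un; rewrite updE; case: eqP => [_|_]; [left|apply: ghi].
  - by rewrite updE; case: eqP => // ->.
  - rewrite (eq_mkseq op1) (fr_i f1) //; apply: chain_sub gch => u.
    by rewrite !unfold_in /branching updE; case: eqP.
pose Inv i (s2 : st) := [/\ graph_ok y s2, deg (ia s2 0) E y + i = d,
  potx n (ia s2 0) E y + i * drop_ d <= potx n M E y,
  nlive n (ia s2 0) E + i <= nlive n M E &
  forall u, u < n -> u != y -> (exists2 e, e < E & joins (ia s2 0) e y u) ->
    3 <= deg (ia s2 0) E u <= d].
apply: (@wp_for_tick _ _ _ _ _ _ _ 0 d (4 * E + 24) Inv).
- by move=> i s2 [[]].
- by [].
- by [].
- by [].
- by lia.
- by [].
- by move=> s2 i _ f _ _; rewrite /= (fr_v f) // (fr_v f1).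
- split.
  + by case: g1.
  + by rewrite -[ia _ 0]/(ia s1 0) M1 dy addn0.
  + by rewrite -[ia _ 0]/(ia s1 0) M1 mul0n addn0.
  + by rewrite -[ia _ 0]/(ia s1 0) M1 addn0.
  + move=> u un uy [e eE']; rewrite -[ia _ 0]/(ia s1 0) M1 => h; case: (dmax u un) => // d0.
    have [h1 h2] := deg0P d0 eE'.
    by move: h; rewrite /joins; case/orP => /andP[/eqP a /eqP b]; [case: h2|case: h1].
- move=> s2 i /andP[_ id] f vi [g2 dy2 p2 l2 m2].
  have rg2 := regs_fr f rg1 isT; have bs2 := fr_b f bs1.
  have vE2 : v s2 5 = E by rewrite (fr_v f).
  have vy2 : v s2 9 = y by rewrite (fr_v f).
  have hi2 : ia s2 2 = upd hi y 1 by rewrite (fr_i f).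
  case: (g2) => gM2 sM2 gE2 gk2 gel2 ghi2 ghin2 gch2.
  have [N eN] : exists N, N = ia s2 0 by eexists.
  have [k ek] : exists k, k = v s2 6 by eexists.
  have [el eel] : exists el, el = ia s2 3 by eexists.
  rewrite -?eN ?vE2 -?ek -?eel in gM2 sM2 gE2 gk2 gel2 gch2 dy2 p2 l2 m2 *.
  apply: wp_seq; apply: (wp_use (wp_take n_gt0 r_gt1 S_def rg2 bs2 (esym eN) vE2 E2 gM2 vy2 yn)).
  move=> s3 f3 [t3 [[d0 _ _]|[j [jE eb3 M3 [sd xn xy]]]]]; first by lia.
  have [x ex] : exists x, x = v s3 13 by eexists.
  have [ec eec] : exists ec, ec = v s3 16 by eexists.
  rewrite -ex -eec in sd xn xy.
  have lj := side_live sd yn xn.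
  have rg3 := regs_fr f3 rg2 isT; have bs3 := fr_b f3 bs2.
  have op3 : opat s3 =1 opat s2 by apply: (opat_fr f3 isT).
  have nl := nlive_kill jE lj.
  apply: wp_seq; apply: wp_set; rewrite //= -ex (rg_r rg3) -/(ubase r x).
    by have := ubase_S n_gt0 r_gt1 S_def xn; lia.
  set s4 := setv _ 20 _.
  have f4 : fr (ISet 20 (Cst 0)) s3 s4.
    split=> [q|//|//|//|[h1 h2]]; first by rewrite !inE /= /upd => /negPf ->.
    split=> // q; rewrite /= /upd; case: ifP => _; last exact: h1.
    by have := ubase_S n_gt0 r_gt1 S_def xn; lia.
  have k4 : v s4 6 = k by rewrite (fr_v f4) // (fr_v f3).
  apply: (wp_use (wp_emit (fr_b f4 bs3) k4 _)); first by lia.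
  move=> s5 f5 [t5 k5 ops5].
  have M5 : ia s5 0 = kill n N j by rewrite (fr_i f5) // (fr_i f4).
  have E5 : v s5 5 = E by rewrite (fr_v f5) // (fr_v f4) // (fr_v f3).
  have el5 : ia s5 3 = el by rewrite (fr_i f5) // (fr_i f4) // (fr_i f3).
  have hi5 : ia s5 2 = upd hi y 1 by rewrite (fr_i f5) // (fr_i f4) // (fr_i f3).
  have kend e u : u < n -> kill n N j (2 * e) = u \/ kill n N j (2 * e + 1) = u ->
     N (2 * e) = u \/ N (2 * e + 1) = u.
    by move=> un; rewrite kill0 kill1; case: eqP => // _; case; lia.
  have dk u : u < n -> deg N E u = deg (kill n N j) E u + ((y == u) + (x == u)).
    by move=> un; rewrite (deg_kill _ jE un) (side_deg _ sd).
  split; first by move: t3 t5; rewrite /s4 /=; lia.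
  rewrite /Inv /= M5; split.
  + split; rewrite /= /upd /= ?M5 ?E5 ?el5 ?hi5 ?k5 //.
    * exact: gwf_kill.
    * exact: simple_kill.
    * by lia.
    * by lia.
    * by move=> e u eE' un h; rewrite -hi2; apply: gel2 eE' un (kend e u un h).
    * by rewrite -hi2.
    * by rewrite -hi2.
    * rewrite -[mkseq _ _]/(mkseq (opat s5) k.+1) ops5 (eq_mkseq (f := opat s4) (g := opat s2)); last first.
        by move=> q; rewrite (opat_fr f4 isT).
      have gch' : chain n r m Q0 (branching (upd hi y 1)) (mkseq (opat s2) k) (Qof n el N E) E by rewrite -hi2.
      apply: ChainS gch' _.
      have -> : oregs s4 = Op y x n (zbase n r m) (base n r j) ec (zbase n r m) 1 (ubase r x) 1.
        case: r1 => a1 a2 a3 a4 a5.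
        rewrite /oregs /= /upd /= -ex -eec eb3 (fr_v f3 (k := 9)) // vy2.
        rewrite (fr_v f3 (k := 14)) // (fr_v f (k := 14)) // a2.
        rewrite (fr_v f3 (k := 19)) // (fr_v f (k := 19)) // a1.
        rewrite (fr_v f3 (k := 17)) // (fr_v f (k := 17)) // a3.
        rewrite (fr_v f3 (k := 18)) // (fr_v f (k := 18)) // a4.
        by rewrite (fr_v f3 (k := 21)) // (fr_v f (k := 21)) // a5.
      apply: step_fold => //.
      -- by rewrite /branching updE eqxx.
      -- case: (gel2 j x jE xn) => //.
         by case: sd => -[-> -> _]; [right|left].
  + by have := dk y yn; rewrite eqxx (negPf xy); lia.
  + have : potx n (kill n N j) E y + drop_ d <= potx n N E y.
      apply: (potx_kill jE yn xn xy sd); apply: m2 => //.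
      by exists j => //; apply: side_joins sd.
    by rewrite mulSn; lia.
  + by lia.
  + move=> u un uy [e eE']; rewrite joins_kill // => /andP[ej je].
    (* The graph being simple, the edge just deleted was the only one joining y and x; so u is
       another vertex and its degree is unchanged. *)
    have ux : u <> x.
      move=> ux; move/eqP: ej; apply; apply: (sM2 e j y u) => //.
      by rewrite ux; apply: side_joins sd.
    have := m2 u un uy (ex_intro2 _ _ e eE' je); rewrite (dk u un).
    have -> : (y == u) = false by rewrite eq_sym (negPf uy).
    have -> : (x == u) = false by apply/eqP => e1; case: ux.
    by rewrite !addn0.
- move=> s2 f vd2 [g2 dy2 p2 l2 _] t2.
  have vE2 : v s2 5 = E by rewrite (fr_v f).
  have hi2 : ia s2 2 = upd hi y 1 by rewrite (fr_i f).
  have d0 : deg (ia s2 0) E y = 0 by lia.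
  rewrite vE2 hi2; split.
  + have : d * (4 * E + 26) <= 2 * m * (4 * (2 * m) + 26) by apply: leq_mul; lia.
    by move: t2; rewrite /s1 /= subn0 -addnA; lia.
  + case: g2 => gM2 sM2 gE2 gk2 gel2 ghi2 ghin2 gch2; split=> // e u eE' un h.
    have [h1 h2] := gel2 e u eE' un h; split=> //; case: h2 => [|uy]; first by left.
    by rewrite vE2 in eE'; have [h3 h4] := deg0P d0 eE'; rewrite uy in h; case: h.
  + by lia.
  + have := pot_potx (ia s2 0) E yn; have := pot_potx M E yn; rewrite d0 dy => -> ->.
    have : nbranch (upd hi y 1) = nbranch hi + 1.
      rewrite /nbranch !count_iota; apply: (sum_change yn).
        by rewrite /branching updE eqxx hiy; lia.
      by move=> u _ /negPf uy; rewrite /branching updE uy.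
    by have := wt_total d3; rewrite {2}/wt /=; lia.
Qed.

(** At most 4m at the start, and never increased by a round; hence 20 |B| <= 4m at the end. *)
Definition budget (s : st) := pot n (ia s 0) (v s 5) + 20 * nbranch (ia s 2).

Definition round_cost := n * (6 * m + 12) + 2 * m * (4 * (2 * m) + 26) + 32 * m + 80.

Lemma graph_ok_eq y s s' : graph_ok y s -> ia s' 0 = ia s 0 -> ia s' 2 = ia s 2 ->
  ia s' 3 = ia s 3 -> v s' 5 = v s 5 -> v s' 6 = v s 6 -> opat s' =1 opat s -> graph_ok y s'.
Proof.
move=> [h1 h2 h3 h4 h5 h6 h7 h8] e0 e2 e3 e5 e6 eo.
by split; rewrite ?e0 ?e2 ?e3 ?e5 ?e6 ?(eq_mkseq eo).
Qed.

Lemma wp_round (s : st) : regs s -> bnd s -> graph_ok n s ->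
  wp Cround (fun s' => [/\ tm s' <= tm s + round_cost, graph_ok n s', budget s' <= budget s &
    v s' 28 = 0 /\ (forall u, u < n -> deg (ia s' 0) (v s' 5) u = 0) \/
    v s' 28 = v s 28 /\ nlive n (ia s' 0) (v s' 5) < nlive n (ia s 0) (v s 5)]) s.
Proof.
move=> rg bs gok; have [gM sM gE gk _ _ _ _] := gok.
have E2 : v s 5 <= 2 * m by lia.
have Lm : 2 * m < base n r m.
  have : m * (2 * 2) <= m * (r * r) by rewrite !leq_mul.
  by rewrite /base; lia.
have dL u : u < n -> deg (ia s 0) (v s 5) u <= 2 * m.
  by move=> un; have := deg_le_live gM un; lia.
apply: wp_seq; apply: (wp_use (wp_choose n_gt0 r_gt1 S_def rg bs erefl erefl E2 gM _)); first by lia.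
move=> s1 f1 [t1 b1 mx].
have rg1 := regs_fr f1 rg isT; have bs1 := fr_b f1 bs.
have M1 : ia s1 0 = ia s 0 by rewrite (fr_i f1).
have E1 : v s1 5 = v s 5 by rewrite (fr_v f1).
have g1 : graph_ok n s1.
  apply: graph_ok_eq gok _ _ _ _ _ _; rewrite ?(fr_i f1) ?(fr_v f1) //.
  exact: (opat_fr f1 isT).
have bg1 : budget s1 = budget s by rewrite /budget M1 E1 (fr_i f1).
have tb : n * (3 * v s 5 + 12) + 3 <= n * (6 * m + 12) + 3 by rewrite leq_add2r leq_mul2l; apply/orP; right; lia.
have mv28 : v s1 28 = v s 28 by rewrite (fr_v f1).
set key1 := key n r m (ia s 0) (v s 5) in b1 mx.
apply: wp_if => //=.
- rewrite leqn0 => /eqP b0; apply: wp_set => //.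
  split; rewrite /= ?bg1 //; first by rewrite /round_cost; lia.
    by apply: graph_ok_eq g1 _ _ _ _ _ _.
    by rewrite -bg1.
  left; split=> // u un; rewrite /= /upd /= M1 E1.
  have := mx u un; rewrite b0 /key1 /key; case: ifP; last by lia.
  by move=> _; lia.
- move=> bpos; case: b1 => [b0|[yn b1]]; first by rewrite b0 in bpos.
  have [y ey] : exists y, y = v s1 9 by eexists.
  rewrite -ey in yn b1.
  have rg3 : regs (tick (tick s1)) by case: rg1.
  have bs3 : bnd (tick (tick s1)) by case: bs1.
  apply: wp_if => //=; rewrite (rg_L rg1) b1 /key1 /key => hb.
  + have dy : 1 <= deg (ia s 0) (v s 5) y <= 2.
      by move: hb; case: ifP => //; have := dL y yn; lia.
    apply: (wp_use (wp_elim (s := tick (tick s1)) (y := y) rg3 bs3 _ _ yn _)).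
    * by apply: graph_ok_eq g1 _ _ _ _ _ _.
    * by [].
    * by rewrite /= M1 E1.
    move=> s2 f2 [t2 g2 l2 p2]; rewrite /= in t2.
    split=> //.
    * by rewrite /round_cost; lia.
    * rewrite -bg1 /budget (fr_i f2 (a := 2)) //=.
      by rewrite leq_add2r.
    * right; rewrite (fr_v f2) // -mv28; split=> //.
      by move: l2; rewrite /= M1 E1.
  + have [kd d3] : key1 y = deg (ia s 0) (v s 5) y /\ 3 <= deg (ia s 0) (v s 5) y.
      move: bpos hb; rewrite b1 /key1 /key; case: ifP => //; lia.
    apply: (wp_use (wp_branch (s := tick (tick s1)) (y := y) (d := deg (ia s 0) (v s 5) y) rg3 bs3 _ _ yn _ _ _ _)).
    * by apply: graph_ok_eq g1 _ _ _ _ _ _.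
    * by [].
    * by rewrite /= b1 kd.
    * by rewrite /= M1 E1.
    * by [].
    * move=> u un; rewrite /= M1 E1; have := mx u un; rewrite b1 kd /key1 /key.
      have := dL y yn; case: ifP; lia.
    move=> s2 f2 [t2 g2 l2 p2]; rewrite /= in t2.
    split=> //.
    * by rewrite /round_cost; lia.
    * by rewrite -bg1 /budget.
    * right; rewrite (fr_v f2) // -mv28; split=> //.
      by move: l2; rewrite /= M1 E1.
Qed.

Lemma Qof_ext el el' M E : (forall u, u < n -> (el u == 0) = (el' u == 0)) ->
  Qof n el M E = Qof n el' M E.
Proof.
move=> h; rewrite /Qof (@eq_in_filter _ (fun u => el u == 0) (fun u => el' u == 0)) //.
by move=> u; rewrite mem_iota add0n => /andP[_ /h].
Qed.

Lemma wp_final (s : st) : regs s -> bnd s -> graph_ok n s ->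
  (forall u, u < n -> deg (ia s 0) (v s 5) u = 0) ->
  wp Cfinal (fun s' => [/\ tm s' <= tm s + (n * 16 + 10), v s' 6 <= n + m &
    chain n r m Q0 (branching (ia s' 2)) (mkseq (opat s') (v s' 6)) [:: FK] (v s' 5)]) s.
Proof.
move=> rg bs gok d0; have [gM sM gE gk _ _ _ gch] := gok.
have zS : zbase n r m <= S by apply: (base_S n_gt0 r_gt1 S_def).
have [M eM] : exists M, M = ia s 0 by eexists.
have [E eE] : exists E, E = v s 5 by eexists.
have [el eel] : exists el, el = ia s 3 by eexists.
have [hi ehi] : exists hi, hi = ia s 2 by eexists.
rewrite -?eM -?eE -?eel -?ehi in gM sM gE gk gch d0.
have E2 : E <= 2 * m by lia.
have nmS : n + m < S.
  have h4 : m * (2 * 2) <= m * (r * r) by rewrite !leq_mul.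
  have h2 : n * 1 <= n * r by rewrite leq_mul2l ltnW ?orbT.
  by rewrite S_def /base; lia.
have dead e : e < E -> n <= M (2 * e).
  move=> eE'; rewrite leqNgt; apply/negP => un.
  by have [h _] := deg0P (d0 _ un) eE'; apply: h.
apply: wp_seq; apply: wp_set; rewrite //= ?(rg_n rg); first by lia.
apply: wp_seq; apply: wp_set; rewrite //= /upd /= ?(rg_n rg); first by lia.
apply: wp_seq; apply: wp_set; rewrite //= /upd /= ?(rg_z rg) //.
apply: wp_seq; apply: wp_set; rewrite //= /upd /= ?(rg_z rg) //.
do 4 (apply: wp_seq; apply: wp_set; [by []|by rewrite /=; lia|]); rewrite /=.
set s1 := setv _ 21 _.
have f1 : fr (Seqs [:: ISet 13 (Cst 0); ISet 14 (Cst 0); ISet 15 (Cst 0); ISet 17 (Cst 0);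
    ISet 16 (Cst 0); ISet 18 (Cst 0); ISet 20 (Cst 0); ISet 21 (Cst 0)]) s s1.
  split=> [j|//|//|//|[h1 h2]].
    rewrite /= !inE !negb_or => /and5P[/negPf e1 /negPf e2 /negPf e3 /negPf e4 /and4P[/negPf e5 /negPf e6 /negPf e7 /negPf e8]].
    by rewrite /= /upd e1 e2 e3 e4 e5 e6 e7 e8.
  by split=> // j; rewrite /= /upd; do 8 (case: ifP => _; [lia|]); apply: h1.
have rg1 := regs_fr f1 rg isT; have bs1 := fr_b f1 bs.
have r1 : [/\ [/\ v s1 13 = n, v s1 14 = n, v s1 15 = zbase n r m & v s1 17 = zbase n r m],
   v s1 16 = 1, v s1 18 = 1, v s1 20 = 0 & v s1 21 = 1] by [].
have t1 : tm s1 = tm s + 8 by rewrite /s1 /=; lia.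
(* The loop does not write array 3; these are the marks which it would have set. *)
pose eli i := fun u => if u < i then 1 else el u.
pose Inv i (s2 : st) := v s2 6 <= m + i /\
  chain n r m Q0 (branching hi) (mkseq (opat s2) (v s2 6)) (Qof n (eli i) M E) E.
apply: (@wp_for_tick _ _ _ _ _ _ _ 0 n 14 Inv).
- by [].
- by [].
- by [].
- by lia.
- by lia.
- by [].
- by move=> s2 i _ f _ _; rewrite /= (rg_n (regs_fr f rg1 isT)).
- rewrite /Inv; split; first by rewrite /= /upd /=; lia.
  have -> : mkseq (opat (setv s1 10 0)) (v (setv s1 10 0) 6) = mkseq (opat s) (v s 6) by [].
  by rewrite (Qof_ext (el' := el)).
- move=> s2 u /andP[_ un] f vu [k2 c2].
  have rg2 := regs_fr f rg1 isT; have bs2 := fr_b f bs1.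
  have el2 : ia s2 3 = el by rewrite (fr_i f) // (fr_i f1).
  apply: wp_if => //=; rewrite ?vu ?el2; first by lia.
  + rewrite leqn0 => /eqP elu.
    apply: wp_seq; apply: wp_set; rewrite //= ?vu; first by lia.
    apply: wp_seq; apply: wp_set; rewrite //= /upd /= ?vu ?(rg_r rg2) -/(ubase r u).
      by have := ubase_S n_gt0 r_gt1 S_def un; lia.
    set s3 := setv _ 19 _.
    have f3 : fr (Seq (ISet 9 (Cst 0)) (ISet 19 (Cst 0))) s2 s3.
      split=> [q|//|//|//|[h1 h2]]; first by rewrite !inE /= /upd => /norP[/negPf -> /negPf ->].
      have uS := ubase_S n_gt0 r_gt1 S_def un.
      by split=> // q; rewrite /= /upd; do 2 (case: ifP => _; [lia|]); apply: h1.
    have k3 : v s3 6 = v s2 6 by rewrite (fr_v f3).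
    apply: (wp_use (wp_emit (fr_b f3 bs2) k3 _)); first by lia.
    move=> s4 f4 [t4 k4 ops4]; split; first by move: t4; rewrite /s3 /=; lia.
    split; first by rewrite /= /upd /= k4; lia.
    have -> : mkseq (opat (tick (setv s4 10 u.+1))) (v (tick (setv s4 10 u.+1)) 6) = mkseq (opat s4) (v s2 6).+1.
      by rewrite -k4.
    rewrite ops4 (eq_mkseq (f := opat s3) (g := opat s2)); last by move=> q; rewrite (opat_fr f3 isT).
    apply: ChainS c2 _.
    have -> : oregs s3 = Op u n n (ubase r u) (zbase n r m) 1 (zbase n r m) 1 0 1.
      case: r1 => [[a1 a2 a3 a4] a5 a6 a7 a8].
      rewrite /oregs /= /upd /=.
      rewrite (fr_v f (k := 13)) // a1 (fr_v f (k := 14)) // a2 (fr_v f (k := 15)) // a3.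
      rewrite (fr_v f (k := 17)) // a4 (fr_v f (k := 16)) // a5 (fr_v f (k := 18)) // a6.
      by rewrite (fr_v f (k := 20)) // a7 (fr_v f (k := 21)) // a8.
    rewrite (Qof_ext (el := eli u.+1) (el' := upd (eli u) u 1)); last first.
      by move=> u' _; rewrite /eli updE ltnS leq_eqVlt; case: (u' == u).
    by apply: step_final => //; rewrite /eli ltnn.
  + move=> elu; apply: wp_skip; split; first by rewrite /=; lia.
    rewrite /Inv; split; first by rewrite /= /upd /=; lia.
    have -> : mkseq (opat (tick (setv (tick s2) 10 u.+1))) (v (tick (setv (tick s2) 10 u.+1)) 6) = mkseq (opat s2) (v s2 6) by [].
    rewrite (Qof_ext (el' := eli u)) // => u' _; rewrite /eli ltnS leq_eqVlt.
    by case: (u' =P u) => [->|//]; rewrite ltnn /=; lia.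
- move=> s2 f vn [k2 c2] t2; split; [by lia|by lia|].
  have E2' : v s2 5 = E by rewrite (fr_v f) // (fr_v f1).
  have -> : ia s2 2 = hi by rewrite (fr_i f) // (fr_i f1).
  rewrite E2'; have -> // : [:: FK] = Qof n (eli n) M E.
  rewrite /Qof; have -> : [seq u <- iota 0 n | eli n u == 0] = [::].
    rewrite (@eq_in_filter _ _ pred0) ?filter_pred0 // => u.
    by rewrite mem_iota add0n /eli => /andP[_ ->].
  have -> // : [seq e <- iota 0 E | M (2 * e) < n] = [::].
  rewrite (@eq_in_filter _ _ pred0) ?filter_pred0 // => e.
  by rewrite mem_iota add0n => /andP[_ /dead]; rewrite leqNgt => /negPf.
Qed.
End Plan.

(** * Planning followed by search *)

Section Main.
Variables (R : realType) (S n r m : nat).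
Hypothesis n_gt0 : (0 < n)%N.
Hypothesis r_gt1 : (1 < r)%N.
Hypothesis S_def : S = (8 * base n r m)%N.
Local Open Scope nat_scope.
Local Notation st := (st R).
Local Notation regs := (@regs R n r m).
Local Notation wp := (@wp R S).
Local Notation fr := (fr S).
Local Notation bnd := (bnd S).

Let r_gt0 : 0 < r. Proof. exact: ltnW. Qed.

Lemma wp_init (s : st) : v s 0 = n -> v s 1 = r -> v s 2 = m -> w s 9 = 0%R -> bnd s ->
  wp Cinit (fun s' => [/\ tm s' <= tm s + (3 * n + 10), regs s', v s' 5 = m, v s' 6 = 0 &
    (forall u, u < n -> ia s' 2 u = r) /\ ia s' 2 n = 1]) s.
Proof.
move=> v0 v1 v2 w9 bs.
have hm := mS n_gt0 r_gt1 S_def; have hn := nS n_gt0 r_gt1 S_def; have hr := rS n_gt0 r_gt1 S_def.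
have bS : 8 * (1 + n * r) + 8 * (m * (r * r)) <= S by rewrite S_def /base; lia.
have rrS : r * r * (1 - (1 - m)) <= S.
  case: (posnP m) => [->|m0]; first by rewrite !subn0 subnn muln0.
  have -> : 1 - (1 - m) = 1 by lia.
  have : 1 * (r * r) <= m * (r * r) by rewrite leq_mul2r m0 orbT.
  by rewrite muln1 mul1n; lia.
have rrm e : e * (r * r * (1 - (1 - m))) = e * (r * r) \/ m = 0.
  by case: (posnP m) => [|m0]; [right|left; rewrite (_ : 1 - (1 - m) = 1) ?muln1 //; lia].
have bm : 1 + n * r + m * (r * r * (1 - (1 - m))) = base n r m.
  by rewrite /base; case: (rrm m) => -> //; rewrite !mul0n.
have bz : 1 + n * r + 2 * m * (r * r * (1 - (1 - m))) = zbase n r m.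
  by rewrite /zbase /base; case: (rrm (2 * m)) => -> //; rewrite !muln0.
have zS : zbase n r m <= S by apply: (base_S n_gt0 r_gt1 S_def).
have mS' : base n r m <= S by rewrite S_def; lia.
apply: wp_seq; apply: wp_set; rewrite //= ?v1 ?v2 //.
apply: wp_seq; apply: wp_set; rewrite //= /upd /= ?v0 ?v1; first by lia.
apply: wp_seq; apply: wp_set; rewrite //= /upd /= ?v2 ?bm //.
apply: wp_seq; apply: wp_set; rewrite //= /upd /= ?v2 ?bz //.
apply: wp_seq; apply: wp_set; rewrite //= /upd /= ?v2 //; first by lia.
apply: wp_seq; apply: wp_set => //.
set s1 := setv _ 6 _.
have rg1 : regs s1.
  split; rewrite //= => m0.
  by rewrite (_ : 1 - (1 - m) = 1) ?muln1 //; lia.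
have bs1 : bnd s1.
  case: bs => h1 h2; split=> // j; rewrite /= /upd; do 6 (case: ifP => _; first by [lia|done]).
  exact: h1.
pose Inv i (s2 : st) := forall u, u < i -> ia s2 2 u = r.
apply: wp_seq; apply: (@wp_for_tick _ _ _ _ _ _ _ 0 n 1 Inv).
- by [].
- by [].
- by [].
- by lia.
- by lia.
- by [].
- by move=> s2 i _ f _ _; rewrite /= (rg_n (regs_fr f rg1 isT)).
- by [].
- move=> s2 i /andP[_ id] f vi inv.
  have rg2 := regs_fr f rg1 isT.
  apply: wp_st; rewrite //= ?vi ?(rg_r rg2); try by lia.
  split; first by rewrite /=; lia.
  move=> u; rewrite ltnS leq_eqVlt /= /upd /= => /orP[/eqP->|ui]; first by rewrite eqxx.
  by case: eqP => // _; apply: inv.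
- move=> s2 f vn inv t2.
  have rg2 := regs_fr f rg1 isT.
  apply: wp_st; rewrite //= ?(rg_n rg2); try by lia.
  split=> //.
  + by move: t2; rewrite /s1 /=; lia.
  + by case: rg2 => *; split.
  + by rewrite /= (fr_v f).
  + by rewrite /= (fr_v f).
  + split=> [u un|]; rewrite /= /upd /= ?eqxx //; case: eqP => [e|_]; first by lia.
    exact: inv.
Qed.

Definition plan_cost := (m + 1) * (round_cost n m).+1 + 20 * n + 40.

Lemma wp_plan (s : st) (Q0 := Qof n (ia s 3) (ia s 0) m) :
  v s 0 = n -> v s 1 = r -> v s 2 = m -> w s 9 = 0%R -> bnd s ->
  gwf n (ia s 0) m -> simple n (ia s 0) m -> (forall u, u < n -> ia s 3 u = 0) ->
  wp Cplan (fun s' => [/\ tm s' <= tm s + plan_cost, regs s' /\ v s' 6 <= n + m,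
    chain n r m Q0 (branching (ia s' 2)) (mkseq (opat s') (v s' 6)) [:: FK] (v s' 5),
    (forall u, u < n -> ia s' 2 u = 1 \/ ia s' 2 u = r) /\ ia s' 2 n = 1 &
    5 * nbranch n (ia s' 2) <= m]) s.
Proof.
move=> v0 v1 v2 w9 bs gM sM el0.
apply: wp_seq; apply: (wp_use (wp_init v0 v1 v2 w9 bs)) => s1 f1 [t1 rg1 E1 k1 [hi1 hin1]].
have bs1 := fr_b f1 bs.
have M1 : ia s1 0 = ia s 0 by rewrite (fr_i f1).
have el1 : ia s1 3 = ia s 3 by rewrite (fr_i f1).
have nl : nlive n (ia s 0) m <= m.
  rewrite /nlive; apply: (@leq_trans (\sum_(0 <= e < m) 1)); last by rewrite sum_nat_const_nat subn0 muln1.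
  by apply: leq_sum => e _; case: (_ < n).
have g1 : graph_ok n r m Q0 n s1.
  split; rewrite ?M1 ?E1 ?el1 ?k1 //.
  - by lia.
  - move=> e u em un h; split; first exact: el0.
    by left; apply: hi1.
  - by move=> u un; right; apply: hi1.
  - exact: Chain0.
have bg1 : budget n s1 <= 4 * m.
  rewrite /budget M1 E1; have := pot_le n (ia s 0) m.
  have -> : nbranch n (ia s1 2) = 0.
    rewrite /nbranch count_iota big_nat big1 // => u /andP[_ un].
    by rewrite /branching hi1 //; lia.
  by lia.
have S1 : 1 <= S by rewrite S_def /base; lia.
apply: wp_seq; apply: wp_set => //; set s2 := setv _ _ _.
have f2 : fr (ISet 28 (Cst 0)) s1 s2.
  split=> [j|//|//|//|[h1 h2]]; first by rewrite !inE /= /upd => /negPf ->.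
  by split=> // j; rewrite /= /upd; case: ifP.
have rg2 := regs_fr f2 rg1 isT; have bs2 := fr_b f2 bs1.
have t2 : tm s2 <= tm s + (3 * n + 11) by rewrite /s2 /=; lia.
(* Every round deletes a live edge, except the last one, which only clears [go_]; the summand 1 in
   the variant is for that round. *)
pose Inv j (s3 : st) := [/\ graph_ok n r m Q0 n s3, budget n s3 <= 4 * m &
  v s3 28 = 0 /\ (forall u, u < n -> deg (ia s3 0) (v s3 5) u = 0) \/
  v s3 28 = 1 /\ j = nlive n (ia s3 0) (v s3 5) + 1].
apply: wp_seq; apply: (@wp_while _ _ _ _ _ _ (nlive n (ia s 0) m + 1) (round_cost n m) Inv).
- split; first by apply: (graph_ok_eq g1).
    by rewrite -[budget n s2]/(budget n s1).
  by right; rewrite /= M1 /upd /= E1.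
- move=> s3 j f3 [g3 b3 c3]; split=> //= go3.
  have rg3 := regs_fr f3 rg2 isT; have bs3 := fr_b f3 bs2.
  have ej : v s3 28 = 1 /\ j = nlive n (ia s3 0) (v s3 5) + 1 by case: c3 => // -[e _]; rewrite e in go3.
  have [e28 ej'] := ej.
  apply: (wp_use (wp_round n_gt0 r_gt1 S_def rg3 bs3 g3)) => s4 f4 [t4 g4 b4 c4].
  split=> //; case: c4 => [[e4 d0]|[e4 lt4]].
    exists 0; first by lia.
    split; [exact: (graph_ok_eq g4)|exact: leq_trans b4 b3|by left].
  exists (nlive n (ia s4 0) (v s4 5) + 1); first by lia.
  split; [exact: (graph_ok_eq g4)|exact: leq_trans b4 b3|right].
  by rewrite /= e4 e28.
- move=> s3 j f3 [g3 b3 c3] /= go3 t3.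
  have d0 : forall u, u < n -> deg (ia s3 0) (v s3 5) u = 0.
    by case: c3 => [[_ h]//|[e _]]; rewrite e in go3.
  have rg3 : regs (tick s3) := regs_fr f3 rg2 isT.
  have bs3 : bnd (tick s3) := fr_b f3 bs2.
  have g3' : graph_ok n r m Q0 n (tick s3) by apply: (graph_ok_eq g3).
  apply: (wp_use (wp_final n_gt0 r_gt1 S_def rg3 bs3 g3' d0)) => s4 f4 [t4 k4 ch4].
  have hi4 : ia s4 2 = ia s3 2 by rewrite (fr_i f4).
  split=> //.
  + have : (nlive n (ia s 0) m + 1) * (round_cost n m).+1 <= (m + 1) * (round_cost n m).+1.
      by rewrite leq_mul2r; apply/orP; right; lia.
    by move: t3 t4; rewrite /plan_cost /=; lia.
  + by split=> //; apply: regs_fr f4 rg3 isT.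
  + by rewrite hi4; case: g3.
  + by rewrite hi4; move: b3; rewrite /budget; lia.
Qed.

Definition main_cost D := plan_cost + (r ^ D * (leaf_cost n r m (n + m)).+1 + 3).

Lemma leaf_cost_mono K K' : K <= K' -> leaf_cost n r m K <= leaf_cost n r m K'.
Proof. by move=> h; rewrite /leaf_cost !leq_add2r !leq_add // ?leq_mul2r ?h ?orbT. Qed.

Lemma code0 Sp k : code r Sp k (fun _ => 0) = 0.
Proof. by elim: k => //= k ->; case: (Sp k). Qed.

Lemma wp_main (s : st) (Q0 := Qof n (ia s 3) (ia s 0) m) :
  v s 0 = n -> v s 1 = r -> v s 2 = m -> w s 9 = 0%R -> bnd s ->
  gwf n (ia s 0) m -> simple n (ia s 0) m -> (forall u, u < n -> ia s 3 u = 0) ->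
  (forall u, u <= n -> ia s 1 u = 0) ->
  wp Cmain (fun s' => (exists D, [/\ 5 * D <= m, D <= n & tm s' <= tm s + main_cost D]) /\
    exists phi, [/\ col n r phi, forall u, u < n -> ia s' 0 u = phi u,
      w s' 0 = F n r Q0 (table0 n r m s) phi &
      forall psi, col n r psi -> (F n r Q0 (table0 n r m s) psi <= w s' 0)%R]) s.
Proof.
move=> v0 v1 v2 w9 bs gM sM el0 lo0.
apply: wp_seq; apply: (wp_use (wp_plan v0 v1 v2 w9 bs gM sM el0)).
move=> s1 f1 [t1 [rg1 k1] ch1 [hi1 hin1] nb1].
have bs1 := fr_b f1 bs.
have lo1 : ia s1 1 = ia s 1 by rewrite (fr_i f1).
have ds1 : dstate n r (branching (ia s1 2)) (ia s1 1) (ia s1 2).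
  split=> //; last by rewrite lo1 lo0.
  move=> u un; rewrite lo1 (lo0 _ (ltnW un)) /branching.
  by case: (hi1 u un) => ->; [split|rewrite leqNgt r_gt1; split].
have c1 : code r (branching (ia s1 2)) n (ia s1 1) = 0.
  rewrite -[RHS](code0 (branching (ia s1 2)) n); apply: eq_code => u un _.
  by rewrite lo1 lo0 // ltnW.
have nmS : n + m < S.
  have h4 : m * (2 * 2) <= m * (r * r) by rewrite !leq_mul.
  have h2 : n * 1 <= n * r by rewrite leq_mul2l ltnW ?orbT.
  by rewrite S_def /base; lia.
have T0 : table0 n r m s1 = table0 n r m s by rewrite /table0 (fr_r f1).
apply: (wp_use (wp_search n_gt0 r_gt1 S_def (E := v s1 5) rg1 bs1 ds1 c1 erefl _ _ ch1)).
- by lia.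
- exact: wfQ_Qof.
move=> s2 f2 [t2 [phi [p1 p2 p3 p4]]]; split; last by exists phi; rewrite -T0.
exists (nbranch n (ia s1 2)); split=> //.
  by rewrite /nbranch -[X in _ <= X](size_iota 0) count_size.
apply: leq_trans t2 _; rewrite /main_cost /weight -/(nbranch n (ia s1 2)).
have : r ^ nbranch n (ia s1 2) * (leaf_cost n r m (v s1 6)).+1 <=
    r ^ nbranch n (ia s1 2) * (leaf_cost n r m (n + m)).+1.
  by rewrite leq_mul2l ltnS leaf_cost_mono ?orbT.
by lia.
Qed.

End Main.

(** * Reading the instance off the input: the factor sum is the score *)

Section Decode.
Local Open Scope nat_scope.

Lemma nth_flatten_const T (x0 : T) (l : seq (seq T)) k e i :
  all (fun x => size x == k) l -> e < size l -> i < k ->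
  nth x0 (flatten l) (e * k + i) = nth x0 (nth [::] l e) i.
Proof.
elim: l e => //= x l IH [|e] /andP[/eqP sx sl] el ik; rewrite nth_cat sx.
  by rewrite ik.
have -> : (e.+1 * k + i < k) = false by rewrite mulSn -addnA; apply/negP; lia.
by rewrite mulSn -addnA addKn IH.
Qed.

Variables (R : realType) (n r : nat).
Variables (I : max2csp R n r) (es : seq ('I_n * 'I_n)).
Hypothesis n_gt0 : 0 < n.
Hypothesis r_gt1 : 1 < r.
Hypothesis es_edges : perm_eq es (enum (edges I)).

Let r_gt0 : 0 < r. Proof. exact: ltnW. Qed.
Let m := size es.
Let e0 : 'I_n * 'I_n := (Ordinal n_gt0, Ordinal n_gt0).

Lemma size_int_input : size (int_input es) = 2 * m.
Proof. by rewrite /int_input /m; elim: es => //= e l ->; lia. Qed.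

Lemma nth_int_input e : e < m ->
  nth 0 (int_input es) (2 * e) = (nth e0 es e).1 /\
  nth 0 (int_input es) (2 * e + 1) = (nth e0 es e).2.
Proof.
move=> em; have h i : i < 2 -> nth 0 (int_input es) (e * 2 + i) =
    nth 0 [:: val (nth e0 es e).1; val (nth e0 es e).2] i.
  move=> i2; rewrite /int_input nth_flatten_const ?size_map //; last by apply/allP => x /mapP[? _ ->].
  by rewrite (nth_map e0).
by split; [have := h 0 isT|have := h 1 isT]; rewrite ?addn0 mulnC.
Qed.

Lemma nth_es_edge e : e < m -> let: (u, u') := nth e0 es e in u < u'.
Proof.
move=> em; have : nth e0 es e \in enum (edges I) by rewrite -(perm_mem es_edges) mem_nth.
by rewrite mem_enum inE; case: (nth _ _ _) => u u' /andP[].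
Qed.

Lemma uniq_es : uniq es.
Proof. by rewrite (perm_uniq es_edges) enum_uniq. Qed.

Lemma gwf_input : gwf n (nth 0 (int_input es)) m.
Proof.
move=> e em; right; have [-> ->] := nth_int_input em; have := nth_es_edge em.
by case: (nth _ _ _) => u u' /= uu; split; rewrite ?ltn_ord //; lia.
Qed.

(** The listed edges are distinct and have their smaller end first, so no pair of ends is listed
    twice in either order. *)
Lemma simple_input : simple n (nth 0 (int_input es)) m.
Proof.
move=> e e' u u' em em' _ _; rewrite /joins.
have [-> ->] := nth_int_input em; have [-> ->] := nth_int_input em'.
have := nth_es_edge em; have := nth_es_edge em'.
case E1: (nth e0 es e) => [a b]; case E2: (nth e0 es e') => [a' b'] /= ab' ab h h'.
have [ea eb] : (a = a' :> nat) /\ (b = b' :> nat) by lia.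
have : nth e0 es e == nth e0 es e'.
  by rewrite E1 E2 xpair_eqE -!val_eqE /= ea eb !eqxx.
by rewrite nth_uniq ?uniq_es // => /eqP.
Qed.

Definition ffun_of (phi : nat -> nat) : {ffun 'I_n -> 'I_r} :=
  [ffun u : 'I_n => insubd (Ordinal r_gt0) (phi u)].

Definition nat_fun (psi : {ffun 'I_n -> 'I_r}) u :=
  if insub u is Some u' then val (psi u') else 0.

Lemma col_nat_fun psi : col n r (nat_fun psi).
Proof.
split=> [u un|]; rewrite /nat_fun.
  by case: insubP => [u' _ _|]; [apply: ltn_ord|rewrite un].
by case: insubP => //= u; rewrite ltnn.
Qed.

Lemma ffun_of_val phi (u : 'I_n) : col n r phi -> ffun_of phi u = phi u :> nat.
Proof. by move=> [h _]; rewrite ffunE val_insubd h. Qed.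

Lemma nat_funK psi : ffun_of (nat_fun psi) = psi.
Proof.
apply/ffunP => u; apply: val_inj; rewrite /= (ffun_of_val u (col_nat_fun psi)).
by rewrite /nat_fun valK.
Qed.

Lemma nth_allpairs (f : 'I_r -> 'I_r -> R) (i j : 'I_r) :
  nth 0%R [seq f i j | i <- enum 'I_r, j <- enum 'I_r] (i * r + j) = f i j.
Proof.
rewrite nth_flatten_const; first last.
- exact: ltn_ord.
- by rewrite size_map size_enum_ord ltn_ord.
- by apply/allP => x /mapP[? _ ->]; rewrite size_map size_enum_ord.
rewrite (nth_map i) ?size_enum_ord // nth_ord_enum (nth_map j) ?size_enum_ord //.
by rewrite nth_ord_enum.
Qed.

Lemma nth_real_monadic (u : 'I_n) (i : 'I_r) :
  nth 0%R (real_input I es) (ubase r u + i) = monadic I u i.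
Proof.
rewrite /real_input /ubase -addnA add1n /= nth_cat size_allpairs !size_enum_ord.
have -> : u * r + i < n * r by have := ltn_ord u; have := ltn_ord i; nia.
rewrite nth_flatten_const; first last.
- exact: ltn_ord.
- by rewrite size_map size_enum_ord ltn_ord.
- by apply/allP => x /mapP[? _ ->]; rewrite size_map size_enum_ord.
rewrite (nth_map u) ?size_enum_ord // nth_ord_enum (nth_map i) ?size_enum_ord //.
by rewrite nth_ord_enum.
Qed.

Lemma nth_real_dyadic e (i j : 'I_r) : e < m ->
  nth 0%R (real_input I es) (base n r e + i * r + j) =
  dyadic I (nth e0 es e).1 (nth e0 es e).2 i j.
Proof.
move=> em; rewrite /real_input /base -!addnA add1n /= nth_cat size_allpairs !size_enum_ord.
rewrite ltnNge leq_addr /= addKn nth_flatten_const; first last.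
- by have := ltn_ord i; have := ltn_ord j; nia.
- by rewrite size_map.
- by apply/allP => x /mapP[e1 _ ->]; rewrite size_allpairs !size_enum_ord.
by rewrite (nth_map e0) // nth_allpairs.
Qed.

Lemma F_score (el M : nat -> nat) (T : nat -> R) phi : col n r phi ->
  (forall u, u < n -> el u = 0) -> (forall i, i < base n r m -> T i = nth 0%R (real_input I es) i) ->
  M =1 nth 0 (int_input es) -> F n r (Qof n el M m) T phi = score I (ffun_of phi).
Proof.
move=> cphi el0 hT hM; rewrite /F /Qof big_cons big_cat !big_map !big_filter /=.
have bm := base_mono n r_gt0 (leq0n m).
have iotaE k : iota 0 k = index_iota 0 k by rewrite /index_iota subn0.
rewrite /score addrA; congr (_ + _ + _)%R.
- by rewrite hT //; move: bm; rewrite /base; lia.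
- rewrite big_mkcond iotaE big_mkord; apply: eq_bigr => u _.
  rewrite el0 //= hT; last by have := ubase_lt r_gt0 (ltn_ord u) (cphi.1 _ (ltn_ord u)); lia.
  by rewrite -(ffun_of_val u cphi) nth_real_monadic.
- have -> : (\sum_(e in edges I) dyadic I e.1 e.2 (ffun_of phi e.1) (ffun_of phi e.2) =
     \sum_(e <- es) dyadic I e.1 e.2 (ffun_of phi e.1) (ffun_of phi e.2))%R.
    by rewrite (perm_big _ es_edges) /= big_enum.
  rewrite (big_nth e0) big_mkcond iotaE; apply: eq_big_nat => e /andP[_ em].
  rewrite !hM; have [-> ->] := nth_int_input em; rewrite ltn_ord.
  have a1 := cphi.1 _ (ltn_ord (nth e0 es e).1); have a2 := cphi.1 _ (ltn_ord (nth e0 es e).2).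
  rewrite hT.
    by rewrite -(ffun_of_val (nth e0 es e).1 cphi) -(ffun_of_val (nth e0 es e).2 cphi) nth_real_dyadic.
  rewrite -addnA; apply: leq_trans (base_lt n r_gt0 e (pair_lt r_gt1 a1 a2)) _.
  by apply: base_mono.
Qed.

End Decode.

(** * The time bound *)

Section Time.
Local Open Scope nat_scope.

Lemma cube_le q : q.+1 ^ 3 <= 8 * 2 ^ q.
Proof.
(* The ratio of successive cubes is at most 2 only from q = 3 on, where equality holds in the
   claim. *)
elim: q => // q IH; case: (ltnP q 3) => [|q3]; first by case: q IH => [|[|[|]]].
rewrite [2 ^ _]expnS; have : q.+2 ^ 3 <= 2 * q.+1 ^ 3 by rewrite !expnS !expn0; nia.
by move: IH; move: (q.+2 ^ 3) (q.+1 ^ 3) (2 ^ q) => *; lia.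
Qed.

(** At most m + 1 rounds of cost O(n (m+1)^2) each; the resulting cube of m + 1 is absorbed by
    2^(m/5) <= r^(m/5). *)
Lemma plan_cost_le n r m : 0 < n -> 1 < r ->
  plan_cost n m <= 300 * 1000 * (n * r ^ (3 + m %/ 5)).
Proof.
move=> n0 r1; set q := m %/ 5.
have m5 : m.+1 <= 5 * q.+1 by rewrite /q; lia.
(* 1000 = 5^3 * 8, with 8 from [cube_le]. *)
have c3 : m.+1 ^ 3 <= 1000 * 2 ^ q.
  apply: (@leq_trans ((5 * q.+1) ^ 3)); first by rewrite leq_exp2r.
  by rewrite expnMn; have := cube_le q; lia.
have p2 : 2 ^ q <= r ^ q by case: (q) => [|q'] //; rewrite leq_exp2r.
have r3 : r ^ q <= r ^ (3 + q) by apply: leq_pexp2l; lia.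
have rc : plan_cost n m <= 300 * (n * m.+1 ^ 3).
  rewrite /plan_cost /round_cost !expnS expn0.
  have h : n * (6 * m + 12) + 2 * m * (4 * (2 * m) + 26) + 32 * m + 80 < 200 * (n * (m.+1 * m.+1)) by nia.
  have : (m + 1) * (n * (6 * m + 12) + 2 * m * (4 * (2 * m) + 26) + 32 * m + 80).+1 <=
     (m + 1) * (200 * (n * (m.+1 * m.+1))) by rewrite leq_mul2l h orbT.
  have : n * 1 <= n * (m.+1 * (m.+1 * m.+1)) by rewrite leq_mul2l orbC; apply/orP; left; nia.
  rewrite muln1 => h2 h3.
  have -> : n * (m.+1 * (m.+1 * (m.+1 * 1))) = n * (m.+1 * (m.+1 * m.+1)) by rewrite muln1.
  have e : (m + 1) * (200 * (n * (m.+1 * m.+1))) = 200 * (n * (m.+1 * (m.+1 * m.+1))) by rewrite addn1; nia.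
  by rewrite e in h3; lia.
apply: leq_trans rc _.
have : n * m.+1 ^ 3 <= n * (1000 * r ^ (3 + q)) by rewrite leq_mul2l; apply/orP; right; lia.
by rewrite (mulnCA n 1000); move: (n * m.+1 ^ 3) (n * r ^ (3 + q)) => *; lia.
Qed.

(* When m > 10 n there is room to spare, since D <= n < m/10; otherwise m = O(n). *)
Lemma branches_le n r m D : 0 < n -> 1 < r -> 5 * D <= m -> D <= n ->
  r ^ D * (n + m) <= 30 * (n * r ^ (m %/ 5)).
Proof.
move=> n0 r1 Dm Dn; set q := m %/ 5.
have Dq : D <= q by rewrite /q; lia.
have [mn|mn] := leqP m (10 * n).
  have : r ^ D <= r ^ q by apply: leq_pexp2l; lia.
  move=> h; apply: (@leq_trans (r ^ q * (11 * n))); first by rewrite leq_mul //; lia.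
  by rewrite mulnC -!mulnA; rewrite leq_mul2r; apply/orP; right.
have -> : r ^ q = r ^ D * r ^ (q - D) by rewrite -expnD subnKC.
have p : q - D < 2 ^ (q - D) by apply: ltn_expl.
have p2 : 2 ^ (q - D) <= r ^ (q - D) by case: (q - D) => // k; rewrite leq_exp2r.
have h : n + m <= 30 * r ^ (q - D) by lia.
apply: leq_trans (leq_mul (leqnn (r ^ D)) h) _.
have : 1 * (r ^ D * r ^ (q - D)) <= n * (r ^ D * r ^ (q - D)) by rewrite leq_mul2r n0 orbT.
rewrite mul1n (mulnCA (r ^ D) 30); move: (r ^ D * r ^ (q - D)) => Z.
by move: (n * Z) => *; lia.
Qed.

Lemma main_cost_le n r m D : 0 < n -> 1 < r -> 5 * D <= m -> D <= n ->
  main_cost n r m D <= 310 * 1000 * (n * r ^ (3 + m %/ 5)).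
Proof.
move=> n0 r1 Dm Dn; have pc := plan_cost_le m n0 r1; have br := branches_le n0 r1 Dm Dn.
have r0 : 0 < r by lia.
have lc : (leaf_cost n r m (n + m)).+1 <= 150 * ((n + m) * r ^ 3).
  have e3 : r ^ 3 = r * r * r by rewrite !expnS expn0 muln1 mulnA.
  have h1 : r <= r ^ 3 by rewrite -{1}[r]expn1; apply: leq_pexp2l.
  have h2 : r * r <= r ^ 3 by rewrite mulnn; apply: leq_pexp2l.
  have a2 : m * (r * r) <= m * r ^ 3 by rewrite leq_mul2l h2 orbT.
  have a3 : (n + m) * (28 * r) <= (n + m) * (28 * r ^ 3) by rewrite leq_mul2l; apply/orP; right; lia.
  have a4 : n * 1 <= n * r ^ 3 by rewrite leq_mul2l expn_gt0 r0 orbT.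
  by rewrite /leaf_cost /base -e3; lia.
have : r ^ D * (leaf_cost n r m (n + m)).+1 <= 4500 * (n * r ^ (3 + m %/ 5)).
  apply: leq_trans (leq_mul (leqnn (r ^ D)) lc) _.
  have -> : r ^ D * (150 * ((n + m) * r ^ 3)) = 150 * r ^ 3 * (r ^ D * (n + m)).
    by move: (r ^ D) (r ^ 3) (n + m) => a b c; lia.
  apply: leq_trans (leq_mul (leqnn _) br) _.
  by rewrite expnD; move: (r ^ 3) (r ^ (m %/ 5)) => a b; apply: eq_leq; lia.
have : 0 < n * r ^ (3 + m %/ 5) by rewrite muln_gt0 n0 expn_gt0 r0.
by rewrite /main_cost; lia.
Qed.

End Time.

(** * The prologue and the initial state *)

Section Start.
Local Open Scope nat_scope.

(* Register 3 receives S, which is 8 times the input length. *)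
Definition prologue : program := [:: IMul 40 1 1; IMul 40 40 2; IMul 41 0 1;
  IAdd 40 40 41; IConst 41 1; IAdd 40 40 41; IConst 41 8; IMul 3 40 41].

Definition prog : program := prologue ++ comp 8 Cmain.

Variables (R : realType) (n r : nat) (I : max2csp R n r) (es : seq ('I_n * 'I_n)).
Hypothesis n_gt0 : 0 < n.
Hypothesis r_gt1 : 1 < r.
Let m := size es.
Let S := 8 * base n r m.

Definition start : st R := St (fun k => nth 0 [:: n; r; m; S] k) (fun _ => 0%R)
  (fun a i => nth 0 (int_input es) (a * S + i))
  (fun a i => nth 0%R (real_input I es) (a * S + i)) 0.

Lemma int_input_le i : nth 0 (int_input es) i <= n.
Proof.
case: (ltnP i (size (int_input es))) => [h|h]; last by rewrite nth_default.
have := mem_nth 0 h; move: (nth _ _ _) => x; rewrite /int_input.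
case/flattenP => l /mapP[[u u'] _ ->] /=; rewrite !inE => /orP[]/eqP->; exact: ltnW.
Qed.

Lemma S_bounds : [/\ n <= S, r <= S, m <= S, 24 <= S & m * (r * r) + n * r + 1 <= S].
Proof.
have hS : S = 8 * base n r m by [].
have := mS n_gt0 r_gt1 hS; have := nS n_gt0 r_gt1 hS; have := rS n_gt0 r_gt1 hS.
have : 1 * 2 <= n * r by apply: leq_mul.
by rewrite /S /base => *; split; lia.
Qed.

Lemma start_bnd : bnd S start.
Proof.
have [h1 h2 h3 h4 _] := S_bounds.
split=> [k|a i _] /=; last exact: leq_trans (int_input_le _) h1.
by case: k => [|[|[|[|k]]]] //=; rewrite nth_nil.
Qed.

Lemma prologue_ok : exists c, [/\ reach S prog 8 (initial I es) c, sim S start c & pc c = 8].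
Proof.
have [h1 h2 h3 h4 h5] := S_bounds; have [b1 b2] := start_bnd.
have h8 : 8 <= S by lia.
have W1 : S <= S ^ 40 by rewrite -{1}[S]expn1; apply: leq_pexp2l; lia.
have W3 : S * S * S <= S ^ 40.
  have -> : S * S * S = S ^ 3 by rewrite !expnS expn0 muln1 mulnA.
  by apply: leq_pexp2l; lia.
(* If there are no edges, r * r may exceed S, but it is within the bound on words. *)
have rr : r * r <= S * S * S by apply: (@leq_trans (S * S)); [exact: leq_mul|nia].
set c0 := initial I es.
have w0 : words_at_most (S ^ 40) c0.
  move=> k; split; last exact: leq_trans (int_input_le k) (leq_trans h1 W1).
  by apply: leq_trans W1; case: k => [|[|[|k]]] //=; rewrite nth_nil.
have [|||||c1 [r1 p1 v1 f1 [s1 wd1]]] := @step_set _ S prog (IMul 40 1 1) 40 (r * r) [::] (behead prog) c0 _ _ w0; rewrite //; first by lia.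
have [|||||c2 [r2 p2 v2 f2 [s2 wd2]]] := @step_set _ S prog (IMul 40 40 2) 40 (r * r * m)
  (take 1 prog) (drop 2 prog) c1 _ _ wd1; rewrite //.
- by apply: (@leq_trans S) => //; lia.
- have -> : r * r * m = ireg c1 40 * ireg c1 2 by rewrite v1 f1.
  by case: (c1).
have [|||||c3 [r3 p3 v3 f3 [s3 wd3]]] := @step_set _ S prog (IMul 41 0 1) 41 (n * r)
  (take 2 prog) (drop 3 prog) c2 _ _ wd2; rewrite //.
- by apply: (@leq_trans S) => //; lia.
- have -> : n * r = ireg c2 0 * ireg c2 1 by rewrite !f2 // !f1.
  by case: (c2).
have [|||||c4 [r4 p4 v4 f4 [s4 wd4]]] := @step_set _ S prog (IAdd 40 40 41) 40 (r * r * m + n * r)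
  (take 3 prog) (drop 4 prog) c3 _ _ wd3; rewrite //.
- by apply: (@leq_trans S) => //; lia.
- have -> : r * r * m + n * r = ireg c3 40 + ireg c3 41 by rewrite v3 f3 // v2.
  by case: (c3).
have [|||||c5 [r5 p5 v5 f5 [s5 wd5]]] := @step_set _ S prog (IConst 41 1) 41 1
  (take 4 prog) (drop 5 prog) c4 _ _ wd4; rewrite //.
- by case: (c4).
have [|||||c6 [r6 p6 v6 f6 [s6 wd6]]] := @step_set _ S prog (IAdd 40 40 41) 40 (base n r m)
  (take 5 prog) (drop 6 prog) c5 _ _ wd5; rewrite //.
- by apply: (@leq_trans S) => //; rewrite /base; lia.
- have -> : base n r m = ireg c5 40 + ireg c5 41 by rewrite v5 f5 // v4 /base; lia.
  by case: (c5).
have [|||||c7 [r7 p7 v7 f7 [s7 wd7]]] := @step_set _ S prog (IConst 41 8) 41 8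
  (take 6 prog) (drop 7 prog) c6 _ _ wd6; rewrite //.
- exact: leq_trans h8 W1.
- by case: (c6).
have [|||||c8 [r8 p8 v8 f8 [s8 wd8]]] := @step_set _ S prog (IMul 3 40 41) 3 S
  (take 7 prog) (drop 8 prog) c7 _ _ wd7; rewrite //.
- have -> : S = ireg c7 40 * ireg c7 41 by rewrite v7 f7 // v6 mulnC.
  by case: (c7).
exists c8; split.
- have rc := @reach_cat R S h4 prog.
  exact: (rc _ _ _ _ _ r1 (rc _ _ _ _ _ r2 (rc _ _ _ _ _ r3 (rc _ _ _ _ _ r4 (rc _ _ _ _ _ r5
    (rc _ _ _ _ _ r6 (rc _ _ _ _ _ r7 r8))))))).
- have [q1 q2 q3] := same_store_trans s1 (same_store_trans s2 (same_store_trans s3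
    (same_store_trans s4 (same_store_trans s5 (same_store_trans s6 (same_store_trans s7 s8)))))).
  split=> //; rewrite ?q1 ?q2 ?q3 //.
  move=> k k40; have [->|k3] := eqVneq k 3; first exact: v8.
  have n40 : k != 40 by lia.
  have n41 : k != 41 by lia.
  rewrite f8 // f7 // f6 // f5 // f4 // f3 // f2 // f1 //.
  by case: k k40 k3 {n40 n41} => [|[|[|[|k]]]] //=; rewrite nth_nil.
- by rewrite p8.
Qed.

End Start.

Lemma accesses_below_mono R s s' P (c : config R) : (s <= s')%N ->
  accesses_below s P c -> accesses_below s' P c.
Proof.
move=> ss; rewrite /accesses_below; case: (onth _ _) => // -[] // *.
all: exact: leq_trans ss.
Qed.

Theorem theorem5 (R : realType) :
  exists (P : program) (C : nat),
    forall (n r : nat), (1 <= n)%N -> (2 <= r)%N ->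
    forall (I : max2csp R n r) (es : seq ('I_n * 'I_n)),
      perm_eq es (enum (edges I)) ->
      let m := #|edges I| in
      let L := input_length I in
      exists t : nat,
        [/\ halted P (run P (initial I es) t),
            outputs_optimum I (run P (initial I es) t),
            t%:R <= C%:R * (n%:R * r%:R `^ (3 + m%:R / 5)) :> R
          & runs_in_space (C * L) (L ^ C) P (initial I es) t].
Proof.
(* 300 instructions for each tick, 310 * 1000 from [main_cost_le], 8 for the prologue. The bound 120
   = 3 * 40 serves the word size, as S = 8L <= L^3 for L >= 3; it also covers the 14 arrays of S =
   8L cells. *)
have [C [C1 C2]] : exists C, (300 * (310 * 1000) + 8 <= C /\ 120 <= C)%N.
  by exists (300 * (310 * 1000) + 8)%N; split; lia.
exists prog, C => n r n_gt0 r_gt1 I es es_edges m L.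
have em : m = size es by rewrite /m cardE (perm_size es_edges).
have eL : L = base n r (size es) by rewrite /L /input_length -/m em /base mulnn.
pose S := (8 * base n r (size es))%N.
have hS : S = (8 * base n r (size es))%N by [].
have [_ _ _ S24 _] := S_bounds es n_gt0 r_gt1.
have [c1 [r1 sim1 p1]] := prologue_ok I es n_gt0 r_gt1.
have r_gt0 : (0 < r)%N by exact: ltnW.
have szL : (size (int_input es) <= S)%N.
  by rewrite (@size_int_input R n r I es n_gt0 r_gt1 es_edges); have [_ _ h _ _] := S_bounds es n_gt0 r_gt1;
     have := mS n_gt0 r_gt1 hS; lia.
(* The list of ends fits into the first segment, so all other arrays of naturals start with
   zeros. *)
have cM : forall a, (0 < a)%N -> forall u, ia (start I es) a u = 0%N.
  by move=> a a0 u; rewrite /= nth_default // (leq_trans szL) //; nia.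
have [|||||||||s' bs' [[D [Dm Dn tD]] [phi [cphi out val opt]]]] :=
  @wp_main R S n r (size es) n_gt0 r_gt1 erefl (start I es); rewrite //.
- exact: start_bnd.
- exact: gwf_input es_edges.
- exact: simple_input es_edges.
- by move=> u _; apply: cM.
- by move=> u _; apply: cM.
have [|t [c2 [r2 sim2 p2 t2]]] := comp_ok S24 bs' Cmain_wf (P := prog) (pre := prologue) (post := [::]) (cf := c1) _ p1 sim1.
  by rewrite cats0.
have [run2 safe2] := reach_cat S24 r1 r2.
have FS psi : col n r psi ->
  F n r (Qof n (ia (start I es) 3) (ia (start I es) 0) (size es)) (table0 n r (size es) (start I es)) psi
  = score I (ffun_of n r_gt1 psi).
  move=> cpsi; apply: (F_score n_gt0 r_gt1 es_edges cpsi).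
  - by move=> u _; apply: cM.
  - by move=> i iL; rewrite /table0 iL.
  - by [].
have hlt : (size prog <= pc c2)%N by rewrite p2 size_cat size_comp.
exists (8 + t)%N; rewrite run2; split.
- exact: hlt.
- exists (ffun_of n r_gt1 phi); split.
  + move=> psi; rewrite -[psi](nat_funK r_gt1) -!FS //; last exact: (col_nat_fun r_gt1).
    by rewrite -val; apply: opt; exact: (col_nat_fun r_gt1).
  + by rewrite (sim_w sim2) val FS.
  + move=> u; rewrite (ffun_of_val r_gt1 u cphi) -out //.
    rewrite -(sim_ia sim2) ?mul0n ?add0n //.
    by have := nS n_gt0 r_gt1 hS; have := ltn_ord u; lia.
- have tC : (8 + t <= C * (n * r ^ (3 + m %/ 5)))%N.
    have X : (0 < n * r ^ (3 + m %/ 5))%N by rewrite muln_gt0 n_gt0 expn_gt0 r_gt0.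
    have := main_cost_le n_gt0 r_gt1 Dm Dn; rewrite -em => mc.
    move: t2 tD; rewrite /= muln0 addn0 add0n -em => t2 tD.
    have h : (8 + t <= (300 * (310 * 1000) + 8) * (n * r ^ (3 + m %/ 5)))%N.
      by move: X mc; move: (n * _)%N (main_cost _ _ _ _) tD => x y *; lia.
    by apply: leq_trans h _; rewrite leq_mul2r C1 orbT.
  apply: (@le_trans _ _ ((C * (n * r ^ (3 + m %/ 5)))%N%:R)); first by rewrite ler_nat.
  rewrite natrM natrM; apply: ler_wpM2l => //; apply: ler_wpM2l => //.
  rewrite natrX -powR_mulrn //.
  apply: ler_powR; first by rewrite ler1n.
  rewrite natrD lerD2l ler_pdivlMr // -natrM ler_nat.
  exact: leq_divM.
- have L3 : (3 <= L)%N.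
    have : (1 * 2 <= n * r)%N by apply: leq_mul.
    by rewrite eL /base; lia.
  have SL : (14 * S <= C * L)%N.
    by rewrite /S -eL mulnA leq_mul2r; apply/orP; right; lia.
  have WL : (S ^ 40 <= L ^ C)%N.
    apply: (@leq_trans ((L ^ 3) ^ 40)%N).
      by rewrite leq_exp2r // /S -eL !expnS expn0; nia.
    by rewrite -expnM; apply: leq_pexp2l; lia.
  have wW c : words_at_most (S ^ 40) c -> words_at_most (R := R) (L ^ C) c.
    by move=> h k; case: (h k) => a b; split; apply: leq_trans WL.
  move=> k; rewrite leq_eqVlt => /orP[/eqP->|kt].
    rewrite run2; split; last by apply/wW/(sim_words sim2).
    by rewrite /accesses_below onth_default.
  have [a b] := safe2 k kt; split; last exact: wW.
  exact: accesses_below_mono SL a.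
Qed.
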